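(* The complete list of minor-minimal graphs with spectator floor $2$ is $C_2\sqcup C_2$, $C_2\sqcup K_{1,3}$, $K_{1,3}\sqcup K_{1,3}$, $C_4$, $H_1$, $H_2$, $H_3$, $H_4$, $H_5$, $K_{1,4}$, and the long $Y$.
   Context: All graphs are finite, have at least one vertex, have no loops, and may have multiple (parallel) edges. $C_2$ is two vertices joined by two parallel edges. The long $Y$ is the tree on 7 vertices consisting of a central vertex with three disjoint paths of length 2 attached to it. The $3$-sun is a triangle with one pendant vertex attached to each triangle vertex. $H_1$ is $K_3$ with every edge doubled. $H_2$ is $K_{1,3}$ with two of its edges doubled. $H_3$ is obtained from a $K_3$ and a $C_2$ by identifying one vertex of each. $H_4$ is obtained from the $3$-sun by contracting one edge of its triangle (keeping the resulting parallel edges), i.e. vertices $x,e$ joined by two parallel edges, two pendant vertices attached to $x$ and one pendant vertex attached to $e$. $H_5$ has vertices $a,b,c,d,e$ with edges $ac$, $bc$, $cd$ and two parallel edges between $d$ and $e$. A minor of $H$ is any graph obtained from $H$ by a sequence of: deleting an isolated vertex, deleting an edge, contracting an edge that has no edge parallel to it. A graph is minor-minimal with spectator floor $k$ if it has spectator floor $k$ and no proper minor has spectator floor $k$. A unique shortest path is a shortest $u$–$v$ path $P$ such that every $u$–$v$ path with the same number of vertices is identical to $P$, where two paths with different edge sequences are different even if their vertex sequences agree; a single vertex is a unique shortest path. The parade number $\mathrm{usp}(G)$ is the largest number of vertices of a unique shortest path in $G$. The spectator number is $\mathrm{sp}(G)=|V(G)|-\mathrm{usp}(G)$. The spectator floor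 $\lfloor \mathrm{sp}\rfloor(G)$ is the minimum of $\mathrm{sp}(H)$ over all graphs $H$ of which $G$ is a minor. *)

(* Defs.v *)
From mathcomp Require Import all_boot.
Set Implicit Arguments. Unset Strict Implicit. Unset Printing Implicit Defensive.

(* A multigraph: vertices 0..gn-1, edges = a list of (endpoint pairs);
   each list entry is a distinct edge, so repeated entries are parallel edges.
   Edges are undirected: (a,b) and (b,a) denote the same kind of edge. *)
Record mgraph := MGraph { gn : nat; ge : seq (nat * nat) }.

Definition wf (G : mgraph) : Prop :=
  0 < gn G /\
  all (fun e : nat * nat => [&& e.1 < gn G, e.2 < gn G & e.1 != e.2]) (ge G).

Definition enorm (e : nat * nat) : nat * nat := (minn e.1 e.2, maxn e.1 e.2).

Definition iso (G H : mgraph) : Prop :=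
  gn G = gn H /\
  exists f : nat -> nat,
    (forall x, x < gn G -> f x < gn H) /\
    {in [pred x | x < gn G] &, injective f} /\
    perm_eq [seq enorm (f e.1, f e.2) | e <- ge G] [seq enorm e | e <- ge H].

(* relabelling after removing vertex v *)
Definition shiftv (v x : nat) : nat := if x < v then x else x.-1.

Definition drop_edge (s : seq (nat * nat)) (i : nat) := take i s ++ drop i.+1 s.

Inductive step : mgraph -> mgraph -> Prop :=
  | step_del_edge G i : i < size (ge G) ->
      step G (MGraph (gn G) (drop_edge (ge G) i))
  | step_del_vertex G v : v < gn G -> 1 < gn G ->
      all (fun e : nat * nat => (e.1 != v) && (e.2 != v)) (ge G) ->
      step G (MGraph (gn G).-1
                [seq (shiftv v e.1, shiftv v e.2) | e <- ge G])
  | step_contract G i : i < size (ge G) ->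
      (forall j, j < size (ge G) -> j != i ->
         enorm (nth (0,0) (ge G) j) != enorm (nth (0,0) (ge G) i)) ->
      let a := (nth (0,0) (ge G) i).1 in
      let b := (nth (0,0) (ge G) i).2 in
      let f := fun x => shiftv b (if x == b then a else x) in
      step G (MGraph (gn G).-1
                [seq (f e.1, f e.2) | e <- drop_edge (ge G) i]).

Inductive reach : mgraph -> mgraph -> Prop :=
  | reach_refl G : reach G G
  | reach_step G1 G2 G3 : step G1 G2 -> reach G2 G3 -> reach G1 G3.

Definition minor (G H : mgraph) : Prop :=
  exists G', reach H G' /\ iso G G'.

Definition proper_minor (G H : mgraph) : Prop :=
  exists G1 G', step H G1 /\ reach G1 G' /\ iso G G'.

Definition joins (G : mgraph) (i x y : nat) : bool :=
  (i < size (ge G)) &&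
  ((nth (0,0) (ge G) i == (x, y)) || (nth (0,0) (ge G) i == (y, x))).

Definition is_path (G : mgraph) (u v : nat) (vs es : seq nat) : Prop :=
  [/\ size vs = (size es).+1,
      nth 0 vs 0 = u,
      nth 0 vs (size es) = v &
      uniq vs] /\
  all (fun x => x < gn G) vs /\
  (forall i, i < size es -> joins G (nth 0 es i) (nth 0 vs i) (nth 0 vs i.+1)).

Definition is_usp (G : mgraph) (u v : nat) (vs es : seq nat) : Prop :=
  [/\ is_path G u v vs es,
      (forall vs' es', is_path G u v vs' es' -> size vs <= size vs') &
      (forall vs' es', is_path G u v vs' es' -> size vs' = size vs ->
         vs' = vs /\ es' = es)].

Definition parade_number (G : mgraph) (m : nat) : Prop :=
  (exists u v vs es, is_usp G u v vs es /\ size vs = m) /\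
  (forall u v vs es, is_usp G u v vs es -> size vs <= m).

Definition spectator_number (G : mgraph) (k : nat) : Prop :=
  exists m, parade_number G m /\ k = gn G - m.

Definition spectator_floor (G : mgraph) (k : nat) : Prop :=
  (exists H, wf H /\ minor G H /\ spectator_number H k) /\
  (forall H s, wf H -> minor G H -> spectator_number H s -> k <= s).

Definition minor_minimal_floor (G : mgraph) (k : nat) : Prop :=
  spectator_floor G k /\
  forall G', wf G' -> proper_minor G' G -> ~ spectator_floor G' k.

Definition C2_C2 := MGraph 4 [:: (0,1); (0,1); (2,3); (2,3)].
Definition C2_K13 := MGraph 6 [:: (0,1); (0,1); (2,3); (2,4); (2,5)].
Definition K13_K13 := MGraph 8 [:: (0,1); (0,2); (0,3); (4,5); (4,6); (4,7)].
Definition C4 := MGraph 4 [:: (0,1); (1,2); (2,3); (3,0)].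
Definition H1 := MGraph 3 [:: (0,1); (0,1); (1,2); (1,2); (0,2); (0,2)].
Definition H2 := MGraph 4 [:: (0,1); (0,1); (0,2); (0,2); (0,3)].
Definition H3 := MGraph 4 [:: (0,1); (1,2); (0,2); (0,3); (0,3)].
Definition H4 := MGraph 5 [:: (0,1); (0,1); (0,2); (0,3); (1,4)].
Definition H5 := MGraph 5 [:: (0,2); (1,2); (2,3); (3,4); (3,4)].
Definition K14 := MGraph 5 [:: (0,1); (0,2); (0,3); (0,4)].
Definition longY := MGraph 7 [:: (0,1); (1,2); (0,3); (3,4); (0,5); (5,6)].

(* Main.v *)
(* A graph has spectator floor at most 1 iff, for some vertex w, the other vertices can be placed
   on a line so that the edges among them are simple and join neighbouring positions, and the
   neighbours of w lie at two consecutive positions: filling in the line gives a path that is a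
   unique shortest path missing only w.  Such graphs are closed under minors, so the theorem lists
   the minor-minimal graphs G outside this class.

   If G is disconnected, minimality forces both sides of a cut not to be linear forests, hence each
   has C_2 or K_{1,3} as a minor, and G is one of the three disjoint unions.  If G is connected and
   has an edge e without parallels, G/e is in the class; being connected it is a path together with
   w.  Two adjacent vertices of degree 2 outside a triangle can be contracted without entering the
   class, so they do not occur in G; this bounds the path, and G is found by computation among the
   finitely many ways of undoing the contraction.  If every edge of G is doubled, G has at most
   five vertices and is again found by computation. *)
Require Import Defs.
From mathcomp Require Import all_boot.
From mathcomp Require Import zify.
From Stdlib Require Import Classical_Prop.
Set Implicit Arguments. Unset Strict Implicit. Unset Printing Implicit Defensive.

(** A vertex off a unique shortest path whose neighbours on the path are two or more positions apart
    would give a competing path that is no longer. This is the origin of the two consecutive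
    positions; multiplicities at w stay free because the path never passes through w. Floor exactly
    2 asks for more than lying outside the class: each listed graph also needs a host with two
    spectators. Conversely, a minor of G inherits the host of G, so minimality with floor 2 turns
    into minimality outside the class. Contraction is forbidden on edges with parallels, so in a
    graph with every edge doubled nothing can be contracted; there, deleting one copy of an edge
    takes over the role of the contraction. Steps act on edge lists and renumber vertices, while the
    class depends on multiplicities only. The arguments therefore run on a multiplicity function
    over a vertex predicate, where a contraction leaves the other vertices their names. *)

Definition mu (G : mgraph) (u v : nat) : nat :=
  count (fun e => enorm e == enorm (u, v)) (ge G).

(** * Effect of a step on edge multiplicities *)

Definition del_edge (G : mgraph) i := MGraph (gn G) (drop_edge (ge G) i).
Definition del_vertex (G : mgraph) v :=
  MGraph (gn G).-1 [seq (shiftv v e.1, shiftv v e.2) | e <- ge G].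
Definition contract (G : mgraph) i :=
  let a := (nth (0,0) (ge G) i).1 in
  let b := (nth (0,0) (ge G) i).2 in
  let f := fun x => shiftv b (if x == b then a else x) in
  MGraph (gn G).-1 [seq (f e.1, f e.2) | e <- drop_edge (ge G) i].
Definition contractible (G : mgraph) i :=
  let e := nth (0,0) (ge G) i in mu G e.1 e.2 == 1.

Lemma enorm_eq p q x y : (enorm (p, q) == enorm (x, y)) =
  (p == x) && (q == y) || (p == y) && (q == x).
Proof. rewrite /enorm xpair_eqE /=; lia. Qed.

Lemma enormC p q : enorm (p, q) = enorm (q, p).
Proof. by rewrite /enorm /= minnC maxnC. Qed.

Lemma muC G u v : mu G u v = mu G v u.
Proof. by rewrite /mu enormC. Qed.

Lemma wf_edge G e : wf G -> e \in ge G -> [&& e.1 < gn G, e.2 < gn G & e.1 != e.2].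
Proof. by case=> _ /allP h /h. Qed.

Lemma mu_pos G u v : wf G -> 0 < mu G u v -> [&& u < gn G, v < gn G & u != v].
Proof.
move=> wG; rewrite /mu -has_count => /hasP [[p q] /(wf_edge wG) /=].
rewrite enorm_eq; lia.
Qed.

Lemma muii G u : wf G -> mu G u u = 0.
Proof. by move=> wG; case E: (mu G u u) => //; have := @mu_pos G u u wG; rewrite E; lia. Qed.

Lemma nth_drop_edge (s : seq (nat * nat)) i : i < size s -> perm_eq s (nth (0,0) s i :: drop_edge s i).
Proof.
move=> h; rewrite -{1}(cat_take_drop i s) (drop_nth (0,0) h) /drop_edge.
by rewrite perm_catC /= perm_cons perm_catC.
Qed.

Lemma count_drop_edge p (s : seq (nat * nat)) i : i < size s ->
  count p s = p (nth (0,0) s i) + count p (drop_edge s i).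
Proof. by move=> h; rewrite (permP (nth_drop_edge h)). Qed.

Lemma mu_del_edge G i u v : i < size (ge G) ->
  mu (del_edge G i) u v = mu G u v - (enorm (nth (0,0) (ge G) i) == enorm (u, v)).
Proof. by move=> h; rewrite /mu (count_drop_edge _ h) addKn. Qed.

Lemma mem_drop_edge (s : seq (nat * nat)) i e : e \in drop_edge s i -> e \in s.
Proof. by rewrite /drop_edge mem_cat => /orP [/mem_take|/mem_drop]. Qed.

Lemma mu_del_vertex G v x y :
  all (fun e : nat * nat => (e.1 != v) && (e.2 != v)) (ge G) ->
  mu (del_vertex G v) x y = mu G (bump v x) (bump v y).
Proof.
move/allP=> h; rewrite /mu count_map; apply: eq_in_count => -[p q] /h /=.
rewrite !enorm_eq /shiftv /bump; do 2 case: ifP; lia.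
Qed.

(* b is merged into a *)
Definition merge_mult a b (m : nat -> nat -> nat) x y :=
  if x == a then m a y + m b y else if y == a then m x a + m x b else m x y.

Lemma merge_mult_edge a b x y p q : a != b -> x != y -> x != b -> y != b ->
  (enorm (if p == b then a else p, if q == b then a else q) == enorm (x, y)) =
    merge_mult a b (fun u v => enorm (p, q) == enorm (u, v)) x y :> nat.
Proof.
move=> ab xy xb yb; rewrite /merge_mult !enorm_eq.
case: (eqVneq p b) => pb; case: (eqVneq q b) => qb; case: (eqVneq x a) => Xa;
  case: (eqVneq y a) => Ya; subst;
  repeat (case: eqP => ? /=); subst => //; lia.
Qed.

Lemma mu_contract_edge a b x y p q : a != b -> x != y ->
  let f := fun x => shiftv b (if x == b then a else x) in
  (enorm (f p, f q) == enorm (x, y)) =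
    merge_mult a b (fun u v => enorm (p, q) == enorm (u, v)) (bump b x) (bump b y) :> nat.
Proof.
move=> ab xy f; have sh z t : (f z == t) = ((if z == b then a else z) == bump b t).
  by rewrite /f /shiftv /bump; case: (eqVneq z b) => zb; case: ifP; lia.
rewrite -merge_mult_edge //; try by move: xy; rewrite /bump; lia.
by rewrite !enorm_eq !sh.
Qed.

Lemma mu_contract G i x y : wf G -> i < size (ge G) -> x != y ->
  let e := nth (0,0) (ge G) i in
  mu (contract G i) x y = merge_mult e.1 e.2 (mu G) (bump e.2 x) (bump e.2 y).
Proof.
move=> wG hi xy e.
have := wf_edge wG (mem_nth (0,0) hi); rewrite -/e => /and3P [e1 e2 e12].
(* The contracted edge counts only towards the pair of its ends, which merging sends to the diagonal
   entry at [e.1]; for distinct [x] and [y] it can be left out of the count. *)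
have -> : merge_mult e.1 e.2 (mu G) (bump e.2 x) (bump e.2 y) =
    merge_mult e.1 e.2 (fun u v => count (fun d => enorm d == enorm (u, v)) (drop_edge (ge G) i))
      (bump e.2 x) (bump e.2 y).
  rewrite /merge_mult /mu !(count_drop_edge _ hi) -/e.
  have -> : e = (e.1, e.2) by case: (e).
  rewrite /= !enorm_eq /bump; repeat (case: ifP => ?); lia.
rewrite /mu /contract /= count_map -/e.
elim: (drop_edge _ _) => [|[p q] s IH] /=; first by rewrite /merge_mult; repeat case: ifP.
rewrite IH (mu_contract_edge _ _ e12 xy).
by rewrite /merge_mult; case: ifP => _; [|case: ifP => _]; rewrite /= ?addnA 1?addnACA -?addnA; lia.
Qed.

(** * The one-spectator class and its closure under contraction *)

Definition adj (p q : nat) : bool := (p == q.+1) || (q == p.+1).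

(* W holds for at most one vertex of V, the spectator, which is off the line. *)
Definition one_spectator_order (V W : pred nat) (m : nat -> nat -> nat) (i : nat) (pos : nat -> nat) : Prop :=
  [/\ forall x y, V x -> V y -> W x -> W y -> x = y,
      forall x y, V x -> V y -> ~~ W x -> ~~ W y -> pos x = pos y -> x = y,
      forall x y, V x -> V y -> ~~ W x -> ~~ W y -> x != y -> m x y <= adj (pos x) (pos y) &
      forall x y, V x -> V y -> W x -> ~~ W y -> 0 < m x y -> (pos y == i) || (pos y == i.+1)].

Definition one_spectator_on V m := exists W i pos, one_spectator_order V W m i pos.

Definition one_spectator G := one_spectator_on (fun x => x < gn G) (mu G).

Definition linear_forest (V : pred nat) (m : nat -> nat -> nat) := exists pos : nat -> nat,
  (forall x y, V x -> V y -> pos x = pos y -> x = y) /\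
  (forall x y, V x -> V y -> x != y -> m x y <= adj (pos x) (pos y)).

(** This is where it helps that [W] may be empty on the vertex set: the spectator of the larger
    graph may have no preimage under [g]. *)
Lemma one_spectator_sub (V' V : pred nat) (m' m : nat -> nat -> nat) (g : nat -> nat) :
  (forall x, V' x -> V (g x)) ->
  (forall x y, V' x -> V' y -> g x = g y -> x = y) ->
  (forall x y, V' x -> V' y -> x != y -> m' x y <= m (g x) (g y)) ->
  one_spectator_on V m -> one_spectator_on V' m'.
Proof.
move=> gV gi gm [W [i [pos [h1 h2 h3 h4]]]].
exists (fun x => W (g x)), i, (fun x => pos (g x)); split => x y Vx Vy.
- by move=> Wx Wy; apply: gi => //; apply: h1 => //; apply: gV.
- by move=> Wx Wy e; apply: gi => //; apply: h2 => //; apply: gV.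
- move=> Wx Wy ne; apply: leq_trans (gm _ _ Vx Vy ne) _; apply: h3 => //; try exact: gV.
  by apply: contra ne => /eqP /gi ->.
- move=> Wx Wy p; apply: (h4 (g x)) => //; try exact: gV.
  by apply: leq_trans p (gm _ _ Vx Vy _); apply/eqP => e; move: Wy; rewrite -e Wx.
Qed.

Lemma linear_forest_sub (V' V : pred nat) (m' m : nat -> nat -> nat) :
  (forall x, V' x -> V x) ->
  (forall x y, V' x -> V' y -> x != y -> m' x y <= m x y) ->
  linear_forest V m -> linear_forest V' m'.
Proof.
move=> VV mm [pos [h1 h2]]; exists pos; split => x y Vx Vy.
  by apply: h1; apply: VV.
by move=> ne; apply: leq_trans (mm _ _ Vx Vy ne) _; apply: h2 => //; apply: VV.
Qed.

(** If one end of the edge is the spectator, the merged vertex becomes the spectator and the other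
    end leaves the line. Otherwise the ends are consecutive on the line and collapse to one
    position. *)
Lemma one_spectator_contract (V : pred nat) m a b :
  (forall x y, m x y = m y x) -> V a -> V b -> a != b -> 0 < m a b ->
  one_spectator_on V m -> one_spectator_on (fun x => V x && (x != b)) (merge_mult a b m).
Proof.
move=> mC Va Vb ab mab [W [i [pos [h1 h2 h3 h4]]]].
have h2' x y : V x -> V y -> ~~ W x -> ~~ W y -> x != y -> pos x != pos y.
  by move=> Vx Vy Wx Wy; apply: contra => /eqP /(h2 _ _ Vx Vy Wx Wy) ->.
have [Wab|] := boolP (W a || W b).
  pose d := if W a then b else a.
  have Wd : ~~ W d.
    rewrite /d; case Wa: (W a); last by rewrite Wa.
    by apply/negP => Wb; move: ab; rewrite (h1 a b Va Vb Wa Wb) eqxx.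
  have Vd : V d by rewrite /d; case: ifP.
  pose o := if W a then a else b.
  have Wo : W o by rewrite /o; case: ifP Wab.
  have Vo : V o by rewrite /o; case: ifP.
  have mod : 0 < m o d by rewrite /o /d; case: ifP; rewrite // mC.
  have ma y : m a y + m b y = m o y + m d y by rewrite /o /d; case: ifP; rewrite // addnC.
  have pd := h4 o d Vo Vd Wo Wd mod.
  have od x : V x -> x != a -> x != b -> ~~ W x /\ pos x != pos d.
    move=> Vx xa xb; suff Wx : ~~ W x by split=> //; apply: h2' => //; rewrite /d; case: ifP.
    apply/negP => Wx; move: (h1 x o Vx Vo Wx Wo); rewrite /o.
    by case: ifP => _ e; move: xa xb; rewrite e eqxx.
  (* The position of [d] is closed up, which brings the line neighbours of [d] to [(pos d).-1] and
     [pos d]. A further neighbour of [o] lands there too, because [pos d] is one of the two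
     consecutive positions open to neighbours of [o]. *)
  exists (pred1 a), (pos d).-1, (fun x => if pos x <= pos d then pos x else (pos x).-1).
  split => x y /andP [Vx xb] /andP [Vy yb] /=.
  - by move=> /eqP -> /eqP ->.
  - move=> xa ya; have [Wx xd] := od x Vx xa xb; have [Wy yd] := od y Vy ya yb => e.
    apply: (h2 x y) => //.
    by move: (pos x) (pos y) (pos d) xd yd e => p q r; clear; do 2 case: ifP; lia.
  - move=> xa ya xy; have [Wx xd] := od x Vx xa xb; have [Wy yd] := od y Vy ya yb.
    rewrite /merge_mult (negbTE xa) (negbTE ya); move: (h3 x y Vx Vy Wx Wy xy).
    move: (m x y) (pos x) (pos y) (pos d) xd yd => M p q r; rewrite /adj; clear.
    by do 2 case: ifP; lia.
  - move=> /eqP -> ya; rewrite /merge_mult eqxx ma => mp; have [Wy yd] := od y Vy ya yb.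
    have f3 := h3 d y Vd Vy Wd Wy; have f4 := h4 o y Vo Vy Wo Wy.
    have dy : d != y by apply: contraNneq yd => ->.
    move: {f3}(f3 dy) f4 mp yd pd.
    move: (m o y) (m d y) (pos y) (pos d) => M M' p r; rewrite /adj; clear.
    by case: (posnP M) => [->|M0 _ /(_ isT)]; case: ifP; lia.
rewrite negb_or => /andP [Wa Wb].
have := h3 a b Va Vb Wa Wb ab; rewrite /adj => pab.
have {}pab : (pos a == (pos b).+1) || (pos b == (pos a).+1) by lia.
(* [k] collapses the positions [c] and [c.+1] of the two ends to [c]. It is monotone with steps of
   at most one, so [i] and [i.+1] are sent to [k i] or its successor. *)
pose c := minn (pos a) (pos b); have [k kE] : exists k, forall t, k t = if t <= c then t else t.-1 by eexists.
have pc : (pos a == c) && (pos b == c.+1) || (pos a == c.+1) && (pos b == c).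
  by rewrite /c; lia.
have off x : V x -> ~~ W x -> x != a -> x != b -> (pos x != c) && (pos x != c.+1).
  move=> Vx Wx xa xb; have := h2' x a Vx Va Wx Wa xa; have := h2' x b Vx Vb Wx Wb xb; lia.
have ka : k (pos a) = c by rewrite kE; case: ifP; lia.
have kadj p q : (p != c) && (p != c.+1) -> (q != c) && (q != c.+1) -> adj p q -> adj (k p) (k q).
  by rewrite !kE /adj; do 2 case: ifP; lia.
have kadjc q M M' : (q != c) && (q != c.+1) -> M <= adj (pos a) q -> M' <= adj (pos b) q ->
    M + M' <= adj c (k q).
  by rewrite kE /adj; case: ifP; lia.
clearbody c.
exists W, (k i), (fun x => k (pos x)); split => x y /andP [Vx xb] /andP [Vy yb].
- exact: h1.
- move=> Wx Wy; case: (eqVneq x a) => xa; case: (eqVneq y a) => ya; rewrite ?xa ?ya //.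
  + by have := off y Vy Wy ya yb; rewrite ka kE; case: ifP; lia.
  + by have := off x Vx Wx xa xb; rewrite ka kE; case: ifP; lia.
  + move=> e; apply: h2 => //; move: e.
    by have := off x Vx Wx xa xb; have := off y Vy Wy ya yb; rewrite !kE; do 2 case: ifP; lia.
- move=> Wx Wy xy; rewrite /merge_mult; case: (eqVneq x a) => xa; last case: (eqVneq y a) => ya.
  + subst x; rewrite ka; apply: kadjc; first by apply: off => //; rewrite eq_sym.
      exact: h3.
    by apply: h3 => //; rewrite eq_sym.
  + subst y; rewrite ka [adj _ _]orbC; apply: kadjc; first exact: off.
      by rewrite mC; apply: h3 => //; rewrite eq_sym.
    by rewrite mC; apply: h3 => //; rewrite eq_sym.
  + apply: leq_trans (h3 x y Vx Vy Wx Wy xy) _.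
    have := kadj _ _ (off x Vx Wx xa xb) (off y Vy Wy ya yb).
    by case: (adj _ _) => [->|].
- move=> Wx Wy; have xa : x != a by apply: contraNneq Wa => <-.
  rewrite /merge_mult (negbTE xa); case: (eqVneq y a) => ya.
    subst y; rewrite ka addn_gt0 => /orP [/(h4 x a Vx Va Wx Wa)|/(h4 x b Vx Vb Wx Wb)];
    by move: pc; rewrite !kE; clear -c; case: ifP; lia.
  move/(h4 x y Vx Vy Wx Wy); have := off y Vy Wy ya yb; rewrite !kE; clear -c.
  by do 2 case: ifP; lia.
Qed.

(** * Steps and isomorphisms *)

Lemma bump_shiftv v z : z != v -> bump v (shiftv v z) = z.
Proof. by rewrite /bump /shiftv; case: ifP; lia. Qed.

Lemma shiftv_lt v z n : z != v -> z < n -> v < n -> shiftv v z < n.-1.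
Proof. by rewrite /shiftv; case: ifP; lia. Qed.

Lemma shiftv_bump v z : shiftv v (bump v z) = z.
Proof. by rewrite /bump /shiftv; case: ifP; lia. Qed.

Lemma bump_lt v x n : v < n -> x < n.-1 -> bump v x < n.
Proof. rewrite /bump; lia. Qed.

Lemma bump_neq v x : bump v x != v.
Proof. rewrite /bump; lia. Qed.

Lemma shiftv_inj v x y : x != v -> y != v -> shiftv v x = shiftv v y -> x = y.
Proof. by move=> xv yv e; rewrite -(bump_shiftv xv) e bump_shiftv. Qed.

Lemma mem_drop_edgeP (s : seq (nat * nat)) i d :
  d \in drop_edge s i -> exists j, [/\ j < size s, j != i & d = nth (0,0) s j].
Proof.
rewrite /drop_edge mem_cat => /orP [] /(nthP (0,0)) [j hj <-]; move: hj.
  rewrite size_take_min leq_min => /andP [ji js]; exists j.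
  by rewrite nth_take //; split=> //; move: ji; clear; lia.
rewrite size_drop => hj; exists (i.+1 + j).
rewrite nth_drop; split=> //; last by clear; lia.
by move: hj; rewrite ltn_subRL.
Qed.

Lemma nth_mem_drop_edge (s : seq (nat * nat)) i j :
  j < size s -> j != i -> nth (0,0) s j \in drop_edge s i.
Proof.
move=> hj ji; rewrite /drop_edge mem_cat; apply/orP; case: (ltngtP j i) ji => // h _; [left|right].
  by rewrite -(nth_take (0,0) h); apply: mem_nth; rewrite size_take_min leq_min h.
rewrite -(subnKC h) -nth_drop; apply: mem_nth.
by rewrite size_drop ltn_sub2r // (leq_ltn_trans h).
Qed.

Lemma mu_nth G i : i < size (ge G) ->
  let e := nth (0,0) (ge G) i in
  mu G e.1 e.2 = 1 + count (fun d => enorm d == enorm e) (drop_edge (ge G) i).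
Proof.
by move=> hi e; rewrite /mu (count_drop_edge _ hi) -/e -surjective_pairing eqxx.
Qed.

Lemma contractibleP G i : i < size (ge G) ->
  (forall j, j < size (ge G) -> j != i ->
         enorm (nth (0,0) (ge G) j) != enorm (nth (0,0) (ge G) i)) <->
  mu G (nth (0,0) (ge G) i).1 (nth (0,0) (ge G) i).2 = 1.
Proof.
move=> hi; rewrite mu_nth //; split.
  move=> h; suff /eqP -> : count (fun d => enorm d == enorm (nth (0, 0) (ge G) i)) (drop_edge (ge G) i) == 0 by [].
  rewrite -leqn0 leqNgt -has_count; apply/hasP => -[d /mem_drop_edgeP [j [hj ji ->]]].
  by rewrite (negbTE (h j hj ji)).
move=> h j hj ji; apply/negP => e.
suff : 0 < count (fun d => enorm d == enorm (nth (0, 0) (ge G) i)) (drop_edge (ge G) i) by lia.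
by rewrite -has_count; apply/hasP; exists (nth (0,0) (ge G) j) => //; apply: nth_mem_drop_edge.
Qed.

Lemma mu_index G u v : 0 < mu G u v ->
  exists2 i, i < size (ge G) & enorm (nth (0,0) (ge G) i) = enorm (u, v).
Proof.
rewrite /mu -has_count => /hasP [e /(nthP (0,0)) [i hi <-]] /eqP h; by exists i.
Qed.

Lemma isolatedP G v : (forall x, mu G v x = 0) <->
  all (fun e : nat * nat => (e.1 != v) && (e.2 != v)) (ge G).
Proof.
split=> [h|/allP h x].
  apply/allP => -[p q] he /=; rewrite -negb_or; apply/negP => pq.
  have := h (if p == v then q else p); apply/eqP; rewrite -lt0n -has_count.
  by apply/hasP; exists (p, q) => //; rewrite enorm_eq; case: ifP pq; lia.
apply/eqP; rewrite -leqn0 leqNgt -has_count; apply/hasP => -[[p q] /h /=].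
rewrite enorm_eq; lia.
Qed.

(** A loop could come only from an edge parallel to the contracted one, and the contraction rule
    excludes these. *)
Lemma step_wf G G1 : step G G1 -> wf G -> wf G1.
Proof.
case=> {G G1} G.
- move=> i hi [n0 /allP h]; split=> //; apply/allP => e /mem_drop_edge; exact: h.
- move=> v hv n1 /allP h [n0 /allP h']; split=> /=; first by lia.
  apply/allP => _ /mapP [[p q] e ->] /=; have := h _ e; have := h' _ e => /=.
  by rewrite /shiftv; do 2 case: ifP; lia.
- move=> i hi /(contractibleP hi) hm a b f wG.
  have := wf_edge wG (mem_nth (0,0) hi); rewrite -/a -/b => /and3P [an bn ab].
  split=> /=; first by lia.
  apply/allP => _ /mapP [[p q] he ->] /=.
  have /= /and3P [pn qn pq] := wf_edge wG (mem_drop_edge he).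
  pose t x := if x == b then a else x.
  have tn x : x < gn G -> t x < gn G by rewrite /t; case: ifP.
  have tb x : t x != b by rewrite /t; case: ifP => // ->.
  rewrite /f -/(t p) -/(t q) !shiftv_lt ?tn ?tb //=.
  apply/eqP => /shiftv_inj; rewrite !tb => /(_ isT isT) tt.
  have ne : enorm (p, q) = enorm (a, b).
    by apply/eqP; rewrite enorm_eq; move: tt; rewrite /t; do 2 case: eqP; lia.
  have [j [hj ji e]] := mem_drop_edgeP he.
  have := proj2 (contractibleP hi) hm j hj ji; rewrite -e ne.
  by rewrite -surjective_pairing eqxx.
Qed.

Lemma step_one_spectator G G1 : wf G -> step G G1 -> one_spectator G -> one_spectator G1.
Proof.
move=> wG s; case: s wG => {G G1} G.
- move=> i hi wG; apply: (@one_spectator_sub _ _ _ _ id) => // x y _ _ _.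
  by rewrite (@mu_del_edge G i) // leq_subr.
- move=> v hv n1 h wG; apply: (@one_spectator_sub _ _ _ _ (bump v)) => /= [x|x y _ _|x y _ _ _].
  + exact: bump_lt.
  + exact: (can_inj (bumpK v)).
  + by rewrite (@mu_del_vertex G v).
- move=> i hi /(contractibleP hi) hm a b f wG.
  have := wf_edge wG (mem_nth (0,0) hi); rewrite -/a -/b => /and3P [an bn ab] cG.
  have := @one_spectator_contract _ (mu G) a b (muC G) an bn ab _ cG; rewrite hm => /(_ isT).
  apply: (@one_spectator_sub _ _ _ _ (bump b)) => /= [x xn|x y _ _|x y _ _ xy].
  + by rewrite bump_neq bump_lt.
  + exact: (can_inj (bumpK b)).
  + by rewrite (@mu_contract G i).
Qed.

Lemma inj_surj n (f : nat -> nat) :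
  (forall x, x < n -> f x < n) -> {in [pred x | x < n] &, injective f} ->
  forall y, y < n -> exists2 x, x < n & f x = y.
Proof.
move=> fn fi y yn.
have u : uniq (map f (iota 0 n)).
  rewrite map_inj_in_uniq ?iota_uniq // => a b; rewrite !mem_iota => an bn; exact: fi.
have sub : {subset map f (iota 0 n) <= iota 0 n}.
  by move=> z /mapP [a]; rewrite mem_iota => /andP [_ an] ->; rewrite mem_iota /= fn.
have [|_ e] := uniq_min_size u sub; first by rewrite size_map.
have : y \in iota 0 n by rewrite mem_iota.
by rewrite -e => /mapP [x]; rewrite mem_iota => /andP [_ xn] ->; exists x.
Qed.

(** Isomorphism read off multiplicities, free of the order of the edge list and of the orientation
    of its entries. *)
Definition isomu G H f := [/\ gn G = gn H, forall x, x < gn G -> f x < gn H,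
   {in [pred x | x < gn G] &, injective f} &
   forall x y, x < gn G -> y < gn G -> mu H (f x) (f y) = mu G x y].

Lemma enorm_inj_eq (V : pred nat) (f : nat -> nat) p q x y : {in V &, injective f} ->
  p \in V -> q \in V -> x \in V -> y \in V ->
  (enorm (f p, f q) == enorm (f x, f y)) = (enorm (p, q) == enorm (x, y)).
Proof.
by move=> fi Vp Vq Vx Vy; rewrite !enorm_eq !(inj_in_eq fi).
Qed.

Lemma iso_wf G H : wf G -> iso G H -> wf H.
Proof.
move=> wG [en [f [fn [fi fp]]]]; split; first by rewrite -en; case: wG.
apply/allP => -[p q] he; have : enorm (p, q) \in [seq enorm e | e <- ge H] by apply: map_f.
rewrite -(perm_mem fp) => /mapP [[a b] hab] /= /eqP.
have /= /and3P [an bn ab] := wf_edge wG hab.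
have fa := fn a an; have fb := fn b bn; have := fi a b an bn; rewrite enorm_eq.
by case: (eqVneq (f a) (f b)) => [e /(_ e)|]; move: ab fa fb; clear; lia.
Qed.

Lemma iso_isomu G H : wf G -> iso G H -> exists f, isomu G H f.
Proof.
move=> wG [en [f [fn [fi fp]]]]; exists f; split=> // x y xn yn.
rewrite /mu -(count_map enorm (pred1 (enorm (f x, f y)))) -(permP fp) count_map.
apply: eq_in_count => -[p q] /(wf_edge wG) /= /and3P [pn qn _].
exact: (@enorm_inj_eq [pred x | x < gn G]).
Qed.

Lemma isomu_iso G H f : wf G -> wf H -> isomu G H f -> iso G H.
Proof.
move=> wG wH [en fn fi fm]; split=> //; exists f; split=> //; split=> //.
have fs y : y < gn H -> exists2 x, x < gn G & f x = y.
  by rewrite -en => yn; apply: inj_surj yn => // x; rewrite {2}en; apply: fn.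
have key x y : x < gn G -> y < gn G ->
   count_mem (enorm (f x, f y)) [seq enorm (f e.1, f e.2) | e <- ge G] =
   count_mem (enorm (f x, f y)) [seq enorm e | e <- ge H].
  move=> xn yn; rewrite !count_map; transitivity (mu G x y).
    apply: eq_in_count => -[p q] /(wf_edge wG) /= /and3P [pn qn _].
    exact: (@enorm_inj_eq [pred x | x < gn G]).
  by rewrite -fm.
apply/allP => k; rewrite mem_cat => /orP [] /mapP [[p q] he ->] /=.
  by have /= /and3P [pn qn _] := wf_edge wG he; rewrite key.
have /= /and3P [/fs [x xn <-] /fs [y yn <-] _] := wf_edge wH he.
by rewrite key.
Qed.

Lemma isomu_sym G H f : isomu G H f -> exists g, isomu H G g /\
  (forall x, x < gn G -> g (f x) = x) /\ (forall y, y < gn H -> f (g y) = y).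
Proof.
move=> [en fn fi fm].
have fs y : y < gn H -> exists2 x, x < gn G & f x = y.
  by rewrite -en => yn; apply: inj_surj yn => // x; rewrite {2}en; apply: fn.
pose g y := nth 0 (iota 0 (gn G)) (find (fun x => f x == y) (iota 0 (gn G))).
have gP y : y < gn H -> g y < gn G /\ f (g y) = y.
  move=> /fs [x xn xy]; have h : has (fun x => f x == y) (iota 0 (gn G)).
    by apply/hasP; exists x; rewrite ?mem_iota ?xy.
  split; last by apply/eqP/(nth_find 0 h).
  have hf : find (fun x => f x == y) (iota 0 (gn G)) < gn G.
    by rewrite -[X in _ < X](size_iota 0 (gn G)) -has_find.
  by rewrite /g nth_iota.
exists g; split; [split|split]=> //.
- by move=> y /gP [].
- by move=> x y /gP [_ e] /gP [_ e'] xy; rewrite -e xy e'.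
- move=> x y /gP [xn e] /gP [yn e']; by rewrite -fm // e e'.
- by move=> x xn; have [h1 h2] := gP _ (fn x xn); apply: fi.
- by move=> y /gP [].
Qed.

Lemma iso_sym G H : wf G -> iso G H -> iso H G.
Proof.
move=> wG i; have wH := iso_wf wG i; have [f /isomu_sym [g [h _]]] := iso_isomu wG i.
exact: isomu_iso h.
Qed.

Lemma iso_trans G H K : wf G -> iso G H -> iso H K -> iso G K.
Proof.
move=> wG i1 i2; have wH := iso_wf wG i1; have wK := iso_wf wH i2.
have [f [e1 f1 f2 f3]] := iso_isomu wG i1; have [g [e2 g1 g2 g3]] := iso_isomu wH i2.
apply: (@isomu_iso _ _ (g \o f)) => //; split=> /=; first by rewrite e1.
- by move=> x /f1 /g1.
- by move=> x y xn yn /g2; rewrite !inE => h; apply: f2 => //; apply: h; apply: f1.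
- by move=> x y xn yn; rewrite g3 ?f1 // f3.
Qed.

Lemma iso_refl G : iso G G.
Proof.
split=> //; exists id; split; [by [] | split; first by []].
have -> : [seq enorm (id e.1, id e.2) | e <- ge G] = [seq enorm e | e <- ge G] by apply: eq_map => -[].
exact: perm_refl.
Qed.

Lemma iso_one_spectator G H : wf G -> iso G H -> one_spectator H -> one_spectator G.
Proof.
move=> wG /(iso_isomu wG) [f [en fn fi fm]].
by apply: (@one_spectator_sub _ _ _ _ f) => // x y xn yn _; rewrite fm.
Qed.

(** Any edge of [H] between the images of the ends will do, since parallel edges are
    interchangeable. Only the orientation of a contracted edge needs care. *)
Lemma step_iso G H G1 : wf G -> iso G H -> step G G1 ->
  exists2 H1, step H H1 & iso G1 H1.
Proof.
move=> wG i s; have wH := iso_wf wG i; have wG1 := step_wf s wG.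
have [f [en fn fi fm]] := iso_isomu wG i.
suff [H1 sH [g gi]] : exists2 H1, step H H1 & exists g, isomu G1 H1 g.
  by exists H1 => //; apply: isomu_iso gi => //; apply: step_wf sH wH.
have fnot v x : v < gn G -> x < gn G -> x != v -> f x != f v.
  by move=> vn xn; apply: contra => /eqP /fi -> //; apply: eqxx.
have fb v x : v < gn G -> x < (gn G).-1 -> f (bump v x) < gn H /\ f (bump v x) != f v.
  by move=> vn xn; rewrite fn ?fnot ?bump_neq ?bump_lt.
have fs y : y < gn H -> exists2 x, x < gn G & f x = y.
  by rewrite -en => yn; apply: inj_surj yn => // x; rewrite {2}en; apply: fn.
case: s wG wG1 en fn fi fm fnot fb fs {i} => {G G1} G.
- move=> i hi wG _ en fn fi fm _ _ _.
  have := wf_edge wG (mem_nth (0,0) hi); set e := nth _ _ _ => /and3P [e1 e2 e12].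
  have : 0 < mu H (f e.1) (f e.2) by rewrite fm // mu_nth.
  case/mu_index=> j hj ej; exists (del_edge H j); first exact: step_del_edge.
  exists f; split=> // x y xn yn.
  rewrite (@mu_del_edge G i) // mu_del_edge // fm // ej -/e; congr (_ - _).
  by rewrite (@enorm_inj_eq [pred x | x < gn G]) // -surjective_pairing.
- move=> v vn n1 /isolatedP iv wG _ en fn fi fm fnot fb fs.
  have ih : all (fun e : nat * nat => (e.1 != f v) && (e.2 != f v)) (ge H).
    apply/isolatedP => y; case: (ltnP y (gn H)) => [yn|yn].
      by have [x xn <-] := fs y yn; rewrite fm.
    apply/eqP; rewrite -leqn0 leqNgt; apply/negP => /(mu_pos wH); lia.
  exists (del_vertex H (f v)); first by apply: step_del_vertex => //; [exact: fn | rewrite -en].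
  exists (fun x => shiftv (f v) (f (bump v x))); split; rewrite /= ?en //.
  + by move=> x; rewrite -?en => xn; have [h1 h2] := fb v x vn xn; rewrite en; apply: shiftv_lt => //; apply: fn.
  + move=> x y; rewrite !inE -en => xn yn; have [h1 h2] := fb v x vn xn; have [h3 h4] := fb v y vn yn.
    by move/shiftv_inj => /(_ h2 h4) /fi; rewrite !inE !bump_lt // => /(_ isT isT) /(can_inj (bumpK v)).
  + move=> x y; rewrite -en => xn yn; have [h1 h2] := fb v x vn xn; have [h3 h4] := fb v y vn yn.
    rewrite (@mu_del_vertex G v); last exact/isolatedP.
    by rewrite mu_del_vertex // !bump_shiftv // fm ?bump_lt.
- move=> i hi /(contractibleP hi) hm a b t wG _ en fn fi fm fnot fb fs.
  have := wf_edge wG (mem_nth (0,0) hi); rewrite -/a -/b => /and3P [an bn ab].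
  have hm' : mu H (f a) (f b) = 1 by rewrite fm.
  have [|j hj ej] := @mu_index H (f a) (f b); first by rewrite hm'.
  have := wf_edge wH (mem_nth (0,0) hj); set e := nth _ _ _ => /and3P [e1 e2 e12].
  have mj : mu H e.1 e.2 = 1.
    by move: hm'; rewrite /mu -ej -/e -surjective_pairing.
  have eab : (e.1 == f a) && (e.2 == f b) || (e.1 == f b) && (e.2 == f a).
    by move: ej => /eqP; rewrite -/e [e]surjective_pairing enorm_eq.
  exists (contract H j); first by apply: step_contract => //; apply/contractibleP.
  (* If [H] lists the edge in the reverse orientation, its contraction discards [f a] and keeps
     [f b]; [s] sends the discarded vertex to the kept one. *)
  pose s z := if z == e.2 then e.1 else z.
  have sn z : z < gn H -> s z < gn H by rewrite /s; case: ifP.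
  have se z : s z != e.2 by rewrite /s; case: ifP => // ->.
  have s_inj x y : x < gn G -> y < gn G -> x != b -> y != b -> s (f x) = s (f y) -> x = y.
    move=> xn yn xb yb; have := fnot b x bn xn xb; have := fnot b y bn yn yb.
    have := fi x y xn yn; rewrite /s; case: (eqVneq (f x) (f y)) => [e0 /(_ e0)//|ne _] yb' xb' h.
    exfalso; move: ne xb' yb'; case/orP: eab h => /andP [/eqP -> /eqP ->]; clear;
      do 2 case: eqP => ?; lia.
  exists (fun x => shiftv e.2 (s (f (bump b x)))); split; rewrite /= ?en //.
  + by move=> x; rewrite -en => xn; rewrite en shiftv_lt ?sn //; case: (fb b x bn xn).
  + move=> x y; rewrite !inE -en => xn yn /shiftv_inj; rewrite !se => /(_ isT isT) /s_inj.
    by rewrite !bump_lt // !bump_neq => /(_ isT isT isT isT) /(can_inj (bumpK b)).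
  + move=> x y; rewrite -en => xn yn.
    case: (eqVneq x y) => [->|xy].
      rewrite !muii //; first exact: (step_wf (step_contract hi (proj2 (contractibleP hi) hm)) wG).
      exact: (step_wf (step_contract hj (proj2 (contractibleP hj) mj)) wH).
    rewrite (@mu_contract G i) // (@mu_contract H j) // -/e; last first.
      apply/negP => /eqP /shiftv_inj; rewrite !se => /(_ isT isT) /s_inj.
      rewrite !bump_lt // !bump_neq => /(_ isT isT isT isT) /(can_inj (bumpK b)); exact/eqP.
    rewrite !bump_shiftv ?se //.
    have := inj_eq (can_inj (bumpK b)) x y; rewrite (negbTE xy) => /negbT.
    have := bump_neq b x; have := bump_neq b y; have := bump_lt bn xn; have := bump_lt bn yn.
    move: (bump b x) (bump b y) => X Y Xn Yn Yb Xb XY.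
    have E z : z < gn G -> z != b -> (s (f z) == e.1) = (z == a).
      move=> zn zb; apply/eqP/eqP => [h|->].
        apply: s_inj => //; rewrite h /s; case/orP: eab => /andP [/eqP -> /eqP ->]; first by case: eqP.
        by rewrite eqxx.
      by rewrite /s; case/orP: eab => /andP [/eqP -> /eqP ->]; rewrite ?eqxx //; case: eqP.
    have F z : z < gn G -> z != b -> z != a -> s (f z) = f z.
      move=> zn zb za; have h1 := fnot b z bn zn zb; have h2 := fnot a z an zn za.
      by rewrite /s; case/orP: eab => /andP [/eqP -> /eqP ->]; rewrite ?(negbTE h1) ?(negbTE h2).
    have S z : z < gn G -> mu H e.1 (f z) + mu H e.2 (f z) = mu G a z + mu G b z.
      move=> zn; rewrite -!fm //; case/orP: eab => /andP [/eqP -> /eqP ->] //.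
      by rewrite addnC.
    rewrite /merge_mult !E //; case: (eqVneq X a) => [Xa|Xa].
      case: (eqVneq Y a) => [Ya|Ya].
        by move: XY; rewrite Xa Ya eqxx.
      by rewrite F // S.
    case: (eqVneq Y a) => [Ya|Ya]; first by rewrite F // ![mu H (f X) _]muC S // ![mu G X _]muC.
    by rewrite !F // fm.
Qed.

(** * Minimal obstructions: isolated vertices, multiplicities, contractions *)

Definition minimal_obstruction G := [/\ wf G, ~ one_spectator G & forall G1, step G G1 -> one_spectator G1].

Lemma minimal_obstruction_iso G H : iso G H -> minimal_obstruction G -> minimal_obstruction H.
Proof.
move=> i [wG nG sG]; have wH := iso_wf wG i; have i' := iso_sym wG i; split=> //.
  by move=> cH; apply: nG; apply: iso_one_spectator i cH.
move=> H1 s; have [G1 /sG c1 i1] := step_iso wH i' s; exact: iso_one_spectator (step_wf s wH) i1 c1.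
Qed.

Lemma minimal_del_edge G u v : minimal_obstruction G -> 0 < mu G u v ->
  one_spectator_on (fun x => x < gn G) (fun x y => mu G x y - (enorm (u, v) == enorm (x, y))).
Proof.
move=> [wG nG sG] /mu_index [i hi ei].
apply: (@one_spectator_sub _ _ _ _ id) (sG _ (step_del_edge hi)) => //= x y _ _ _.
by rewrite (@mu_del_edge G i) // ei.
Qed.

Lemma pos_bound n (pos : nat -> nat) : exists S, forall x, x < n -> pos x <= S.
Proof.
exists (\sum_(z < n) pos z) => x xn.
by rewrite (bigD1 (Ordinal xn)) //= leq_addr.
Qed.

(** An isolated vertex can be put far out on the line, so adding one does not lead out of the
    class. *)
Lemma minimal_not_isolated G v : minimal_obstruction G -> v < gn G -> exists x, 0 < mu G v x.
Proof.
move=> [wG nG sG] vn.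
case hasv: (all (fun e : nat * nat => (e.1 != v) && (e.2 != v)) (ge G)); last first.
  move/negbT/allPn: hasv => -[[p q] he /= pq].
  exists (if p == v then q else p); rewrite -has_count; apply/hasP; exists (p, q) => //.
  by rewrite enorm_eq; case: ifP pq; lia.
exfalso; apply: nG; have iv := proj2 (isolatedP G v) hasv.
case: (ltnP 1 (gn G)) => n1; last first.
  exists (pred1 0), 0, id; split => x y xn yn; have x0 : x = 0 by [move: xn n1; clear; lia];
    have y0 : y = 0 by [move: yn n1; clear; lia]; by rewrite x0 y0.
have [W [i [pos [h1 h2 h3 h4]]]] := sG _ (step_del_vertex vn n1 hasv).
have m1 x y : x != v -> y != v -> mu G x y =
  mu (MGraph (gn G).-1 [seq (shiftv v e.1, shiftv v e.2) | e <- ge G]) (shiftv v x) (shiftv v y).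
  by move=> xv yv; rewrite (@mu_del_vertex G v) // !bump_shiftv.
have [S big] := pos_bound (gn G) pos.
exists (fun x => (x != v) && W (shiftv v x)), i,
  (fun x => if x == v then S.+3 + i else pos (shiftv v x)).
have sn x : x < gn G -> x != v -> shiftv v x < (gn G).-1 by move=> xn xv; apply: shiftv_lt.
have bigs x : x < gn G -> x != v -> pos (shiftv v x) <= S.
  by move=> xn xv; apply: big; apply: leq_trans (sn x xn xv) (leq_pred _).
split=> x y xn yn.
- move=> /andP [xv Wx] /andP [yv Wy]; apply: (shiftv_inj xv yv); apply: h1 => //; exact: sn.
- case: (eqVneq x v) => xv; case: (eqVneq y v) => yv /=; rewrite ?xv ?yv //.
  + by move=> _ _ e; have := bigs y yn yv; move: e; clear; lia.
  + by move=> _ _ e; have := bigs x xn xv; move: e; clear; lia.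
  + move=> Wx Wy e; apply: (shiftv_inj xv yv); apply: h2 => //; exact: sn.
- case: (eqVneq x v) => xv; first by rewrite xv iv.
  case: (eqVneq y v) => yv; first by rewrite yv muC iv.
  move=> /= Wx Wy xy; rewrite m1 //; apply: h3 => //; try exact: sn.
  by apply: contra xy => /eqP /(shiftv_inj xv yv) ->.
- move=> /andP [xv Wx]; case: (eqVneq y v) => yv; first by rewrite yv muC iv.
  by move=> /= Wy; rewrite m1 //; apply: h4 => //; apply: sn.
Qed.

(** After deleting one of three parallel edges at least two remain, too many for the line. So one
    end is the spectator, where multiplicities are free, and the edge can be restored inside the
    class. *)
Lemma minimal_mult_le2 G u v : minimal_obstruction G -> mu G u v <= 2.
Proof.
move=> mG; rewrite leqNgt; apply/negP => m3; have [wG nG sG] := mG; apply: nG.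
have m0 : 0 < mu G u v by apply: leq_trans m3.
have /and3P [un vn uv] := mu_pos wG m0.
have [W [i [pos [h1 h2 h3 h4]]]] := minimal_del_edge mG m0.
exists W, i, pos; split => // x y xn yn.
- move=> Wx Wy xy; have := h3 x y xn yn Wx Wy xy; rewrite enorm_eq.
  case E : (_ || _); last by rewrite subn0.
  have -> : mu G x y = mu G u v.
    by case/orP: E => /andP [/eqP -> /eqP ->] //; rewrite muC.
  by move: m3; clear; lia.
- move=> Wx Wy; have := h4 x y xn yn Wx Wy; rewrite enorm_eq.
  case E : (_ || _); last by rewrite subn0.
  have -> : mu G x y = mu G u v.
    by case/orP: E => /andP [/eqP -> /eqP ->] //; rewrite muC.
  by move=> h _; apply: h; move: m3; clear; lia.
Qed.

Lemma minimal_contract G a b : minimal_obstruction G -> mu G a b = 1 ->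
  one_spectator_on (fun x => (x < gn G) && (x != b)) (merge_mult a b (mu G)).
Proof.
move=> [wG nG sG] m1; have m0 : 0 < mu G a b by rewrite m1.
have [i hi ei] := mu_index m0.
have := wf_edge wG (mem_nth (0,0) hi); set e := nth _ _ _ => /and3P [e1 e2 e12].
have me : mu G e.1 e.2 = 1 by move: m1; rewrite /mu -ei -/e -surjective_pairing.
have cG := sG _ (step_contract hi (proj2 (contractibleP hi) me)).
have {cG} : one_spectator_on (fun x => (x < gn G) && (x != e.2)) (merge_mult e.1 e.2 (mu G)).
  apply: (@one_spectator_sub _ _ _ _ (shiftv e.2)) cG => /=
    [x /andP [xn xe]|x y /andP [xn xe] /andP [yn ye]|x y /andP [xn xe] /andP [yn ye] xy].
  - exact: shiftv_lt.
  - exact: shiftv_inj.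
  - rewrite (@mu_contract G i) // -/e ?bump_shiftv //.
    by apply: contra xy => /eqP /(shiftv_inj xe ye) ->.
have : (e.1 == a) && (e.2 == b) || (e.1 == b) && (e.2 == a).
  by move: ei => /eqP; rewrite -/e [e]surjective_pairing enorm_eq.
case/orP => /andP [/eqP E1 /eqP E2]; rewrite E1 E2 // in e1 e2 e12 *.
(* Here the edge is listed as [(b, a)], so the contraction has kept [b], which takes the part of
   [a]. *)
apply: (@one_spectator_sub _ _ _ _ (fun x => if x == a then b else x)) => x.
- by case: (eqVneq x a) => [_ _|xa /andP [-> _]] //; rewrite e1.
- by move=> y /andP [xn xb] /andP [yn yb]; do 2 case: eqP => //; move=> ? ? ?; subst => //; lia.
- move=> y /andP [xn xb] /andP [yn yb] xy; rewrite /merge_mult.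
  case: (eqVneq x a) => xa; first case: (eqVneq y a) => ya.
  + by move: xy; rewrite xa ya eqxx.
  + by rewrite eqxx addnC.
  + case: (eqVneq y a) => ya; first by rewrite (negbTE xb) eqxx addnC.
    by rewrite (negbTE xb) (negbTE yb).
Qed.

Ltac ifs_lia := repeat (case: ifP => ?); lia.

(** * Vertices of degree two *)

(** Shifts positions so that [s] becomes free for a new vertex. *)
Definition slot (s t : nat) := if t < s then t else t.+1.

Lemma slot_inj s : injective (slot s).
Proof. by move=> p q; rewrite /slot; do 2 case: ifP; lia. Qed.

Lemma slot_neq s t : slot s t != s.
Proof. by rewrite /slot; case: ifP; lia. Qed.

Lemma slot_adj s p q : adj p q -> ~~ ((p.+1 == s) && (q == s)) ->
  ~~ ((q.+1 == s) && (p == s)) -> adj (slot s p) (slot s q).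
Proof. by rewrite /slot /adj; do 2 case: ifP; lia. Qed.

Lemma adjC p q : adj p q = adj q p.
Proof. by rewrite /adj orbC. Qed.

(* For a path a - x - y - b through two vertices of degree 2, y is put back at position s. *)
Lemma one_spectator_insert (V W : pred nat) m a x y b i i' s pos :
  (forall u v, m u v = m v u) ->
  (forall z, z != a -> z != y -> m x z = 0) ->
  (forall z, z != x -> z != b -> m y z = 0) ->
  m a x = 1 -> m x y = 1 -> m y b = 1 -> x != y -> b != y -> a != y -> a != x -> V a -> V x -> V b ->
  one_spectator_order (fun z => V z && (z != y)) W (merge_mult x y m) i pos ->
  (forall u v, V u -> V v -> u != y -> v != y -> ~~ W u -> ~~ W v -> u != x -> v != x ->
     (pos u).+1 = s -> pos v = s -> m u v = 0) ->
  (~~ W x -> ~~ W a -> adj (slot s (pos x)) (slot s (pos a))) ->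
  (~~ W x -> adj s (slot s (pos x))) ->
  (~~ W b -> adj s (slot s (pos b))) ->
  (W x -> (s == i') || (s == i'.+1)) ->
  (W b -> (s == i') || (s == i'.+1)) ->
  (forall u v, V u -> V v -> u != y -> v != y -> W u -> ~~ W v -> 0 < m u v ->
     (slot s (pos v) == i') || (slot s (pos v) == i'.+1)) ->
  one_spectator_on V m.
Proof.
move=> mC mx my max mxy myb xy by_ ay ax Va Vx Vb [h1 h2 h3 h4] str hxa hyx hyb hWx hWb hW.
exists (fun z => (z != y) && W z), i', (fun z => if z == y then s else slot s (pos z)).
have m1 u v : u != y -> v != y -> u != x -> v != x -> m u v = merge_mult x y m u v.
  by move=> uy vy ux vx; rewrite /merge_mult (negbTE ux) (negbTE vx).
have key u v : V u -> V v -> u != y -> v != y -> ~~ W u -> ~~ W v -> u != v ->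
    m u v <= adj (slot s (pos u)) (slot s (pos v)).
  move=> Vu Vv uy vy Wu Wv uv.
  case: (eqVneq u x) => ux; first case: (eqVneq v a) => va.
  - by subst u v; rewrite mC max hxa.
  - by rewrite ux mx.
  case: (eqVneq v x) => vx; first case: (eqVneq u a) => ua.
  - by subst u v; rewrite max adjC hxa.
  - by rewrite vx mC mx.
  have Vu' : V u && (u != y) by rewrite Vu.
  have Vv' : V v && (v != y) by rewrite Vv.
  have := h3 u v Vu' Vv' Wu Wv uv; rewrite -m1 //.
  case: (posnP (m u v)) => [-> //|m0]; rewrite -(ltn_predK m0) => le.
  apply: leq_trans le _; case A : (adj _ _) => //; rewrite slot_adj //.
    apply/negP => /andP [/eqP e1 /eqP e2].
    by move: m0; rewrite (str u v).
  apply/negP => /andP [/eqP e1 /eqP e2].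
  by move: m0; rewrite mC (str v u).
have keyy v : V v -> v != y -> ~~ W v -> m y v <= adj s (slot s (pos v)).
  move=> Vv vy Wv; case: (eqVneq v x) => vx; first by subst v; rewrite mC mxy hyx.
  by case: (eqVneq v b) => vb; [subst v; rewrite myb hyb | rewrite my].
split=> u v Vu Vv.
- by move=> /andP [uy Wu] /andP [vy Wv]; apply: h1; rewrite ?Vu ?Vv.
- case: (eqVneq u y) => uy; case: (eqVneq v y) => vy /=.
  + by rewrite uy vy.
  + by move=> _ _ /esym e; have := slot_neq s (pos v); rewrite e eqxx.
  + by move=> _ _ e; have := slot_neq s (pos u); rewrite e eqxx.
  + by move=> Wu Wv /slot_inj e; apply: h2; rewrite ?Vu ?Vv.
- case: (eqVneq u y) => uy; case: (eqVneq v y) => vy /=.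
  + by rewrite uy vy eqxx.
  + by move=> _ Wv _; rewrite uy; apply: keyy.
  + by move=> Wu _ _; rewrite vy mC adjC; apply: keyy.
  + exact: key.
- move=> /andP [uy Wu]; case: (eqVneq v y) => vy /= Wv; last exact: hW.
  move=> m0; have : (u == x) || (u == b).
    by apply: contraLR m0; rewrite negb_or vy mC => /andP [ux ub]; rewrite my.
  by case/orP => /eqP e; rewrite e in Wu; [apply: hWx | apply: hWb].
Qed.

(** The contraction of the middle edge of a path [a], [x], [y], [b] is undone by putting [y] back:
    between [a] and [b] if [x] is the spectator, and beside [x] otherwise, on a side that depends on
    [a] and [b]. *)
Lemma one_spectator_series (V : pred nat) m a x y b :
  (forall u v, m u v = m v u) ->
  (forall z, z != a -> z != y -> m x z = 0) ->
  (forall z, z != x -> z != b -> m y z = 0) ->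
  m a x = 1 -> m x y = 1 -> m y b = 1 -> m a b = 0 ->
  x != y -> b != y -> a != y -> a != x -> b != x -> a != b -> V a -> V x -> V b ->
  one_spectator_on (fun z => V z && (z != y)) (merge_mult x y m) -> one_spectator_on V m.
Proof.
move=> mC mx my max mxy myb mab xy by_ ay ax bx ab Va Vx Vb [W [i [pos c]]].
have [h1 h2 h3 h4] := c.
have ins := one_spectator_insert mC mx my max mxy myb xy by_ ay ax Va Vx Vb c.
have Va' : V a && (a != y) by rewrite Va.
have Vx' : V x && (x != y) by rewrite Vx.
have Vb' : V b && (b != y) by rewrite Vb.
have Mx z : z != y -> z != x -> merge_mult x y m x z = (z == a) + (z == b).
  move=> zy zx; rewrite /merge_mult eqxx; case: (eqVneq z a) => za.
    by rewrite za mC max my // (negbTE ab).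
  by rewrite mx //; case: (eqVneq z b) => zb; [rewrite zb myb | rewrite my].
have Mxa : merge_mult x y m x a = 1 by rewrite Mx // eqxx (negbTE ab).
have Mxb : merge_mult x y m x b = 1 by rewrite Mx // eqxx eq_sym (negbTE ab).
have MC u v : u != v -> merge_mult x y m u v = merge_mult x y m v u.
  by move=> uv; rewrite /merge_mult; do 2 case: eqP => ?; subst; rewrite ?(mC u) ?(mC v) // eqxx in uv *.
have Mm u v : u != x -> v != x -> merge_mult x y m u v = m u v.
  by move=> ux vx; rewrite /merge_mult (negbTE ux) (negbTE vx).
have inj u v : V u && (u != y) -> V v && (v != y) -> ~~ W u -> ~~ W v -> u != v -> pos u != pos v.
  by move=> Vu Vv Wu Wv; apply: contra => /eqP /(h2 _ _ Vu Vv Wu Wv) ->.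
have Wuniq u v : V u && (u != y) -> V v && (v != y) -> W u -> u != v -> ~~ W v.
  by move=> Vu Vv Wu uv; apply/negP => Wv; move: uv; rewrite (h1 u v) ?eqxx.
have xa : x != a by rewrite eq_sym.
have xb : x != b by rewrite eq_sym.
have ba : b != a by rewrite eq_sym.
have [Wx|Wx] := boolP (W x).
  have Wa := Wuniq x a Vx' Va' Wx xa; have Wb := Wuniq x b Vx' Vb' Wx xb.
  have := h4 x a Vx' Va' Wx Wa; rewrite Mxa => /(_ isT) pa.
  have := h4 x b Vx' Vb' Wx Wb; rewrite Mxb => /(_ isT) pb.
  have pab := inj a b Va' Vb' Wa Wb ab.
  (* [a] and [b] hold [i] and [i.+1]. Placing [y] between them breaks no edge because [m a b = 0],
     and the spectator [x] now sees [a] and [y], which are consecutive. *)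
  apply: (ins (if pos a == i then i else i.+1) i.+1); rewrite ?Wx ?(negbTE Wa) ?(negbTE Wb) //.
  - move=> u v Vu Vv uy vy Wu Wv ux vx [pu] pv.
    have Vu' : V u && (u != y) by rewrite Vu.
    have Vv' : V v && (v != y) by rewrite Vv.
    have [e|e] : (pos u = pos a /\ pos v = pos b) \/ (pos u = pos b /\ pos v = pos a).
      by move: pa pb pab pu pv; clear; lia.
    + by case: e => /(h2 _ _ Vu' Va' Wu Wa) -> /(h2 _ _ Vv' Vb' Wv Wb) ->.
    + by case: e => /(h2 _ _ Vu' Vb' Wu Wb) -> /(h2 _ _ Vv' Va' Wv Wa) ->; rewrite mC.
  - by move=> _; move: pa pb pab; rewrite /adj /slot; clear; ifs_lia.
  - by move=> _; move: pa; clear; ifs_lia.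
  - move=> u v Vu Vv uy vy Wu Wv.
    have -> : u = x by apply: h1; rewrite ?Vu.
    have [->|va] := eqVneq v a; last by rewrite mx.
    by move=> _; move: pa; clear; rewrite /slot; ifs_lia.
have [Wb|Wb] := boolP (W b).
  have Wa := Wuniq b a Vb' Va' Wb ba.
  have := h4 b x Vb' Vx' Wb Wx; rewrite MC // Mxb => /(_ isT) px.
  have := h3 x a Vx' Va' Wx Wa xa; rewrite Mxa => pa.
  (* [y] goes next to [x] on the side away from [a]. As [a] is no neighbour of the spectator [b],
     any further neighbour of [b] is on that side too. *)
  pose s := if pos a < pos x then (pos x).+1 else pos x.
  apply: (ins (if pos a < pos x then i.+1 else i) s); rewrite ?Wb ?(negbTE Wa) ?(negbTE Wx) //.
  - move=> u v Vu Vv uy vy Wu Wv ux vx pu pv.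
    have Vu' : V u && (u != y) by rewrite Vu.
    have Vv' : V v && (v != y) by rewrite Vv.
    have := inj u x Vu' Vx' Wu Wx ux; have := inj v x Vv' Vx' Wv Wx vx.
    by move: pu pv; rewrite /s; clear; ifs_lia.
  - by move=> _ _; move: pa; rewrite /s; clear; case: ifP => ?; rewrite /adj /slot; ifs_lia.
  - by move=> _; rewrite /s; clear; case: ifP => ?; rewrite /adj /slot; ifs_lia.
  - by move=> _; move: pa px; rewrite /s; clear; case: ifP => ?; rewrite /adj; ifs_lia.
  - move=> u v Vu Vv uy vy Wu Wv.
    have -> : u = b by apply: h1; rewrite ?Vu.
    move=> m0; have Vv' : V v && (v != y) by rewrite Vv.
    have va : v != a by apply: contraTneq m0 => ->; rewrite mC mab.
    have vx : v != x by apply: contraTneq m0 => ->; rewrite mC mx.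
    have := inj v x Vv' Vx' Wv Wx vx; have := inj v a Vv' Va' Wv Wa va.
    have := h4 b v Vb' Vv' Wb Wv; rewrite Mm // m0 => /(_ isT).
    move: pa px; rewrite /s; clear; case: ifP => ?; rewrite /adj /slot; ifs_lia.
have pb := h3 x b Vx' Vb' Wx Wb xb; rewrite Mxb in pb.
(* [x] and [b] are consecutive on the line, and [y] goes into the gap between them. *)
pose s := if pos b == (pos x).+1 then (pos x).+1 else pos x.
have str u v : V u -> V v -> u != y -> v != y -> ~~ W u -> ~~ W v -> u != x -> v != x ->
     (pos u).+1 = s -> pos v = s -> m u v = 0.
  move=> Vu Vv uy vy Wu Wv ux vx pu pv.
  have Vu' : V u && (u != y) by rewrite Vu.
  have Vv' : V v && (v != y) by rewrite Vv.
  have := inj u x Vu' Vx' Wu Wx ux; have := inj v x Vv' Vx' Wv Wx vx.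
  by move: pu pv; rewrite /s; clear; ifs_lia.
have [Wa|Wa] := boolP (W a).
  have := h4 a x Va' Vx' Wa Wx; rewrite MC // Mxa => /(_ isT) px.
  apply: (ins (if pos b == (pos x).+1 then i else i.+1) s); rewrite ?Wa ?(negbTE Wb) ?(negbTE Wx) //.
  - by move=> _; rewrite /s; clear; case: ifP => ?; rewrite /adj /slot; ifs_lia.
  - by move=> _; move: pb; rewrite /s; clear; case: ifP => ?; rewrite /adj /slot; ifs_lia.
  - move=> u v Vu Vv uy vy Wu Wv.
    have -> : u = a by apply: h1; rewrite ?Vu.
    move=> m0; have Vv' : V v && (v != y) by rewrite Vv.
    case: (eqVneq v x) => [->|vx].
      by move: px pb; rewrite /s; clear; case: ifP => ?; rewrite /slot /adj; ifs_lia.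
    have vb : v != b by apply: contraTneq m0 => ->; rewrite mab.
    have := inj v x Vv' Vx' Wv Wx vx; have := inj v b Vv' Vb' Wv Wb vb.
    have := h4 a v Va' Vv' Wa Wv; rewrite Mm // m0 => /(_ isT).
    move: pb px; rewrite /s; clear; case: ifP => ?; rewrite /adj /slot; ifs_lia.
have pa := h3 x a Vx' Va' Wx Wa xa; rewrite Mxa in pa.
have pab := inj a b Va' Vb' Wa Wb ab.
(* [x] is no neighbour of the spectator, so a gap opened beside [x] cannot separate two neighbours
   of the spectator. *)
apply: (ins (if i < pos x then i else i.+1) s); rewrite ?(negbTE Wa) ?(negbTE Wb) ?(negbTE Wx) //.
- by move=> _ _; move: pa pb pab; rewrite /s; clear; case: ifP => ?; rewrite /adj /slot; ifs_lia.
- by move=> _; rewrite /s; clear; case: ifP => ?; rewrite /adj /slot; ifs_lia.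
- by move=> _; move: pb; rewrite /s; clear; case: ifP => ?; rewrite /adj /slot; ifs_lia.
- move=> u v Vu Vv uy vy Wu Wv m0.
  have ux : u != x by apply: contraTneq Wu => ->.
  have ua : u != a by apply: contraTneq Wu => ->.
  have Vu' : V u && (u != y) by rewrite Vu.
  have Vv' : V v && (v != y) by rewrite Vv.
  have vx : v != x by apply: contraTneq m0 => ->; rewrite mC mx.
  have := inj v x Vv' Vx' Wv Wx vx.
  have := h4 u v Vu' Vv' Wu Wv; rewrite Mm // m0 => /(_ isT).
  rewrite /s; clear; case: ifP => ?; rewrite /slot; ifs_lia.
Qed.

Lemma minimal_no_series G a x y b : minimal_obstruction G ->
  (forall z, z != a -> z != y -> mu G x z = 0) ->
  (forall z, z != x -> z != b -> mu G y z = 0) ->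
  mu G a x = 1 -> mu G x y = 1 -> mu G y b = 1 -> mu G a b = 0 ->
  b != x -> a != y -> a != b -> False.
Proof.
move=> mG mx my max mxy myb mab bx ay ab; have [wG nG _] := mG; apply: nG.
have /and3P [an xn ax] : [&& a < gn G, x < gn G & a != x] by apply: mu_pos; rewrite ?max.
have /and3P [_ yn xy] : [&& x < gn G, y < gn G & x != y] by apply: mu_pos; rewrite ?mxy.
have /and3P [_ bn yb] : [&& y < gn G, b < gn G & y != b] by apply: mu_pos; rewrite ?myb.
apply: (@one_spectator_series _ _ a x y b) => //; first exact: muC; first by rewrite eq_sym.
exact: minimal_contract.
Qed.

(** * Minors from labellings with connected fibers *)

Definition label_mult (psi : nat -> nat) (H : mgraph) (u v : nat) : nat :=
  count (fun e => enorm (psi e.1, psi e.2) == enorm (u, v)) (ge H).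

(** Connectedness by cuts: a set that splits the fiber is crossed by an edge inside the fiber. In
    this form it passes through relabellings and contractions without any handling of paths. *)
Definition connected_fiber (H : mgraph) (psi : nat -> nat) (v : nat) : Prop :=
  forall (S : pred nat) x y, x < gn H -> y < gn H -> psi x = v -> psi y = v -> S x -> ~~ S y ->
  exists e, [/\ e \in ge H, psi e.1 = v, psi e.2 = v & S e.1 != S e.2].

(** A minor model with the fibers as branch sets. A label of [gn X] or more marks a vertex that is
    thrown away. *)
Definition model (X H : mgraph) (psi : nat -> nat) : Prop :=
  [/\ forall v, v < gn X -> exists2 x, x < gn H & psi x = v,
      forall v, v < gn X -> connected_fiber H psi v &
      forall u v, u < gn X -> v < gn X -> u != v -> mu X u v <= label_mult psi H u v].

Lemma minor_step X H H1 : step H H1 -> minor X H1 -> minor X H.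
Proof. by move=> s [G [r i]]; exists G; split=> //; apply: reach_step s r. Qed.

Lemma mem_drop_edge_neq (s : seq (nat * nat)) i e : i < size s ->
  e \in s -> e != nth (0,0) s i -> e \in drop_edge s i.
Proof.
by move=> hi; rewrite (perm_mem (nth_drop_edge hi)) inE => /orP [->|].
Qed.

Lemma size_drop_edge (s : seq (nat * nat)) i : i < size s -> size s = (size (drop_edge s i)).+1.
Proof. by move=> hi; rewrite (perm_size (nth_drop_edge hi)). Qed.

Lemma label_mult_del_edge psi H i u v : i < size (ge H) -> u != v ->
  let e := nth (0,0) (ge H) i in
  enorm (psi e.1, psi e.2) != enorm (u, v) -> label_mult psi (del_edge H i) u v = label_mult psi H u v.
Proof.
by move=> hi uv e ne; rewrite /label_mult /= (count_drop_edge _ hi) -/e (negbTE ne).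
Qed.

Lemma model_del_edge X H psi i : i < size (ge H) ->
  model X H psi ->
  let e := nth (0,0) (ge H) i in
  (forall v, v < gn X -> psi e.1 = v -> psi e.2 = v ->
     exists2 j, j < size (ge H) /\ j != i & enorm (nth (0,0) (ge H) j) = enorm e) ->
  (psi e.1 < gn X -> psi e.2 < gn X -> psi e.1 != psi e.2 ->
     mu X (psi e.1) (psi e.2) < label_mult psi H (psi e.1) (psi e.2)) ->
  model X (del_edge H i) psi.
Proof.
move=> hi [m1 m2 m3] e he1 he2; split=> // [v vX S x y xn yn px py Sx Sy|u v uX vX uv].
  have [d [dH d1 d2 d3]] := m2 v vX S x y xn yn px py Sx Sy.
  case: (eqVneq d e) => [de|de]; last by exists d; split=> //; apply: mem_drop_edge_neq.
  have [||j [hj ji] /eqP ej] := he1 v vX; rewrite -?de //.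
  exists (nth (0,0) (ge H) j); have := nth_mem_drop_edge hj ji.
  move: ej; rewrite -de; case: (nth _ _ _) => p q; case: (d) d1 d2 d3 => p' q' /= d1 d2 d3.
  rewrite enorm_eq => /orP [] /andP [/eqP -> /eqP ->] h; split=> //.
  by rewrite eq_sym.
case E: (enorm (psi e.1, psi e.2) == enorm (u, v)); last by rewrite label_mult_del_edge ?E // m3.
have h a b : a < gn X -> b < gn X -> psi e.1 = a -> psi e.2 = b -> a != b ->
    mu X a b <= label_mult psi (del_edge H i) a b.
  move=> aX bX ea eb ab; have := he2; rewrite ea eb => /(_ aX bX ab).
  rewrite /label_mult /= (count_drop_edge _ hi) -/e ea eb eqxx; clear; lia.
move: E; rewrite enorm_eq => /orP [] /andP [/eqP e1 /eqP e2].
  by apply: h.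
by rewrite muC /label_mult (enormC u); apply: h => //; rewrite eq_sym.
Qed.

Lemma model_iso X H psi : wf X -> wf H -> model X H psi ->
  (forall x, x < gn H -> psi x < gn X) ->
  (forall x y, x < gn H -> y < gn H -> psi x = psi y -> x = y) ->
  (forall e, e \in ge H -> label_mult psi H (psi e.1) (psi e.2) <= mu X (psi e.1) (psi e.2)) ->
  iso X H.
Proof.
move=> wX wH [m1 m2 m3] used inj le; apply: iso_sym => //.
apply: (@isomu_iso _ _ psi) => //; split=> //; first (apply/eqP; rewrite eqn_leq; apply/andP; split).
- rewrite -{1}(size_iota 0 (gn H)) -(size_iota 0 (gn X)) -(size_map psi).
  apply: uniq_leq_size.
    by rewrite map_inj_in_uniq ?iota_uniq // => a b; rewrite !mem_iota /=; apply: inj.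
  by move=> z /mapP [x]; rewrite mem_iota /= => xn ->; rewrite mem_iota /= used.
- rewrite -(size_iota 0 (gn H)) -{1}(size_iota 0 (gn X)) -(size_map psi (iota 0 (gn H))).
  apply: uniq_leq_size; first exact: iota_uniq.
  move=> v; rewrite mem_iota /= => /m1 [x xn <-]; apply: map_f; by rewrite mem_iota.
- move=> x y xn yn; case: (eqVneq x y) => [->|xy]; first by rewrite !muii.
  have E : label_mult psi H (psi x) (psi y) = mu H x y.
    apply: eq_in_count => -[p q] /(wf_edge wH) /= /and3P [pn qn _].
    by apply: (@enorm_inj_eq [pred x | x < gn H]) => // a b; apply: inj.
  have pxy : psi x != psi y by apply: contra xy => /eqP /(inj _ _ xn yn) ->.
  apply/eqP; rewrite eqn_leq andbC -{1 2}E m3 ?used //= andbT.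
  case: (posnP (mu H x y)) => [m0|]; first by rewrite E m0.
  rewrite /mu -has_count => /hasP [[p q] he]; rewrite enorm_eq; have := le _ he => /= le1.
  case/orP => /andP [/eqP ep /eqP eq]; subst p q => //.
  by rewrite -/(mu X _ _) muC /label_mult enormC.
Qed.

(** Induction on vertices plus edges: unless [psi] is an isomorphism, some step leads to a smaller
    graph with a model. Edges at discarded vertices go first, then those vertices, then surplus
    edges between fibers. An edge inside a fiber is deleted if it has a parallel and contracted if
    not. *)
Lemma model_minor X H psi : wf X -> wf H -> model X H psi -> minor X H.
Proof.
move=> wX; have [k] := ubnP (gn H + size (ge H)); elim: k H psi => // k IH H psi hk wH mH.
have [m1 m2 m3] := mH.
have IHe i : i < size (ge H) -> model X (del_edge H i) psi -> minor X H.
  move=> hi mi; apply: (minor_step (step_del_edge hi)); apply: IH mi.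
    by move: hk; rewrite (size_drop_edge hi) addnS.
  exact: step_wf (step_del_edge hi) wH.
case: (boolP (has (fun i => let e := nth (0,0) (ge H) i in
   (gn X <= psi e.1) || (gn X <= psi e.2)) (iota 0 (size (ge H))))) => [/hasP [i]|].
  rewrite mem_iota add0n => /andP [_ hi] /= he; apply: (IHe i hi).
  apply: model_del_edge => //.
    by move=> v vX e1 e2; move: he; rewrite e1 e2 leqNgt vX.
  by move=> e1 e2; move: he; rewrite leqNgt e1 leqNgt e2.
move/hasPn => uedge.
have {}uedge e : e \in ge H -> psi e.1 < gn X /\ psi e.2 < gn X.
  move=> /(nthP (0,0)) [i hi <-]; have := uedge i; rewrite mem_iota add0n => /(_ hi) /=.
  by rewrite negb_or -!ltnNge => /andP.
case: (boolP (has (fun v => gn X <= psi v) (iota 0 (gn H)))) => [/hasP [v]|].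
  rewrite mem_iota add0n => /andP [_ vn] pv.
  have iv : all (fun e : nat * nat => (e.1 != v) && (e.2 != v)) (ge H).
    apply/allP => e /uedge [e1 e2]; apply/andP; split; apply/eqP => ev.
      by move: pv; rewrite -ev leqNgt e1.
    by move: pv; rewrite -ev leqNgt e2.
  have X0 : 0 < gn X by case: wX.
  have n1 : 1 < gn H.
    have [x xn px] := m1 0 X0; rewrite ltnNge; apply/negP => n1.
    move: pv; have -> : v = x by move: n1 xn vn; clear; lia.
    by rewrite px leqNgt X0.
  have s := step_del_vertex vn n1 iv.
  apply: (minor_step s); apply: (IH _ (psi \o bump v)) (step_wf s wH) _ => /=.
    by move: hk n1; rewrite size_map; clear; lia.
  have iv' e : e \in ge H -> bump v (shiftv v e.1) = e.1 /\ bump v (shiftv v e.2) = e.2.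
    by move/(allP iv) => /andP [e1 e2]; rewrite !bump_shiftv.
  split=> [u uX|u uX S x y xn yn px py Sx Sy|u w uX wX0 uw].
  - have [x xn px] := m1 u uX; exists (shiftv v x).
      by apply: shiftv_lt => //; apply/eqP => xv; move: pv; rewrite -xv px leqNgt uX.
    by rewrite /= bump_shiftv //; apply/eqP => xv; move: pv; rewrite -xv px leqNgt uX.
  - have [||e [eH e1 e2 e3]] :=
      m2 u uX (fun z => S (shiftv v z)) (bump v x) (bump v y) (bump_lt vn xn) (bump_lt vn yn) px py.
      by rewrite shiftv_bump.
      by rewrite shiftv_bump.
    exists (shiftv v e.1, shiftv v e.2); have [h1 h2] := iv' e eH; split=> //=; rewrite ?h1 ?h2 //.
    by apply/mapP; exists e.
  - apply: leq_trans (m3 u w uX wX0 uw) _; rewrite /label_mult /= count_map; apply: eq_leq.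
    by apply: eq_in_count => e /iv' [h1 h2] /=; rewrite h1 h2.
move/hasPn => uvert.
have {}uvert v : v < gn H -> psi v < gn X.
  by move=> vn; have := uvert v; rewrite mem_iota -ltnNge; apply.
case: (boolP (has (fun i => let e := nth (0,0) (ge H) i in
   (psi e.1 != psi e.2) && (mu X (psi e.1) (psi e.2) < label_mult psi H (psi e.1) (psi e.2)))
   (iota 0 (size (ge H))))) => [/hasP [i]|].
  rewrite mem_iota add0n => /andP [_ hi] /= /andP [ne lt]; apply: (IHe i hi).
  apply: model_del_edge => // v vX e1 e2.
  by move: ne; rewrite e1 e2 eqxx.
move/hasPn => tight.
case: (boolP (all (fun x => all (fun y => (psi x == psi y) ==> (x == y)) (iota 0 (gn H))) (iota 0 (gn H)))).
  move=> /allP inj; exists H; split; first exact: reach_refl.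
  have {}inj x y : x < gn H -> y < gn H -> psi x = psi y -> x = y.
    move=> xn yn e; have := inj x; rewrite mem_iota => /(_ xn) /allP /(_ y).
    by rewrite mem_iota => /(_ yn); rewrite e eqxx => /eqP.
  apply: (model_iso wX wH mH uvert inj) => e eH.
  have /(nthP (0,0)) [i hi ei] := eH; have := tight i; rewrite mem_iota => /(_ hi) /=.
  have /and3P [en1 en2 e12] := wf_edge wH eH.
  rewrite ei negb_and negbK -leqNgt => /orP [/eqP /inj e0|//].
  by move: e12; rewrite e0 ?eqxx.
move/allPn => [x]; rewrite mem_iota => /andP [_ xn] /allPn [y]; rewrite mem_iota => /andP [_ yn].
rewrite negb_imply => /andP [/eqP pxy xy].
have yx : ~~ (pred1 x) y by rewrite /= eq_sym.
have [e [eH e1 e2 _]] := m2 (psi x) (uvert x xn) (pred1 x) x y xn yn erefl (esym pxy) (eqxx x) yx.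
have /(nthP (0,0)) [i hi ei] := eH.
case: (boolP (has (fun j => (j != i) && (enorm (nth (0,0) (ge H) j) == enorm e)) (iota 0 (size (ge H))))).
  move=> /hasP [j]; rewrite mem_iota => /andP [_ hj] /andP [ji /eqP ej].
  apply: (IHe i hi); apply: model_del_edge; rewrite ?ei //; last by rewrite e1 e2 eqxx.
  by move=> *; exists j.
move/hasPn => par.
have con : forall j, j < size (ge H) -> j != i ->
         enorm (nth (0,0) (ge H) j) != enorm (nth (0,0) (ge H) i).
  by move=> j hj ji; have := par j; rewrite mem_iota ji ei; apply.
have s := step_contract hi con; have wc := step_wf s wH.
have /and3P [an bn ab] := wf_edge wH eH.
apply: (minor_step s); apply: (IH _ (psi \o bump e.2)) wc _ => /=.
  by move: hk; rewrite size_map (size_drop_edge hi); clear; lia.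
rewrite ei; pose f z := shiftv e.2 (if z == e.2 then e.1 else z).
rewrite -[X in model _ X]/(MGraph (gn H).-1 [seq (f d.1, f d.2) | d <- drop_edge (ge H) i]).
have pf z : psi (bump e.2 (f z)) = psi z.
  rewrite /f; case: (eqVneq z e.2) => zb; first by rewrite bump_shiftv // zb e2.
  by rewrite bump_shiftv.
have fb z : f (bump e.2 z) = z by rewrite /f (negbTE (bump_neq _ _)) shiftv_bump.
have f12 : f e.1 = f e.2 by rewrite /f eqxx (negbTE ab).
split=> [u uX|u uX S z t zn tn pz pt Sz St|u w uX wX0 uw] /=.
- have [z zn pz] := m1 u uX; exists (f z); last by rewrite pf.
  rewrite /f; apply: shiftv_lt => //; first by case: (eqVneq z e.2).
  by case: ifP.
- have [||d [dH d1 d2 d3]] :=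
     m2 u uX (fun z => S (f z)) (bump e.2 z) (bump e.2 t) (bump_lt bn zn) (bump_lt bn tn) pz pt.
    by rewrite fb.
    by rewrite fb.
  exists (f d.1, f d.2); split=> //=; rewrite ?pf //.
  apply: (map_f (fun d => (f d.1, f d.2))); apply: mem_drop_edge_neq => //.
  by rewrite ei; apply: contraNneq d3 => ->; rewrite f12.
- apply: leq_trans (m3 u w uX wX0 uw) _; rewrite /label_mult /= count_map (count_drop_edge _ hi) ei e1 e2.
  have -> : enorm (psi x, psi x) == enorm (u, w) = false.
    by apply/negP; rewrite enorm_eq; move: uw; clear; lia.
  by rewrite add0n; apply: eq_leq; apply: eq_count => d /=; rewrite !pf.
Qed.

Lemma label_multC psi H u v : label_mult psi H u v = label_mult psi H v u.
Proof. by rewrite /label_mult enormC. Qed.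

Lemma label_mult_id H u v : label_mult id H u v = mu H u v.
Proof. by apply: eq_count => -[p q]. Qed.

Lemma label_mult_comp psi th H u v : label_mult psi H u v <= label_mult (th \o psi) H (th u) (th v).
Proof.
apply: sub_count => e /=; rewrite !enorm_eq => /orP [] /andP [/eqP -> /eqP ->].
  by rewrite !eqxx.
by rewrite !eqxx orbT.
Qed.

Lemma connected_fiber_id H v : connected_fiber H id v.
Proof. by move=> S x y _ _ -> -> ->. Qed.

Lemma connected_fiber_comp H psi th u v : (forall z, (th z == v) = (z == u)) ->
  connected_fiber H psi u -> connected_fiber H (th \o psi) v.
Proof.
move=> tE c S x y xn yn /eqP; rewrite /= tE => /eqP px /eqP; rewrite tE => /eqP py Sx Sy.
have [e [eH e1 e2 e3]] := c S x y xn yn px py Sx Sy; exists e; split=> //=; apply/eqP.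
  by rewrite tE e1.
by rewrite tE e2.
Qed.

(** A label outside [us] gets the index [size us], which equals [gn X], and is thereby discarded. *)
Lemma embedding_model X H psi us : wf X -> size us = gn X -> uniq us ->
  (forall u, u \in us -> connected_fiber H psi u /\ exists2 x, x < gn H & psi x = u) ->
  (forall i j, i < j -> j < gn X -> mu X i j <= label_mult psi H (nth 0 us i) (nth 0 us j)) ->
  model X H ((fun z => index z us) \o psi).
Proof.
move=> wX su uu fu mX.
have iE v z : v < gn X -> (index z us == v) = (z == nth 0 us v).
  rewrite -su => vX; apply/eqP/eqP => [e|->]; last by rewrite index_uniq.
  by rewrite -e nth_index // -index_mem e.
split.
- move=> v vX; have [|_ [x xn px]] := fu (nth 0 us v); first by rewrite mem_nth ?su.
  by exists x => //=; rewrite px index_uniq ?su.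
- move=> v vX; have [|c _] := fu (nth 0 us v); first by rewrite mem_nth ?su.
  by apply: connected_fiber_comp c => z; apply: iE.
- have key i j : i < j -> j < gn X -> mu X i j <= label_mult ((fun z => index z us) \o psi) H i j.
    move=> ij jX; apply: leq_trans (mX i j ij jX) _.
    have := label_mult_comp psi (fun z => index z us) H (nth 0 us i) (nth 0 us j).
    by rewrite !index_uniq // su //; apply: ltn_trans jX.
  move=> i j iX jX; case: (ltngtP i j) => // [ij|ji] _; first exact: key.
  by rewrite muC label_multC; apply: key.
Qed.

Lemma embedding_minor X H us : wf X -> wf H -> size us = gn X -> uniq us -> all (fun u => u < gn H) us ->
  (forall i j, i < j -> j < gn X -> mu X i j <= mu H (nth 0 us i) (nth 0 us j)) -> minor X H.
Proof.
move=> wX wH su uu /allP uH mX.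
apply: (@model_minor _ _ ((fun z => index z us) \o id)) => //; apply: embedding_model => //.
by move=> u /uH un; split; [exact: connected_fiber_id | exists u].
Qed.

Lemma label_mult_merge a b psi H x y : a != b -> x != y -> x != b -> y != b ->
  label_mult ((fun z => if z == b then a else z) \o psi) H x y = merge_mult a b (label_mult psi H) x y.
Proof.
move=> ab xy xb yb; rewrite /label_mult; elim: (ge H) => [|e s IH] /=; first by rewrite /merge_mult; repeat case: ifP.
by rewrite IH merge_mult_edge // /merge_mult; case: ifP => _; [|case: ifP => _ //]; rewrite addnACA.
Qed.

(** By the degree bound [u] and [v] have at most one further neighbour each, and these lie on
    different sides of the merged vertex; so [v] fits next to [u] on one of the sides. *)
Lemma linear_forest_uncontract (U : seq nat) m u v :
  (forall x y, m x y = m y x) -> u \in U -> v \in U -> u != v -> 0 < m u v ->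
  (forall x y, x \in U -> y \in U -> x != y -> m x y <= 1) ->
  (forall x a b c, x \in U -> a \in U -> b \in U -> c \in U -> uniq [:: x; a; b; c] ->
     0 < m x a -> 0 < m x b -> 0 < m x c -> False) ->
  linear_forest (fun x => (x \in U) && (x != v)) (merge_mult u v m) -> linear_forest (mem U) m.
Proof.
move=> mC Uu Uv uv muv m1 d3 [pos [h1 h2]].
have Vu : (u \in U) && (u != v) by rewrite Uu.
(* A vertex satisfying [bf] forces [v] to come before [u]: it is a further neighbour of [v] just
   before the merged vertex, or of [u] just after it. *)
pose bf z := [&& z != u, z != v & (0 < m v z) && ((pos z).+1 == pos u) || (0 < m u z) && (pos z == (pos u).+1)].
pose s := if has bf U then pos u else (pos u).+1.
have inj x y : x \in U -> x != v -> y \in U -> y != v -> x != y -> pos x != pos y.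
  by move=> xU xv yU yv; apply: contra => /eqP /h1 ->; rewrite ?xU ?yU ?eqxx.
have two z : z \in U -> z != v -> z != u -> m u z + m v z <= adj (pos u) (pos z).
  move=> zU zv zu; have := h2 u z Vu; rewrite zU zv /merge_mult eqxx => ->//.
  by rewrite eq_sym.
have un z : z \in U -> z != v -> z != u -> 0 < m u z -> adj (slot s (pos u)) (slot s (pos z)).
  move=> zU zv zu mz; have := two z zU zv zu; rewrite /s.
  case: ifP => [/hasP [z' z'U /and3P [z'u z'v]]|/hasPn /(_ z zU)].
    case: (eqVneq z' z) => [->|zz'].
      by move: mz; clear; rewrite /adj /slot; ifs_lia.
    move/orP=> [] /andP [m' p']; first have := two z' z'U z'v z'u.
      have := inj z z' zU zv z'U z'v; rewrite eq_sym => /(_ zz').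
      by move: m' p' mz; clear; rewrite /adj /slot; ifs_lia.
    by case: (d3 u v z z' Uu Uv zU z'U _ muv mz m');
      rewrite /= !inE !negb_or uv ![_ == z]eq_sym zu zv ![_ == z']eq_sym z'u z'v zz'.
  by rewrite /bf zu zv mz /=; move: mz; clear; rewrite /adj /slot; ifs_lia.
have vn z : z \in U -> z != v -> z != u -> 0 < m v z -> adj s (slot s (pos z)).
  move=> zU zv zu mz; have := two z zU zv zu; rewrite /s.
  case: ifP => [/hasP [z' z'U /and3P [z'u z'v]]|/hasPn /(_ z zU)].
    case: (eqVneq z' z) => [->|zz'].
      by move: mz; clear; rewrite /adj /slot; ifs_lia.
    move/orP=> [] /andP [m' p']; last first.
      have := inj z z' zU zv z'U z'v; rewrite eq_sym => /(_ zz').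
      have := two z' z'U z'v z'u.
      by move: m' p' mz; clear; rewrite /adj /slot; ifs_lia.
    case: (d3 v u z z' Uv Uu zU z'U _ _ mz m'); last by rewrite mC.
    by rewrite /= !inE !negb_or ![_ == z]eq_sym zu zv ![_ == z']eq_sym z'u z'v zz' eq_sym uv.
  by rewrite /bf zu zv mz /=; move: mz; clear; rewrite /adj /slot; ifs_lia.
have uvs : adj s (slot s (pos u)) by rewrite /s /adj /slot; case: (has _ _); clear; ifs_lia.
have le (b : bool) x y : x \in U -> y \in U -> x != y -> (0 < m x y -> b) -> m x y <= b.
  by move=> xU yU xy; have := m1 x y xU yU xy; case: (m x y) => [//|[|//]] _ ->.
exists (fun z => if z == v then s else slot s (pos z)); split => x y xU0 yU0;
  have xU : x \in U := xU0; have yU : y \in U := yU0.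
  case: (eqVneq x v) => xv; case: (eqVneq y v) => yv.
  - by rewrite xv yv.
  - by move/esym=> e; have := slot_neq s (pos y); rewrite e eqxx.
  - by move=> e; have := slot_neq s (pos x); rewrite e eqxx.
  - by move/slot_inj => /h1; rewrite xv yv !andbT; apply.
move=> xy; apply: le => //.
case: (eqVneq x v) => xv; case: (eqVneq y v) => yv.
- by move: xy; rewrite xv yv eqxx.
- rewrite xv; case: (eqVneq y u) => [->//|yu]; exact: vn.
- rewrite yv mC adjC; case: (eqVneq x u) => [->//|xu]; exact: vn.
case: (eqVneq x u) => xu.
  by rewrite xu; apply: un => //; rewrite -xu eq_sym.
case: (eqVneq y u) => yu; first by rewrite yu mC adjC; apply: un.
have := h2 x y; rewrite xU yU xv yv /merge_mult (negbTE xu) (negbTE yu) => /(_ isT isT xy) a0 p0.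
have {}a0 : adj (pos x) (pos y) by case: (adj _ _) a0 p0 => //; case: (m x y).
have := inj x u xU xv Uu uv xu; have := inj y u yU yv Uu uv yu.
move=> pyu pxu; apply: slot_adj a0 _ _; move: pyu pxu; rewrite /s; case: (has _ _); clear; lia.
Qed.

Definition C2 := MGraph 2 [:: (0,1); (0,1)].
Definition K13 := MGraph 4 [:: (0,1); (0,2); (0,3)].

(** A double edge gives [C2], and a vertex with three neighbours gives [K13]. Otherwise an edge is
    contracted: a cycle ends up as a double edge, and a linear forest can be expanded again. [U] is
    the set of current branch sets; discarding all labels outside it lets models on two sides of a
    cut be combined. *)
Lemma linear_forest_or_model H U psi : wf H -> uniq U ->
  (forall u, u \in U -> connected_fiber H psi u /\ exists2 x, x < gn H & psi x = u) ->
  linear_forest (mem U) (label_mult psi H) \/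
  exists X th, [/\ X = C2 \/ X = K13, model X H (th \o psi) & forall z, z \notin U -> gn X <= th z].
Proof.
move=> wH; have [k] := ubnP (size U); elim: k U psi => // k IH U psi hk uU fU.
have emb X us : X = C2 \/ X = K13 -> size us = gn X -> uniq us -> {subset us <= U} ->
    (forall i j, i < j -> j < gn X -> mu X i j <= label_mult psi H (nth 0 us i) (nth 0 us j)) ->
    linear_forest (mem U) (label_mult psi H) \/
    exists X th, [/\ X = C2 \/ X = K13, model X H (th \o psi) & forall z, z \notin U -> gn X <= th z].
  move=> XX su uus sub mX; right; exists X, (fun z => index z us); split=> //.
    by apply: embedding_model => // [|u /sub /fU //]; case: XX => ->.
  move=> z zU; rewrite -su leqNgt index_mem; apply: contra zU; exact: sub.
case: (boolP (has (fun u => has (fun v => (u != v) && (1 < label_mult psi H u v)) U) U)).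
  move=> /hasP [u uU' /hasP [v vU' /andP [uv m2]]]; apply: (@emb C2 [:: u; v]); first by left.
  - by [].
  - by rewrite /= inE uv.
  - by move=> z; rewrite !inE => /orP [] /eqP ->.
  - by move=> [|i] [|[|j]].
move/hasPn => simple.
have m1 x y : x \in U -> y \in U -> x != y -> label_mult psi H x y <= 1.
  by move=> xU yU xy; have /hasPn /(_ y yU) := simple x xU; rewrite xy -leqNgt.
case: (boolP (has (fun x => has (fun a => has (fun b => has (fun c =>
  [&& uniq [:: x; a; b; c], 0 < label_mult psi H x a, 0 < label_mult psi H x b
    & 0 < label_mult psi H x c]) U) U) U) U)).
  move=> /hasP [x xU /hasP [a aU /hasP [b bU /hasP [c cU /and4P [uq xa xb xc]]]]].
  apply: (@emb K13 [:: x; a; b; c]) => //; first by right.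
  - by move=> z; rewrite !inE => /or4P [] /eqP ->.
  - by move=> [|[|[|[|i]]]] [|[|[|[|j]]]].
move/hasPn => deg2.
have d3 x a b c : x \in U -> a \in U -> b \in U -> c \in U -> uniq [:: x; a; b; c] ->
    0 < label_mult psi H x a -> 0 < label_mult psi H x b -> 0 < label_mult psi H x c -> False.
  move=> xU aU bU cU uq xa xb xc.
  have /hasPn /(_ a aU) /hasPn /(_ b bU) /hasPn /(_ c cU) := deg2 x xU.
  by rewrite uq xa xb xc.
case: (boolP (has (fun u => has (fun v => (u != v) && (0 < label_mult psi H u v)) U) U)); last first.
  move/hasPn => noe; left; exists id; split=> // x y xU yU xy.
  by have /hasPn /(_ y yU) := noe x xU; rewrite xy -leqNgt leqn0 => /eqP ->.
move=> /hasP [u uU' /hasP [v vU' /andP [uv muv]]].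
pose t z := if z == v then u else z.
have tE z w : w != v -> (t z == w) = (z == w) || (z == v) && (w == u).
  by rewrite /t; case: (eqVneq z v) => [->|] //; rewrite ?orbF // eq_sym => /negbTE ->; rewrite eq_sym.
have tu z : (t z == u) = (z == u) || (z == v).
  by rewrite tE // [u == u]eqxx andbT.
have vrem z : (z \in rem v U) = (z != v) && (z \in U) by rewrite mem_rem_uniq // inE.
case: (IH (rem v U) (t \o psi)).
- by move: hk; rewrite size_rem //; case: (U) uU' => //= *; lia.
- exact: rem_uniq.
- move=> w; rewrite vrem => /andP [wv wU].
  have [c [x xn px]] := fU w wU; have [cv [xv xvn pxv]] := fU v vU'.
  split; last by exists x => //=; rewrite /t px (negbTE wv).
  case: (eqVneq w u) => wu; last first.
    by apply: connected_fiber_comp c => z; rewrite tE // (negbTE wu) andbF orbF.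
  move: c; rewrite wu => {w wU wv x xn px wu} c S y z yn zn /eqP; rewrite /= tu => py /eqP; rewrite tu => pz Sy Sz.
  have tuv a : psi a = u \/ psi a = v -> t (psi a) = u.
    by rewrite /t; case=> ->; rewrite ?eqxx ?(negbTE uv).
  have lift w0 a b : (w0 = u \/ w0 = v) -> connected_fiber H psi w0 -> a < gn H -> b < gn H ->
     psi a = w0 -> psi b = w0 -> S a -> ~~ S b ->
     exists e, [/\ e \in ge H, (t \o psi) e.1 = u, (t \o psi) e.2 = u & S e.1 != S e.2].
    move=> hw cw an bn pa pb Sa Sb; have [e [eH e1 e2 e3]] := cw S a b an bn pa pb Sa Sb.
    by exists e; split=> //=; apply: tuv; rewrite ?e1 ?e2.
  (* [e] joins the two fibers being merged. If [S] does not cut [e], it cuts one of the fibers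
     between an end of [e] and [y] or [z]. *)
  move: muv; rewrite -has_count => /hasP [e eH euv].
  have /orP ed : (psi e.1 == u) && (psi e.2 == v) || (psi e.1 == v) && (psi e.2 == u) by rewrite -enorm_eq.
  case: (eqVneq (S e.1) (S e.2)) => Se; last first.
    by exists e; split=> //=; apply: tuv; case: ed => /andP [/eqP e1 /eqP e2]; rewrite ?e1 ?e2; by [left|right].
  have /and3P [en1 en2 _] := wf_edge wH eH.
  have [p [q [pn qn pp pq pqS]]] : exists p q, [/\ p < gn H, q < gn H, psi p = u, psi q = v & S p = S q].
    by case: ed => /andP [/eqP e1 /eqP e2]; [exists e.1, e.2 | exists e.2, e.1].
  case Sp: (S p).
    case/orP: pz => /eqP pz; first by apply: (lift u p z) => //; left.
    by apply: (lift v q z) => //; [right | rewrite -pqS].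
  case/orP: py => /eqP py; first by apply: (lift u y p) => //; [left | rewrite Sp].
  by apply: (lift v y q) => //; [right | rewrite -pqS Sp].
- move=> h; left; apply: (linear_forest_uncontract _ uU' vU' uv muv m1 d3); first exact: label_multC.
  apply: linear_forest_sub h => [x /andP [xU xv]|x y /andP [xU xv] /andP [yU yv] xy]; first by rewrite /= vrem xv.
  by rewrite label_mult_merge.
- move=> [X [th [XX mX oX]]]; right; exists X, (th \o t); split=> // z zU.
  have zv : z != v by apply: contraNneq zU => ->.
  rewrite /= /t (negbTE zv); apply: oX; by rewrite vrem negb_and zU orbT.
Qed.

(** * A decision procedure for the class *)

(* Under vm_compute the connectives && and || evaluate both arguments. *)
Fixpoint lazy_all T (p : T -> bool) (s : seq T) : bool :=
  if s is x :: s' then (if p x then lazy_all p s' else false) else true.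
Fixpoint lazy_has T (p : T -> bool) (s : seq T) : bool :=
  if s is x :: s' then (if p x then true else lazy_has p s') else false.

(** Everything required between [x] and the vertices after it, tested as soon as [y] is chosen as
    its successor and [r] is what remains; bad prefixes are cut off early. *)
Definition next_ok (m : nat -> nat -> nat) (w x y : nat) (r : seq nat) : bool :=
  if m x y <= 1 then
    lazy_all (fun z => if m x z == 0 then (if m w x == 0 then true else m w z == 0) else false) r
  else false.

Fixpoint dfs_order m w (k : nat) (x : nat) (r : seq nat) : bool :=
  if k is k'.+1 then
    if r is [::] then true else
    lazy_has (fun y => let r' := rem y r in
                   if next_ok m w x y r' then dfs_order m w k' y r' else false) r
  else false.

(** Each vertex is tried as spectator; that one may be assumed to exist is [one_spectator_pred1].
    The argument [n] of [dfs_order] is fuel. *)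
Definition search_order n m : bool :=
  lazy_has (fun w => let r := rem w (iota 0 n) in
     if r is [::] then true else
     lazy_has (fun x => dfs_order m w n x (rem x r)) r) (iota 0 n).

Definition matrix (G : mgraph) : seq (seq nat) :=
  mkseq (fun u => mkseq (mu G u) (gn G)) (gn G).

Definition one_spectatorb (G : mgraph) : bool :=
  let t := matrix G in search_order (gn G) (fun u v => nth 0 (nth [::] t u) v).

(** Tests edge steps only: a vertex can be deleted only if it is isolated, and [obstructionb]
    excludes isolated vertices separately. *)
Definition edge_minb (G : mgraph) : bool :=
  lazy_all (fun i => if (if contractible G i then one_spectatorb (contract G i) else true)
              then one_spectatorb (del_edge G i) else false)
   (iota 0 (size (ge G))).

Definition isob (G X : mgraph) : bool :=
  if gn G == gn X then if size (ge G) == size (ge X) then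
   let t := [seq enorm e | e <- ge X] in
   lazy_has (fun s => perm_eq [seq enorm (nth 0 s e.1, nth 0 s e.2) | e <- ge G] t)
     (permutations (iota 0 (gn G))) else false else false.

Definition obstructions := [:: C2_C2; C2_K13; K13_K13; C4; H1; H2; H3; H4; H5; K14; longY].

Definition graph_of_mult (n : nat) (m : nat -> nat -> nat) : mgraph :=
  MGraph n (flatten [seq flatten [seq nseq (m u v) (u, v) | v <- iota u.+1 (n - u.+1)] | u <- iota 0 n]).

(** Fails only on a graph that is outside the class, minimal for edge steps and yet not listed. A
    minimal obstruction is thus settled once the check succeeds on a copy of it. *)
Definition check_listed G :=
  if one_spectatorb G then true else if edge_minb G then lazy_has (isob G) obstructions else true.

Lemma lazy_allE T (p : T -> bool) s : lazy_all p s = all p s.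
Proof. by elim: s => //= x s <-; case: (p x). Qed.

Lemma lazy_hasE T (p : T -> bool) s : lazy_has p s = has p s.
Proof. by elim: s => //= x s <-; case: (p x). Qed.

Lemma ifE (a b : bool) : (if a then b else false) = a && b. Proof. by case: a. Qed.

Definition linear_order (m : nat -> nat -> nat) w i (s : seq nat) :=
  (forall k l, k < size s -> l < size s -> k != l -> m (nth 0 s k) (nth 0 s l) <= adj k l) /\
  (forall k, k < size s -> 0 < m w (nth 0 s k) -> (k == i) || (k == i.+1)).

(** If there is no spectator, the last vertex of the line can serve as one: its only possible
    neighbour is at the position before it. *)
Lemma one_spectator_pred1 n m : 0 < n -> one_spectator_on (fun x => x < n) m ->
  exists w i pos, w < n /\ one_spectator_order (fun x => x < n) (pred1 w) m i pos.
Proof.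
move=> n0 [W [i [pos [h1 h2 h3 h4]]]].
case: (boolP (has W (iota 0 n))) => [/hasP [w]|/hasPn noW].
  rewrite mem_iota add0n => /andP [_ wn] Ww; exists w, i, pos; split=> //.
  have WE x : x < n -> W x -> x = w by move=> xn Wx; apply: h1.
  have NW x : x < n -> x != w -> ~~ W x.
    by move=> xn xw; apply/negP => /(WE x xn) /eqP; rewrite (negbTE xw).
  split=> x y xn yn /=.
  - by move=> /eqP -> /eqP ->.
  - by move=> xw yw; apply: h2 => //; apply: NW.
  - by move=> xw yw; apply: h3 => //; apply: NW.
  - by move=> /eqP -> yw; apply: h4 => //; apply: NW.
have {}noW x : x < n -> ~~ W x by move=> xn; apply: noW; rewrite mem_iota.
have [w wmax] : exists w : 'I_n, forall x : 'I_n, pos x <= pos w.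
  by case: (arg_maxnP (fun x : 'I_n => pos x) (erefl : xpredT (Ordinal n0))) => w _ h; exists w => x; apply: h.
exists w, (pos w).-1, pos; split=> //; split=> x y xn yn /=.
- by move=> /eqP -> /eqP ->.
- by move=> _ _; apply: h2 => //; apply: noW.
- by move=> _ _; apply: h3 => //; apply: noW.
- move=> /eqP -> yw m0; have wn := ltn_ord w.
  have := h3 w y wn yn (noW _ wn) (noW _ yn); rewrite eq_sym => /(_ yw).
  have := wmax (Ordinal yn); rewrite /=.
  have : pos y != pos w by apply: contra yw => /eqP /h2 ->//; apply: noW.
  by move: m0; rewrite /adj; clear; lia.
Qed.

Lemma incr_seq (t : seq nat) k l : sorted ltn t -> k <= l -> l < size t ->
  nth 0 t k + (l - k) <= nth 0 t l.
Proof.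
move=> st; elim: l => [|l IH] kl lt; first by have -> : k = 0 by [lia]; rewrite addn0.
case: (ltngtP k l.+1) kl => // [kl _|-> _]; last by rewrite subnn addn0.
have := IH kl (ltnW lt).
have := @sorted_ltn_nth _ _ ltn_trans 0 t st l l.+1 (ltnW lt) lt (ltnSn l).
by move: kl; clear; lia.
Qed.

(** Sorting by position and closing the gaps keeps consecutive positions consecutive. The last
    clause later gives [i < N] for the host. *)
Lemma one_spectator_linear_order n m : 0 < n -> one_spectator_on (fun x => x < n) m ->
  exists w s i, [/\ w < n, perm_eq s (rem w (iota 0 n)), linear_order m w i s &
     0 < size s -> i < size s].
Proof.
move=> n0 /(one_spectator_pred1 n0) [w [i [pos [wn [h1 h2 h3 h4]]]]].
pose s := sort (fun x y => pos x <= pos y) (rem w (iota 0 n)).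
have ps : perm_eq s (rem w (iota 0 n)) by rewrite /s perm_sort.
have sP z : (z \in s) = (z < n) && (z != w).
  by rewrite (perm_mem ps) mem_rem_uniq ?iota_uniq // inE mem_iota andbC.
have us : uniq s by rewrite (perm_uniq ps) rem_uniq ?iota_uniq.
have inj : {in s &, injective pos}.
  by move=> x y; rewrite !sP => /andP [xn xw] /andP [yn yw]; apply: h2.
have st : sorted ltn (map pos s).
  rewrite ltn_sorted_uniq_leq map_inj_in_uniq // us /= sorted_map.
  by apply: sort_sorted => x y; apply: leq_total.
have incr k l : k <= l -> l < size s -> pos (nth 0 s k) + (l - k) <= pos (nth 0 s l).
  move=> kl ls; have := incr_seq st kl; rewrite size_map => /(_ ls).
  by rewrite !(nth_map 0) // (leq_ltn_trans kl).
have nP k : k < size s -> nth 0 s k < n /\ nth 0 s k != w.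
  by move=> ks; apply/andP; rewrite -sP mem_nth.
(* Once gaps are closed, a vertex from position [i] or [i.+1] has rank [k0] or [k0.+1]. *)
pose k0 := find (fun z => i <= pos z) s.
have kP k : k < size s -> 0 < m w (nth 0 s k) -> [&& k0 < size s & (k == k0) || (k == k0.+1)].
  move=> ks mk; have [kn kw] := nP k ks.
  have pk := h4 w (nth 0 s k) wn kn (eqxx w) kw mk.
  have k0k : k0 <= k.
    rewrite leqNgt; apply/negP => /(before_find 0) /=; move: pk; clear; lia.
  have k0s : k0 < size s by apply: leq_ltn_trans ks.
  have hs : has (fun z => i <= pos z) s by rewrite has_find.
  have /= pk0 := nth_find 0 hs; rewrite -/k0 in pk0.
  by have := incr _ _ k0k ks; move: k0k pk pk0; rewrite k0s -/k0; clear; lia.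
(* If [k0] is out of range the spectator has no neighbour, and any index is correct. *)
exists w, s, (if k0 < size s then k0 else 0); split=> //; last by case: ifP.
split=> [k l ks ls kl|k ks mk]; last by have := kP k ks mk; case: ifP.
have [kn kw] := nP k ks; have [ln lw] := nP l ls.
apply: leq_trans (h3 _ _ kn ln kw lw _) _; first by rewrite nth_uniq.
rewrite /adj; case: (ltngtP k l) kl => // kl _.
  by have := incr _ _ (ltnW kl) ls; move: kl; clear; lia.
by have := incr _ _ (ltnW kl) ks; move: kl; clear; lia.
Qed.

Fixpoint good_order m w s : bool :=
  if s is x :: s' then (if s' is y :: r then next_ok m w x y r else true) && good_order m w s' else true.

Lemma next_okP m w x y r : reflect
  (m x y <= 1 /\ forall z, z \in r -> m x z = 0 /\ (m w x = 0 \/ m w z = 0)) (next_ok m w x y r).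
Proof.
rewrite /next_ok ifE lazy_allE; apply: (iffP andP) => -[h1 h2]; split=> //.
  move=> z /(allP h2); rewrite ifE => /andP [/eqP -> h]; split=> //.
  by move: h; case: eqP => [|_ /eqP]; [left|right].
apply/allP => z /h2 [-> h]; rewrite eqxx; case: eqP => // wx; case: h => // ->.
by rewrite eqxx.
Qed.

(** Neighbours of [w] that are pairwise consecutive occupy at most two positions, so the pairwise
    condition expresses the one on [i] and [i.+1]. *)
Lemma good_orderP m w s : good_order m w s <-> forall k l, k < l -> l < size s ->
  m (nth 0 s k) (nth 0 s l) <= (l == k.+1) /\
  (0 < m w (nth 0 s k) -> 0 < m w (nth 0 s l) -> l == k.+1).
Proof.
split.
  elim: s => // x s IH /= /andP [c /IH {}IH] [|k] [|l] // kl ls; last exact: IH.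
  case: s c IH ls => // y r /next_okP [c1 c2] IH ls; case: l ls kl => [|l] //= ls _.
  by have [-> [->|->]] := c2 _ (mem_nth 0 ls).
elim: s => // x s IH h /=; apply/andP; split; last first.
  by apply/IH => k l kl ls; apply: (h k.+1 l.+1).
case: s h {IH} => // y r h; apply/next_okP; split; first by case: (h 0 1).
move=> z /(nthP 0) [l lr <-]; have [] := h 0 l.+2 isT lr; rewrite /= leqn0 => /eqP -> h2.
split=> //; case: (posnP (m w x)) => [|p]; [by left|right].
by case: (posnP (m w (nth 0 r l))) => // q; move: (h2 p q).
Qed.

Lemma next_ok_perm m w x y r r' : perm_eq r r' -> next_ok m w x y r -> next_ok m w x y r'.
Proof.
by move=> p /next_okP [h1 h2]; apply/next_okP; split=> // z; rewrite -(perm_mem p); apply: h2.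
Qed.

Lemma dfs_orderS m w k x r : dfs_order m w k.+1 x r = nilp r ||
  has (fun y => next_ok m w x y (rem y r) && dfs_order m w k y (rem y r)) r.
Proof.
case: r => // y0 r0; transitivity (lazy_has (fun y => if next_ok m w x y (rem y (y0 :: r0))
  then dfs_order m w k y (rem y (y0 :: r0)) else false) (y0 :: r0)) => //.
by rewrite lazy_hasE orFb; apply: eq_has => y; apply: ifE.
Qed.

Lemma dfs_complete m w k s x r : size s < k -> perm_eq s r -> good_order m w (x :: s) ->
  dfs_order m w k x r.
Proof.
elim: k s x r => // k IH s x r sk p; rewrite dfs_orderS => /= /andP [c g].
case: s sk p c g => [|y s] sk p c g.
  by rewrite /nilp -(perm_size p).
have yr : y \in r by rewrite -(perm_mem p) mem_head.
have p' : perm_eq s (rem y r).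
  by rewrite -(perm_cons y); apply: perm_trans p (perm_to_rem yr).
by apply/orP; right; apply/hasP; exists y => //; rewrite (next_ok_perm p' c); apply: IH p' g.
Qed.

Lemma dfs_sound m w k x r : dfs_order m w k x r -> exists2 s, perm_eq s r & good_order m w (x :: s).
Proof.
elim: k x r => // k IH x r; rewrite dfs_orderS => /orP [/nilP ->|]; first by exists [::].
move=> /hasP [y yr] /andP [c /IH [s p g]].
exists (y :: s); last by rewrite /= (next_ok_perm _ c) // perm_sym.
by rewrite perm_sym; apply: perm_trans (perm_to_rem yr) _; rewrite perm_cons perm_sym.
Qed.

Lemma search_order_complete n m : 0 < n -> one_spectator_on (fun x => x < n) m -> search_order n m.
Proof.
move=> n0 /(one_spectator_linear_order n0) [w [s [i [wn ps [l1 l2] _]]]].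
rewrite /search_order lazy_hasE; apply/hasP; exists w; first by rewrite mem_iota.
have g : good_order m w s.
  apply/good_orderP => k l kl ls; have ks := ltn_trans kl ls; split.
    by have := l1 k l ks ls; move: kl; rewrite /adj; clear; lia.
  by move=> /(l2 k ks) hk /(l2 l ls) hl; move: kl hk hl; clear; lia.
case E: (rem w (iota 0 n)) => [|y0 r0] //; rewrite -E lazy_hasE.
case: s ps g {l1 l2} => [|x s] ps g; first by move/perm_size: ps; rewrite E.
have xr : x \in rem w (iota 0 n) by rewrite -(perm_mem ps) mem_head.
apply/hasP; exists x => //; apply: dfs_complete g; last first.
  by rewrite -(perm_cons x); apply: perm_trans ps (perm_to_rem xr).
have := perm_size ps; rewrite size_rem ?mem_iota // size_iota /= => e.
by move: e n0; clear; lia.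
Qed.

Lemma search_order_sound n m : (forall x y, x < n -> y < n -> m x y = m y x) ->
  search_order n m -> one_spectator_on (fun x => x < n) m.
Proof.
move=> mC; rewrite /search_order lazy_hasE => /hasP [w]; rewrite mem_iota add0n => /andP [_ wn] h.
have [s ps g] : exists2 s, perm_eq s (rem w (iota 0 n)) & good_order m w s.
  move: h; case E: (rem w (iota 0 n)) => [|y0 r0]; first by exists [::].
  rewrite -E lazy_hasE => /hasP [x xr /dfs_sound [s p g]]; exists (x :: s) => //.
  by rewrite perm_sym; apply: perm_trans (perm_to_rem xr) _; rewrite perm_cons perm_sym.
have sP z : (z \in s) = (z < n) && (z != w).
  by rewrite (perm_mem ps) mem_rem_uniq ?iota_uniq // inE mem_iota andbC.
move/good_orderP: g => g.
exists (pred1 w), (find (fun z => 0 < m w z) s), (fun z => index z s); split=> x y xn yn /=.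
- by move=> /eqP -> /eqP ->.
- move=> xw yw e; have xs : x \in s by rewrite sP xn.
  by rewrite -(nth_index 0 xs) e nth_index // sP yn.
- move=> xw yw; have xs : x \in s by rewrite sP xn.
  have ys : y \in s by rewrite sP yn.
  move=> xy; rewrite -{1}(nth_index 0 xs) -{1}(nth_index 0 ys).
  have hx := xs; have hy := ys; rewrite -index_mem in hx; rewrite -index_mem in hy.
  case: (ltngtP (index x s) (index y s)) => [lt|lt|e].
  + by have [le _] := g _ _ lt hy; apply: leq_trans le _; rewrite /adj orbC; case: eqP.
  + rewrite mC ?nth_index //; have [le _] := g _ _ lt hx; rewrite !nth_index // in le.
    by apply: leq_trans le _; rewrite /adj; case: eqP.
  + by move: xy; rewrite -(nth_index 0 xs) e nth_index // eqxx.
- move=> /eqP -> yw m0; have ys : y \in s by rewrite sP yn.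
  set k := find _ _; have hk : k <= index y s.
    by rewrite leqNgt; apply/negP => /(before_find 0) /=; rewrite nth_index // m0.
  have hs : has (fun z => 0 < m w z) s by apply/hasP; exists y.
  case: (eqVneq (index y s) k) => //= ne; have {ne hk}lt : k < index y s by rewrite ltn_neqAle eq_sym ne.
  have [_ h2] := g _ _ lt (etrans (index_mem _ _) ys).
  by rewrite h2 ?nth_index // (nth_find 0 hs).
Qed.

Lemma one_spectatorbP G : wf G -> reflect (one_spectator G) (one_spectatorb G).
Proof.
move=> wG; rewrite /one_spectatorb.
have E u v : u < gn G -> v < gn G -> nth 0 (nth [::] (matrix G) u) v = mu G u v.
  by move=> un vn; rewrite !nth_mkseq.
apply: (iffP idP) => [h|cG].
  have : one_spectator_on (fun x => x < gn G) (fun u v => nth 0 (nth [::] (matrix G) u) v).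
    by apply: search_order_sound h => x y xn yn; rewrite !E // muC.
  by apply: (@one_spectator_sub _ _ _ _ id) => // x y xn yn _; rewrite E.
apply: search_order_complete; first by case: wG.
by apply: (@one_spectator_sub _ _ _ _ id _ _ _ cG) => // x y xn yn _; rewrite E.
Qed.

Definition wfb G := (0 < gn G) &&
  all (fun e : nat * nat => [&& e.1 < gn G, e.2 < gn G & e.1 != e.2]) (ge G).

Definition obstructionb G := [&& wfb G, ~~ one_spectatorb G, edge_minb G &
  all (fun v => has (fun e : nat * nat => (e.1 == v) || (e.2 == v)) (ge G)) (iota 0 (gn G))].

Lemma wfbP G : wfb G -> wf G.
Proof. by case/andP. Qed.

Lemma contract_step G i : wf G -> i < size (ge G) -> contractible G i -> step G (contract G i).
Proof. by move=> wG hi /eqP h; apply: step_contract => //; apply/contractibleP. Qed.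

Lemma obstruction_minimal G : obstructionb G -> minimal_obstruction G.
Proof.
case/and4P => /wfbP wG /(one_spectatorbP wG) nG; rewrite /edge_minb lazy_allE => /allP mG /allP iG; split=> //.
move=> G1 s; have w1 := step_wf s wG; apply/one_spectatorbP => //.
case: s wG mG iG w1 {nG} => {G G1} G.
- move=> i hi wG mG _ _; have := mG i; rewrite mem_iota !ifE => /(_ hi).
  by case/andP.
- move=> v vn _ /allP iv wG _ iG _; have := iG v; rewrite mem_iota => /(_ vn) /hasP [e he].
  by have := iv e he; case/andP => /negbTE -> /negbTE ->.
- move=> i hi /(contractibleP hi) hm a b f wG mG _ _; have := mG i; rewrite mem_iota !ifE => /(_ hi).
  by rewrite /contractible hm /=; case/andP.
Qed.

Lemma isob_iso G X : wf G -> isob G X -> iso G X.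
Proof.
move=> wG; rewrite /isob !ifE => /and3P [/eqP en _]; rewrite lazy_hasE => /hasP [s].
rewrite mem_permutations => ps p; split=> //; exists (fun x => nth 0 s x).
have ss : size s = gn G by rewrite (perm_size ps) size_iota.
have us : uniq s by rewrite (perm_uniq ps) iota_uniq.
split; last split=> //.
  by move=> x xn; rewrite -en; have := mem_nth 0 (eq_ind_r (fun n => x < n) xn ss); rewrite (perm_mem ps) mem_iota.
by move=> x y; rewrite !inE -ss => xn yn /eqP; rewrite nth_uniq // => /eqP.
Qed.

Definition listed G := iso G C2_C2 \/ iso G C2_K13 \/ iso G K13_K13 \/ iso G C4 \/ iso G H1 \/
    iso G H2 \/ iso G H3 \/ iso G H4 \/ iso G H5 \/ iso G K14 \/ iso G longY.

Lemma listed_obstruction G : listed G -> exists2 X, obstructionb X & iso G X.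
Proof.
have wit X : obstructionb X -> iso G X -> exists2 X, obstructionb X & iso G X by exists X.
by rewrite /listed; repeat (case; first by apply: wit); apply: wit.
Qed.

Lemma check_listedP G : minimal_obstruction G -> check_listed G -> listed G.
Proof.
move=> [wG nG sG]; rewrite /check_listed; case: (one_spectatorbP wG) => // _.
have -> : edge_minb G.
  rewrite /edge_minb lazy_allE; apply/allP => i; rewrite mem_iota add0n => /andP [_ hi]; rewrite ifE.
  apply/andP; split; last by apply/(one_spectatorbP (step_wf (step_del_edge hi) wG)); apply/sG/step_del_edge.
  case: ifP => // c; have s2 := contract_step wG hi c.
  by apply/(one_spectatorbP (step_wf s2 wG)); apply: sG.
rewrite /obstructions /= /listed.
by repeat (case: ifP => [/(isob_iso wG) i _|_]; first by tauto).
Qed.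

Lemma iso_check_listed G H : minimal_obstruction G -> iso G H -> check_listed H -> listed G.
Proof.
move=> mG i cH; have wG : wf G by case: mG.
have := check_listedP (minimal_obstruction_iso i mG) cH.
have tr X : iso H X -> iso G X by apply: iso_trans.
rewrite /listed.
repeat (case=> [/tr|]; first by tauto); move/tr; tauto.
Qed.

(** * Closure under minors and disconnected obstructions *)

Lemma reach_one_spectator G H : reach G H -> wf G -> one_spectator G -> one_spectator H.
Proof.
elim=> {G H} // G1 G2 G3 s _ IH w1 c1; apply: IH; first exact: step_wf w1.
exact: step_one_spectator c1.
Qed.

Lemma minor_one_spectator G H : wf G -> wf H -> minor G H -> one_spectator H -> one_spectator G.
Proof.
by move=> wG wH [G' [r i]] cH; apply: iso_one_spectator i _ => //; apply: reach_one_spectator r wH cH.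
Qed.

(** A single step from [G] already enters the class, which is never left again; so [X] is reached by
    no step at all. *)
Lemma minimal_minor_iso G X : minimal_obstruction G -> wf X -> ~ one_spectator X -> minor X G -> iso G X.
Proof.
move=> [wG nG sG] wX nX [G' [r i]].
case: r wG sG i => [G0 wG _ i|G1 G2 G3 s r wG sG i]; first exact: iso_sym.
case: nX; apply: iso_one_spectator i _ => //; apply: reach_one_spectator r _ _; first exact: step_wf wG.
exact: sG.
Qed.

Definition dunion G H := MGraph (gn G + gn H)
  (ge G ++ [seq (gn G + e.1, gn G + e.2) | e <- ge H]).

Lemma mu_dunion G H u v : wf G -> wf H -> mu (dunion G H) u v =
  if (u < gn G) && (v < gn G) then mu G u v else
  if (gn G <= u) && (gn G <= v) then mu H (u - gn G) (v - gn G) else 0.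
Proof.
move=> wG wH; rewrite /mu /= count_cat count_map.
have z1 : (u < gn G) && (v < gn G) = false -> count (fun e => enorm e == enorm (u, v)) (ge G) = 0.
  move=> uv; apply/eqP; rewrite -leqn0 leqNgt -has_count; apply/hasP => -[[p q] /(wf_edge wG) /=].
  by move: uv; rewrite enorm_eq; clear; lia.
have z2 : (gn G <= u) && (gn G <= v) = false ->
    count (preim (fun e => (gn G + e.1, gn G + e.2)) (fun e => enorm e == enorm (u, v))) (ge H) = 0.
  move=> uv; apply/eqP; rewrite -leqn0 leqNgt -has_count; apply/hasP => -[[p q] _ /=].
  by move: uv; rewrite enorm_eq; clear; lia.
case: ifP => uv; first by rewrite z2 ?addn0 //; move: uv; clear; lia.
rewrite z1 // add0n; case: ifP => uv'; last by rewrite z2.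
apply: eq_count => -[p q] /=; rewrite !enorm_eq; move: uv'; clear; lia.
Qed.

(** Each model discards the vertices on the other side, so the labels do not interfere;
    [gn X1 + gn X2] again means discarded. *)
Lemma dunion_model X1 X2 H S psi1 psi2 : wf X1 -> wf X2 -> wf H ->
  model X1 H psi1 -> (forall z, ~~ S z -> gn X1 <= psi1 z) ->
  model X2 H psi2 -> (forall z, S z -> gn X2 <= psi2 z) ->
  model (dunion X1 X2) H (fun z => if S z then (if psi1 z < gn X1 then psi1 z else gn X1 + gn X2)
                                  else gn X1 + psi2 z).
Proof.
move=> w1 w2 wH [a1 a2 a3] s1 [b1 b2 b3] s2; set psi := fun z => _.
have E1 z v : v < gn X1 -> (psi z == v) = (psi1 z == v).
  move=> vX; rewrite /psi; case: ifP => Sz; first by case: ifP => //; move: vX; clear; lia.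
  by have := s1 z (negbT Sz); move: vX; clear; lia.
have E2 z v : v < gn X2 -> (psi z == gn X1 + v) = (psi2 z == v).
  move=> vX; rewrite /psi; case: ifP => Sz; last by clear; lia.
  by have := s2 z Sz; move: vX; case: ifP; clear; lia.
have cases v : v < gn X1 + gn X2 -> v < gn X1 \/ exists2 v', v' < gn X2 & v = gn X1 + v'.
  case: (ltnP v (gn X1)) => [|le] h; [by left | right; exists (v - gn X1); first by move: le h; clear; lia].
  by rewrite subnKC.
have conn psi' v v' : (forall z, (psi z == v) = (psi' z == v')) ->
    connected_fiber H psi' v' -> connected_fiber H psi v.
  move=> E c T x y xn yn /eqP; rewrite E => /eqP px /eqP; rewrite E => /eqP py Tx Ty.
  have [e [eH e1 e2 e3]] := c T x y xn yn px py Tx Ty; exists e; split=> //; apply/eqP.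
    by rewrite E e1.
  by rewrite E e2.
split.
- move=> v /cases [vX|[v' vX ->]].
    by have [x xn /eqP px] := a1 v vX; exists x => //; apply/eqP; rewrite E1.
  by have [x xn /eqP px] := b1 v' vX; exists x => //; apply/eqP; rewrite E2.
- move=> v /cases [vX|[v' vX ->]].
    by apply: conn (a2 v vX) => z; apply: E1.
  by apply: conn (b2 v' vX) => z; apply: E2.
- move=> u v /cases [uX|[u' uX ->]] /cases [vX|[v' vX ->]] uv; rewrite mu_dunion //.
  + rewrite uX vX; apply: leq_trans (a3 u v uX vX uv) _; apply: sub_count => e.
    by rewrite !enorm_eq !E1.
  + by do 2 (case: ifP => [|_]; first by move: uX; clear; lia).
  + by do 2 (case: ifP => [|_]; first by move: vX; clear; lia).
  + case: ifP => [|_]; first by clear; lia.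
    rewrite !leq_addr /= !addKn; apply: leq_trans (b3 u' v' uX vX _) _.
      by move: uv; clear; lia.
    by apply: sub_count => e; rewrite !enorm_eq !E2.
Qed.

(** Delete an edge inside the side [S]. If that side were a linear forest, it could be laid out
    beyond the order obtained for the other side, and all of [G] would lie in the class. *)
Lemma minimal_cut_not_linear_forest G (S : pred nat) x : minimal_obstruction G -> x < gn G -> S x ->
  (forall u v, u < gn G -> v < gn G -> S u -> ~~ S v -> mu G u v = 0) ->
  ~ linear_forest (fun z => (z < gn G) && S z) (mu G).
Proof.
move=> mG xn Sx cut [pos2 [p1 p2]]; have [wG nG sG] := mG; apply: nG.
have [y mxy] := minimal_not_isolated mG xn; have /and3P [_ yn xy] := mu_pos wG mxy.
have Sy : S y by apply: contraTT mxy => Sy; rewrite cut.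
have [W [i [pos [h1 h2 h3 h4]]]] := minimal_del_edge mG mxy.
have [B hB] := pos_bound (gn G) pos.
have del u v : ~~ S u -> mu G u v - (enorm (x, y) == enorm (u, v)) = mu G u v.
  move=> Su; rewrite enorm_eq; case: (eqVneq x u) => [e|_]; first by rewrite -e Sx in Su.
  by case: (eqVneq y u) => [e|_]; [rewrite -e Sy in Su | rewrite andbF subn0].
exists (fun z => ~~ S z && W z), i, (fun z => if S z then B + pos2 z + 2 else pos z).
split=> u v un vn.
- by move=> /andP [_ Wu] /andP [_ Wv]; apply: h1.
- case: (boolP (S u)) => Su; case: (boolP (S v)) => Sv /=.
  + by move=> _ _ e; apply: p1; rewrite ?un ?vn //; move: e; clear; lia.
  + by move=> _ _; have := hB v vn; clear; lia.
  + by move=> _ _; have := hB u un; clear; lia.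
  + exact: h2.
- case: (boolP (S u)) => Su; case: (boolP (S v)) => Sv /=.
  + move=> _ _ uv; apply: leq_trans (p2 u v _ _ uv) _; rewrite ?un ?vn //.
    by rewrite /adj; clear; lia.
  + by rewrite cut.
  + by rewrite muC cut.
  + by move=> Wu Wv uv; rewrite -(del u v Su); apply: h3.
- move=> /andP [Su Wu]; case: (boolP (S v)) => Sv /=; first by rewrite muC cut.
  by move=> Wv; rewrite -(del u v Su); apply: h4.
Qed.

Lemma minimal_disconnected G (S : pred nat) x y : minimal_obstruction G -> x < gn G -> y < gn G ->
  S x -> ~~ S y ->
  (forall u v, u < gn G -> v < gn G -> S u -> ~~ S v -> mu G u v = 0) -> listed G.
Proof.
move=> mG xn yn Sx Sy cut; have wG : wf G by case: mG.
have side (T : pred nat) z : z < gn G -> T z ->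
  (forall u v, u < gn G -> v < gn G -> T u -> ~~ T v -> mu G u v = 0) ->
  exists X psi, [/\ X = C2 \/ X = K13, model X G psi & forall z, ~~ T z -> gn X <= psi z].
  move=> zn Tz cutT; have nl := minimal_cut_not_linear_forest mG zn Tz cutT.
  pose U := [seq u <- iota 0 (gn G) | T u].
  have UE u : (u \in U) = (u < gn G) && T u by rewrite mem_filter mem_iota andbC.
  have [||h|[X [th [XX mX oX]]]] := @linear_forest_or_model G U id wG.
  - by rewrite filter_uniq ?iota_uniq.
  - by move=> u; rewrite UE => /andP [un _]; split; [exact: connected_fiber_id | exists u].
  - case: nl; apply: linear_forest_sub h => [u|u v _ _ _]; first by rewrite /= UE.
    by rewrite label_mult_id.
  - exists X, th; split=> // u Tu; apply: oX; by rewrite UE negb_and Tu orbT.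
have [X1 [psi1 [e1 m1 o1]]] := side S x xn Sx cut.
have [|X2 [psi2 [e2 m2 o2]]] := side (predC S) y yn Sy.
  by move=> u v un vn Su Sv; rewrite muC cut //; apply: negbNE.
have w1 : wf X1 by case: e1 => ->.
have w2 : wf X2 by case: e2 => ->.
have o2' z : S z -> gn X2 <= psi2 z by move=> Sz; apply: o2; rewrite /= Sz.
have o1' z : ~~ ~~ S z -> gn X2 <= psi2 z by exact: o2.
have fin X : wf X -> obstructionb X -> minor X G -> iso G X.
  by move=> wX /obstruction_minimal [_ nX _]; apply: minimal_minor_iso.
have M12 := dunion_model w1 w2 wG m1 o1 m2 o2'.
have M21 := dunion_model (S := predC S) w2 w1 wG m2 o2 m1 o1.
rewrite /listed; case: e1 e2 M12 M21 => -> [] -> M12 M21.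
- by left; apply: fin => //; apply: model_minor M12.
- by right; left; apply: fin => //; apply: model_minor M12.
- by right; left; apply: fin => //; apply: model_minor M21.
- by right; right; left; apply: fin => //; apply: model_minor M12.
Qed.

(** * The connected case *)

(* The path 0, ..., N-1, whose edge (i, i+1) has multiplicity bit, and the spectator N joined to i
   and i+1 with multiplicities m1 and m2. *)
Definition host (N i bit m1 m2 k l : nat) : nat :=
  let h k l :=
    if l == N then (if k == i then m1 else if k == i.+1 then m2 else 0)
    else if k.+1 == l then (if k == i then bit else 1) else 0 in
  if k < l then h k l else h l k.

(* Undoes a contraction onto x: of the h x k edges joining x to k, D k are moved to the new vertex
   N.+1, which is joined to x by one edge. *)
Definition unmerge (N x : nat) (h : nat -> nat -> nat) (D : nat -> nat) (k l : nat) : nat :=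
  if l == N.+1 then (if k == x then 1 else D k)
  else if k == x then h k l - D l else if l == x then h k l - D k else h k l.

(** Multiplicities above 2 do not occur in a minimal obstruction, so codes with such entries are
    skipped. *)
Definition check_code N i x bit m1 m2 D :=
  let h := host N i bit m1 m2 in
  let M := unmerge N x h D in
  if lazy_all (fun k => lazy_all (fun l => M k l <= 2) (iota k.+1 (N.+1 - k))) (iota 0 N.+2) then
     check_listed (graph_of_mult N.+2 M)
  else true.

Definition Dof (z1 z2 z3 d1 d2 d3 z : nat) : nat :=
  if z == z1 then d1 else if z == z2 then d2 else if z == z3 then d3 else 0.

(** All neighbours of [x] in the host are among [z1], [z2] and [z3], so a split is determined by how
    many edges to each of them move. The bound [bd] is 0 where one of these names falls on [x]
    itself or beyond [N]. *)
Definition check_splits N i x bit m1 m2 :=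
  let h := host N i bit m1 m2 in
  let z1 := if x == N then i else x.-1 in
  let z2 := if x == N then i.+1 else x.+1 in
  let z3 := N in
  let bd z := if (z == x) || (N < z) then 0 else h x z in
  lazy_all (fun d1 => lazy_all (fun d2 => lazy_all (fun d3 => check_code N i x bit m1 m2 (Dof z1 z2 z3 d1 d2 d3))
     (iota 0 (bd z3).+1)) (iota 0 (bd z2).+1)) (iota 0 (bd z1).+1).

(* Two adjacent degree-2 vertices t, t.+1 survive the splitting of x; see minimal_no_series. *)
Definition series N i x :=
  lazy_has (fun t => [&& (t.+1 < i) || (i.+1 < t), x != t & x != t.+1]) (iota 1 (N - 3)).

(** Merging adds two multiplicities of at most 2, hence [iota 0 5]. The guard is connectedness of
    the host: the spectator has a neighbour, and the two parts of the path are joined by the edge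
    from [i] to [i.+1] or through the spectator. *)
Definition check_hosts N i :=
  lazy_all (fun x => if series N i x then true else lazy_all (fun bit => lazy_all (fun m1 => lazy_all (fun m2 =>
      if (0 < m1 + m2) && ((i.+1 < N) ==> (0 < bit + minn m1 m2)) then
        check_splits N i x bit m1 m2 else true)
     (if i.+1 < N then iota 0 5 else [:: 0])) (iota 0 5)) (iota 0 2)) (iota 0 N.+1).

(** The ranges come from [series]. With five path vertices before [i], or six after it, there are
    two disjoint pairs of adjacent inner vertices away from the spectator, and [x] can meet only one
    of them. *)
Definition check_all_hosts := lazy_all (fun i => lazy_all (fun r => check_hosts (i.+1 + r) i) (iota 0 6)) (iota 0 5).

(* tri v + u is the rank of the pair u < v in (0,1), (0,2), (1,2), (0,3), ... *)
Definition tri v := (v * v.-1)./2.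

(** Each pair carries two edges or none, so a bit per pair encodes the graph. Graphs with an
    isolated vertex are skipped. *)
Definition check_doubled n (bs : seq bool) :=
  let m u v := (nth false bs (tri v + u)).*2 in
  if lazy_all (fun u => lazy_has (fun v => (if u < v then m u v else m v u) != 0) (rem u (iota 0 n))) (iota 0 n)
  then check_listed (graph_of_mult n m) else true.

Fixpoint all_bits k (p : seq bool -> bool) : bool :=
  if k is k'.+1 then
    if all_bits k' (fun bs => p (false :: bs)) then all_bits k' (fun bs => p (true :: bs)) else false
  else p [::].

Definition check_all_doubled := lazy_all (fun n => all_bits (tri n) (check_doubled n)) (iota 1 5).

Lemma check_all_hosts_true : check_all_hosts.
Proof. by vm_compute. Qed.
Lemma check_all_doubled_true : check_all_doubled.
Proof. by vm_compute. Qed.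

Lemma count_flatten_sum (T : Type) (I : eqType) (p : pred T) (F : I -> seq T) s :
  count p (flatten [seq F i | i <- s]) = \sum_(i <- s) count p (F i).
Proof. by rewrite count_flatten -map_comp sumnE big_map. Qed.

Lemma mu_graph_of_mult n m u v : u < v -> v < n -> mu (graph_of_mult n m) u v = m u v.
Proof.
move=> uv vn; have un := ltn_trans uv vn.
rewrite /mu /= count_flatten_sum (bigD1_seq u) ?mem_iota ?iota_uniq //=.
rewrite big1_seq ?addn0 => [|u' /andP [ne _]]; last first.
  rewrite count_flatten_sum big1_seq // => v'; rewrite mem_iota => /andP [_ /andP [uv' _]].
  rewrite count_nseq enorm_eq (_ : _ || _ = false) ?mul0n //.
  by move: ne uv uv'; clear; lia.
rewrite count_flatten_sum (bigD1_seq v) ?mem_iota ?iota_uniq //=; last first.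
  by move: uv vn un; clear; lia.
rewrite big1_seq ?addn0 => [|v' /andP [ne]]; first by rewrite count_nseq eqxx mul1n.
rewrite mem_iota => /andP [uv' _]; rewrite count_nseq enorm_eq (_ : _ || _ = false) ?mul0n //.
by move: ne uv uv'; clear; lia.
Qed.

Lemma wf_graph_of_mult n m : 0 < n -> wf (graph_of_mult n m).
Proof.
move=> n0; split=> //; apply/allP => -[p q] /flatten_mapP [u]; rewrite mem_iota => un.
move=> /flatten_mapP [v]; rewrite mem_iota => vn /nseqP [[-> ->] _] /=.
by move: un vn; clear; lia.
Qed.

Lemma iso_graph_of_mult G n m h : wf G -> gn G = n -> (forall x, x < n -> h x < n) ->
  {in [pred x | x < n] &, injective h} ->
  (forall u v, u < v -> v < n -> m u v = mu G (h u) (h v)) -> iso G (graph_of_mult n m).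
Proof.
move=> wG en hn hi hm; have n0 : 0 < n by rewrite -en; case: wG.
apply: iso_sym; first exact: wf_graph_of_mult.
apply: (@isomu_iso _ _ h) => //; first exact: wf_graph_of_mult.
split=> //=; rewrite ?en // => u v un vn.
case: (ltngtP u v) => [uv|vu|->].
- by rewrite mu_graph_of_mult // hm.
- by rewrite [RHS]muC mu_graph_of_mult // hm // muC.
- by rewrite !muii //; apply: wf_graph_of_mult.
Qed.

Section SplitHost.

Variables (G : mgraph) (N x i : nat).
Hypotheses (mG : minimal_obstruction G) (nG : gn G = N.+2) (xN : x <= N) (iN : i < N).
Hypothesis conn : forall (S : pred nat) u v, u < N.+2 -> v < N.+2 -> S u -> ~~ S v ->
  exists u' v', [/\ u' < N.+2, v' < N.+2, S u', ~~ S v' & 0 < mu G u' v'].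
Hypothesis mx : mu G x N.+1 = 1.

Let M := mu G.
Let hst := merge_mult x N.+1 M.

Hypothesis F1 : forall k l, k < N -> l < N -> k != l -> hst k l <= adj k l.
Hypothesis F2 : forall k, k < N -> 0 < hst N k -> (k == i) || (k == i.+1).

Let wG : wf G. Proof. by case: mG. Qed.
Let MC u v : M u v = M v u. Proof. exact: muC. Qed.
Let Mout u v : N.+2 <= v -> M u v = 0.
Proof.
move=> h; apply/eqP; rewrite -leqn0 leqNgt; apply/negP => /(mu_pos wG).
by rewrite nG; move: h; clear; lia.
Qed.

Let hstC k l : k != l -> hst k l = hst l k.
Proof.
move=> kl; rewrite /hst /merge_mult.
case: (eqVneq k x) => kx; case: (eqVneq l x) => lx; last exact: MC.
- by rewrite kx lx eqxx in kl.
- by rewrite ![M _ l]MC.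
- by rewrite ![M k _]MC.
Qed.

Let hst_ge k l : k != l -> k <= N -> l <= N -> M k l <= hst k l.
Proof.
move=> kl kN lN; rewrite /hst /merge_mult; case: (eqVneq k x) => [->|_]; first exact: leq_addr.
by case: (eqVneq l x) => [->|_] //; exact: leq_addr.
Qed.

Let hst_geN l : l != x -> l <= N -> M N.+1 l <= hst x l.
Proof. by move=> lx lN; rewrite /hst /merge_mult eqxx leq_addl. Qed.

Let hst_eq k l : k != x -> l != x -> hst k l = M k l.
Proof. by move=> kx lx; rewrite /hst /merge_mult (negbTE kx) (negbTE lx). Qed.

(** Contraction preserves connectedness: a cut of the host is pulled back along the map [t] that
    merges [N.+1] into [x]. *)
Let cut (S : pred nat) u v : u <= N -> v <= N -> S u -> ~~ S v ->
  exists u' v', [/\ u' <= N, v' <= N, S u', ~~ S v' & 0 < hst u' v'].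
Proof.
move=> uN vN Su Sv; pose t z := if z == N.+1 then x else z.
have tN z : z <= N -> t z = z by rewrite /t; case: eqP => // ->; rewrite ltnn.
have tle z : z < N.+2 -> t z <= N.
  by move=> h; rewrite /t; case: eqP => // /eqP; move: h; clear; lia.
have [||||u' [v' [un vn Su' Sv' m0]]] := conn (S := fun z => S (t z)) (u := u) (v := v).
- by rewrite ltnS ltnW.
- by rewrite ltnS ltnW.
- by rewrite tN.
- by rewrite tN.
have tt : t u' != t v' by apply: contraNneq Sv' => <-.
exists (t u'), (t v'); split; rewrite ?tle //.
apply: leq_trans m0 _; move: tt; rewrite /t.
case: (eqVneq u' N.+1) => [->|ne]; case: (eqVneq v' N.+1) => [->|ne'] tt.
- by rewrite eqxx in tt.
- by apply: hst_geN; rewrite 1?eq_sym //; move: vn ne'; clear; lia.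
- by rewrite hstC // -/M MC; apply: hst_geN => //; move: un ne; clear; lia.
- by apply: hst_ge => //; [move: un ne; clear; lia | move: vn ne'; clear; lia].
Qed.

Let hst_path k : k.+1 < N -> k != i -> hst k k.+1 = 1.
Proof.
move=> kN ki; apply/eqP; rewrite eqn_leq; apply/andP; split.
  have := F1 (ltnW kN) kN _; rewrite /adj eqxx orbT; apply; clear; lia.
(* The cut after [k], with the spectator put on the side of its neighbours, can be crossed only by
   the edge from [k] to [k.+1]. *)
have [||u [v [uN vN Su Sv h]]] := @cut (fun z => if z == N then i < k else z <= k) k k.+1 (ltnW (ltnW kN)) (ltnW kN).
- by case: ifP; move: kN; clear; lia.
- by case: ifP; move: kN; clear; lia.
move: Su Sv; case: (eqVneq u N) => uN'; case: (eqVneq v N) => vN'; try by clear; lia.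
- move=> ik; rewrite -ltnNge => kv.
  have vN2 : v < N by move: vN vN'; clear; lia.
  by move: h; rewrite uN' => /(F2 vN2); move: ik kv; clear; lia.
- move=> uk; rewrite -leqNgt => ki'; have uN2 : u < N by move: uN uN'; clear; lia.
  by move: h; rewrite vN' hstC // => /(F2 uN2); move: ki ki' uk; clear; lia.
- move=> uk; rewrite -ltnNge => kv.
  have un : u < N by move: uN uN'; clear; lia.
  have vn : v < N by move: vN vN'; clear; lia.
  have uv : u != v by move: uk kv; clear; lia.
  have := leq_trans h (F1 un vn uv); rewrite /adj => a.
  have [eu ev] : u = k /\ v = k.+1 by move: uk kv a; clear; lia.
  by rewrite eu ev in h.
Qed.

Let bit := if i.+1 < N then hst i i.+1 else 0.
Let m1 := hst N i.
Let m2 := if i.+1 < N then hst N i.+1 else 0.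

Let hstE k l : k <= N -> l <= N -> k != l -> hst k l = host N i bit m1 m2 k l.
Proof.
have lt k' l' : k' < l' -> l' <= N -> hst k' l' =
    if l' == N then (if k' == i then m1 else if k' == i.+1 then m2 else 0)
    else if k'.+1 == l' then (if k' == i then bit else 1) else 0.
  move=> kl lN; have kN : k' < N by apply: leq_trans kl lN.
  case: (eqVneq l' N) => lN'.
    rewrite lN' hstC; last by move: kN; clear; lia.
    case: (eqVneq k' i) => [->//|ki]; case: (eqVneq k' i.+1) => [ki'|ki'].
      by rewrite /m2 -ki' kN.
    by apply/eqP; rewrite -leqn0 leqNgt; apply/negP => /(F2 kN); rewrite (negbTE ki) (negbTE ki').
  have lN2 : l' < N by move: lN lN'; clear; lia.
  have kl' : k' != l' by move: kl; clear; lia.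
  case: (eqVneq k'.+1 l') => [e|ne].
    subst l'; case: (eqVneq k' i) => [ki|ki]; last exact: hst_path.
    by subst k'; rewrite /bit lN2.
  by apply/eqP; rewrite -leqn0; apply: leq_trans (F1 kN lN2 kl') _; rewrite /adj; move: kl ne; clear; lia.
move=> kN lN; rewrite /host; case: (ltngtP k l) => // kl _; first exact: lt.
by rewrite hstC ?lt //; move: kl; clear; lia.
Qed.

Let m_pos : 0 < m1 + m2.
Proof.
have [||u [v [uN vN /eqP Su Sv]]] := @cut (pred1 N) N i (leqnn N) (ltnW iN).
- exact: eqxx.
- by move: iN; rewrite /=; clear; lia.
have vN' : v < N by move: vN Sv => /=; clear; lia.
rewrite Su => h; case/orP: (F2 vN' h) => /eqP e; subst v; first by rewrite /m1 addn_gt0 h.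
by rewrite /m2 vN' addn_gt0 h orbT.
Qed.

Let bit_pos : i.+1 < N -> 0 < bit + minn m1 m2.
Proof.
move=> iN'; rewrite /bit /m1 /m2 iN'; case: (posnP (hst i i.+1)) => [b0|]; last by clear; lia.
suff [h1 h2] : 0 < hst N i /\ 0 < hst N i.+1 by move: h1 h2; clear; lia.
have low u v : u < N -> v < N -> u <= i -> i < v -> 0 < hst u v -> False.
  move=> uN vN ui iv h; have uv : u != v by move: ui iv; clear; lia.
  have := leq_trans h (F1 uN vN uv); rewrite /adj => a.
  have [eu ev] : u = i /\ v = i.+1 by move: ui iv a; clear; lia.
  by rewrite eu ev b0 in h.
(* The two parts of the path are now joined through the spectator only. Putting it on one side of
   the cut and then on the other yields its edges to [i] and to [i.+1]. *)
split.
  have [||u [v [uN vN Su Sv h]]] := @cut (fun z => z <= i) i i.+1 (ltnW iN) (ltnW iN').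
  - by [].
  - by clear; lia.
  have uN' : u < N by apply: leq_ltn_trans Su iN.
  move: Sv; rewrite -ltnNge => Sv; case: (eqVneq v N) => vN'; last first.
    by case: (@low u v) => //; move: vN vN'; clear; lia.
  have uv : u != v by move: Su Sv; clear; lia.
  move: h; rewrite hstC // vN' => h; have := F2 uN' h; move: h.
  by case: (eqVneq u i) => [->//|] _ _ /=; move: Su; clear; lia.
have [||u [v [uN vN Su Sv h]]] := @cut (fun z => (z <= i) || (z == N)) i i.+1 (ltnW iN) (ltnW iN').
- by rewrite leqnn.
- by move: iN'; clear; lia.
move: Sv; rewrite negb_or -ltnNge => /andP [Sv vN'].
have {}vN' : v < N by move: vN vN'; clear; lia.
case/orP: Su => Su; first by case: (@low u v) => //; apply: leq_ltn_trans Su iN.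
move: h; rewrite (eqP Su) => h; have := F2 vN' h; move: h.
by case: (eqVneq v i.+1) => [->//|] ne _; move: Sv ne; clear; lia.
Qed.

Let no_series : series N i x = false.
Proof.
apply/negP; rewrite /series lazy_hasE => /hasP [t]; rewrite mem_iota => /andP [t1 tN'] /and3P [ti xt xt1].
have tN : t.+2 < N by move: t1 tN'; clear; lia.
have out p : (p == t) || (p == t.+1) -> forall z, z <= N -> z != p -> z != p.-1 -> z != p.+1 -> hst p z = 0.
  move=> pt z zN zp zp1 zp2; have pN : p < N by move: pt tN; clear; lia.
  case: (eqVneq z N) => [->|zN'].
    rewrite hstC; last by move: pN; clear; lia.
    apply/eqP; rewrite -leqn0 leqNgt; apply/negP => /(F2 pN).
    by move: pt ti; clear; lia.
  have {}zN : z < N by move: zN zN'; clear; lia.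
  have pz : p != z by rewrite eq_sym.
  apply/eqP; rewrite -leqn0; apply: leq_trans (F1 pN zN pz) _; rewrite /adj.
  by move: zp1 zp2 t1 pt; clear; lia.
have e0 : hst t t.-1 = 1.
  rewrite hstC; last by move: t1; clear; lia.
  by rewrite -{2}(prednK t1); apply: hst_path; move: t1 tN ti; clear; lia.
have e1 : hst t t.+1 = 1 by apply: hst_path; move: tN ti; clear; lia.
have e2 : hst t.+1 t.+2 = 1 by apply: hst_path; move: tN ti; clear; lia.
have tx : t != x by rewrite eq_sym.
have t1x : t.+1 != x by rewrite eq_sym.
have M1 : M t t.+1 = 1 by rewrite -hst_eq.
(* an outer neighbour of t or t+1 may have been replaced by its split twin N+1 *)
have outer p q : (p == t) || (p == t.+1) -> p != x -> q <= N -> p != q -> hst p q = 1 ->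
    exists2 r, (r == q) || (r == N.+1) && (x == q) &
      M r p = 1 /\ forall z, (z == q) || (z == N.+1) && (x == q) -> z != r -> M p z = 0.
  move=> pt px qN pq h; case: (eqVneq q x) => qx; last first.
    exists q; first by rewrite eqxx.
    split; first by rewrite MC -hst_eq.
    by move=> z; rewrite andbF orbF => /eqP ->; rewrite eqxx.
  have : M p x + M p N.+1 = 1 by move: h; rewrite /hst /merge_mult (negbTE px) qx eqxx.
  subst q; case E: (M p x) => [|[|//]].
    rewrite add0n => e; exists N.+1; first by rewrite eqxx orbT.
    by rewrite MC; split=> // z; rewrite andbT => /orP [] /eqP -> //; rewrite eqxx.
  rewrite addSn => -[e]; exists x; first by rewrite eqxx.
  by rewrite MC; split=> // z; rewrite andbT => /orP [] /eqP -> //; rewrite eqxx.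
have p0 : (t == t) || (t == t.+1) by rewrite eqxx.
have p1 : (t.+1 == t) || (t.+1 == t.+1) by rewrite eqxx orbT.
have [|||a aE [Ma za]] := outer t t.-1 p0 tx; [by move: tN; clear; lia|by move: t1; clear; lia|by []|].
have [|||b bE [Mb zb]] := outer t.+1 t.+2 p1 t1x; [by move: tN; clear; lia|by clear; lia|by []|].
have far p z : (p == t) || (p == t.+1) -> p != x -> z != p -> z != p.-1 -> z != p.+1 ->
    ~~ ((z == N.+1) && ((x == p.-1) || (x == p.+1))) -> M p z = 0.
  move=> pt px zp zp1 zp2 zN; case: (leqP z N) => zN'.
    apply/eqP; rewrite -leqn0 -(out p pt z zN' zp zp1 zp2); apply: hst_ge => //; first by rewrite eq_sym.
    by move: pt tN; clear; lia.
  case: (eqVneq z N.+1) => [e|ne]; last by apply: Mout; move: zN' ne; clear; lia.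
  rewrite e eqxx /= negb_or in zN; case/andP: zN => xp1 xp2.
  have pN : p <= N by move: pt tN; clear; lia.
  apply/eqP; rewrite e MC -leqn0 -(out p pt x xN _ xp1 xp2) 1?eq_sym //.
  by rewrite hstC //; apply: hst_geN.
apply: (@minimal_no_series G a t t.+1 b) => //.
- move=> z zna znt; case: (boolP ((z == t.-1) || (z == N.+1) && (x == t.-1))) => [/za /(_ zna)|ne] //.
  case: (eqVneq z t) => [->|zt]; first exact: muii.
  by apply: far => //; move: ne znt xt1; clear; lia.
- move=> z znt znb; case: (boolP ((z == t.+2) || (z == N.+1) && (x == t.+2))) => [/zb /(_ znb)|ne] //.
  case: (eqVneq z t.+1) => [->|zt]; first exact: muii.
  by apply: far => //; move: ne znt xt; clear; lia.
- by rewrite -/M MC.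
(* An edge between [a] and [b] would survive the merging as one between [t.-1] and [t.+2], which are
   not adjacent in the host. *)
- have tN0 : t.-1 < N by move: tN; clear; lia.
  have tt : t.-1 != t.+2 by clear; lia.
  have h0 : hst t.-1 t.+2 = 0.
    by apply/eqP; rewrite -leqn0; apply: leq_trans (F1 tN0 tN tt) _; rewrite /adj; move: t1; clear; lia.
  apply/eqP; rewrite -leqn0 -h0.
  case/orP: aE => [/eqP -> | /andP [/eqP -> /eqP xa]]; case/orP: bE => [/eqP ->|/andP [/eqP -> /eqP xb]].
  + by apply: hst_ge => //; apply: ltnW.
  + rewrite -/M MC hstC // -xb; apply: hst_geN; last exact: ltnW.
    by rewrite xb.
  + by rewrite -xa; apply: hst_geN; [rewrite xa eq_sym | apply: ltnW].
  + by exfalso; move: xa xb; clear; lia.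
- by move: bE tN xt; clear; lia.
- by move: aE tN xt1 t1; clear; lia.
- by move: aE bE tN t1; clear; lia.
Qed.

Let seriesI t : 0 < t -> t.+2 < N -> (t.+1 < i) || (i.+1 < t) -> x != t -> x != t.+1 -> False.
Proof.
move=> t1 tN ti xt xt1; have /negP := negbT no_series; apply.
rewrite /series lazy_hasE; apply/hasP; exists t; last by rewrite ti xt.
by rewrite mem_iota; move: t1 tN; clear; lia.
Qed.

Let i_lt5 : i < 5.
Proof.
rewrite ltnNge; apply/negP => i5; have N5 : 5 < N := leq_ltn_trans i5 iN.
case: (boolP ((x == 1) || (x == 2))) => x12.
  by apply: (@seriesI 3); move: x12 i5 N5; clear; lia.
by apply: (@seriesI 1); move: x12 i5 N5; clear; lia.
Qed.

Let r_lt6 : N - i.+1 < 6.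
Proof.
rewrite ltnNge; apply/negP => r6; have N7 : i + 7 <= N by move: r6; clear; lia.
case: (boolP ((x == N - 3) || (x == N - 2))) => x12.
  by apply: (@seriesI (N - 5)); move: x12 N7; clear; lia.
by apply: (@seriesI (N - 3)); move: x12 N7; clear; lia.
Qed.

Let z1 := if x == N then i else x.-1.
Let z2 := if x == N then i.+1 else x.+1.
Let bd z := if (z == x) || (N < z) then 0 else host N i bit m1 m2 x z.
(** The split that recovers [G]: the edges to move are those of [N.+1] in [G] other than its edge to
    [x]. *)
Let d z := if (z == x) || (N < z) then 0 else M N.+1 z.
Let D := Dof z1 z2 N (d z1) (d z2) (d N).

Let d_bd z : d z <= bd z.
Proof.
rewrite /d /bd; case: ifP => // /negbT; rewrite negb_or -leqNgt => /andP [zx zN].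
by rewrite -hstE // 1?eq_sym //; apply: hst_geN.
Qed.

Let DE z : z <= N -> z != x -> D z = M N.+1 z.
Proof.
move=> zN zx; have dE : d z = M N.+1 z by rewrite /d (negbTE zx) ltnNge zN.
rewrite /D /Dof; case: eqP => [<-//|n1]; case: eqP => [<-//|n2]; case: eqP => [e|n3]; first by rewrite -dE e.
apply/esym/eqP; rewrite -leqn0; apply: leq_trans (hst_geN zx zN) _.
rewrite hstE 1?eq_sym // /host; move: n1 n2 n3 zx zN xN; rewrite /z1 /z2; clear.
case: (eqVneq x N) => xN; case: (ltnP x z) => xz; repeat (case: eqP => ?); lia.
Qed.

Let codeE u v : u < v -> v < N.+2 -> unmerge N x (host N i bit m1 m2) D u v = M u v.
Proof.
move=> uv vN; rewrite /unmerge; have uN : u <= N by move: uv vN; clear; lia.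
case: (eqVneq v N.+1) => [->|vN'].
  by case: (eqVneq u x) => [->//|ux]; rewrite DE // MC.
have {}vN : v <= N by move: vN vN'; clear; lia.
have ne : u != v by move: uv; clear; lia.
rewrite -hstE //; case: (eqVneq u x) => ux.
  rewrite DE //; last by rewrite -ux eq_sym.
  by rewrite /hst /merge_mult ux eqxx addnK.
case: (eqVneq v x) => vx; last exact: hst_eq.
by rewrite DE // /hst /merge_mult (negbTE ux) vx eqxx [M u N.+1]MC addnK.
Qed.

Let hst_le4 k l : k <= N -> l <= N -> hst k l <= 4.
Proof.
have M2 u v : M u v <= 2 by apply: minimal_mult_le2.
move=> _ _; rewrite /hst /merge_mult; have := M2 k l; have := M2 x l; have := M2 N.+1 l.
have := M2 k x; have := M2 k N.+1; clear; ifs_lia.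
Qed.

Lemma split_host_listed : listed G.
Proof.
apply: (@iso_check_listed _ (graph_of_mult N.+2 (unmerge N x (host N i bit m1 m2) D)) mG).
  by apply: (@iso_graph_of_mult _ _ _ id) => // u v uv vN; apply: codeE.
have bit1 : bit < 2.
  rewrite /bit; case: ifP => // iN'; have ne : i != i.+1 by clear; lia.
  by have := F1 iN iN' ne; case: (adj _ _); clear; lia.
have := check_all_hosts_true; rewrite /check_all_hosts lazy_allE => /allP /(_ i).
rewrite mem_iota lazy_allE => /(_ i_lt5) /allP /(_ (N - i.+1)).
rewrite mem_iota subnKC // /check_hosts lazy_allE => /(_ r_lt6) /allP /(_ x).
rewrite mem_iota no_series lazy_allE => /(_ xN) /allP /(_ bit).
rewrite mem_iota lazy_allE => /(_ bit1) /allP /(_ m1).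
rewrite mem_iota lazy_allE add0n ltnS hst_le4 ?(ltnW iN) // => /(_ isT) /allP /(_ m2).
have -> : m2 \in (if i.+1 < N then iota 0 5 else [:: 0]).
  by rewrite /m2; case: ifP => iN' //; rewrite mem_iota /= ltnS hst_le4.
move=> /(_ isT); rewrite m_pos /=.
have -> : (i.+1 < N) ==> (0 < bit + minn m1 m2) by apply/implyP.
rewrite /check_splits -/z1 -/z2 lazy_allE => /allP /(_ (d z1)).
rewrite mem_iota add0n ltnS lazy_allE => /(_ (d_bd z1)) /allP /(_ (d z2)).
rewrite mem_iota add0n ltnS lazy_allE => /(_ (d_bd z2)) /allP /(_ (d N)).
rewrite mem_iota add0n ltnS => /(_ (d_bd N)); rewrite /check_code -/D.
case: ifP => // /negP []; rewrite lazy_allE; apply/allP => k; rewrite mem_iota => kN.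
rewrite lazy_allE; apply/allP => l; rewrite mem_iota => lN.
by rewrite codeE; [apply: minimal_mult_le2 | move: kN lN; clear; lia | move: kN lN; clear; lia].
Qed.

End SplitHost.

Lemma listed_iso G H : wf G -> iso G H -> listed H -> listed G.
Proof.
move=> wG i; have tr X : iso H X -> iso G X by apply: iso_trans.
rewrite /listed; repeat (case=> [/tr|]; first by tauto); move/tr; tauto.
Qed.

Lemma minimal_connected G (S : pred nat) u v : minimal_obstruction G -> ~ listed G ->
  u < gn G -> v < gn G -> S u -> ~~ S v ->
  exists u' v', [/\ u' < gn G, v' < gn G, S u', ~~ S v' & 0 < mu G u' v'].
Proof.
move=> mG nL un vn Su Sv.
case: (boolP (has (fun u' => has (fun v' => [&& S u', ~~ S v' & 0 < mu G u' v'])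
  (iota 0 (gn G))) (iota 0 (gn G)))).
  move=> /hasP [u']; rewrite mem_iota => /andP [_ un'] /hasP [v']; rewrite mem_iota => /andP [_ vn'].
  by case/and3P => *; exists u', v'.
move/hasPn => no; case: nL; apply: (minimal_disconnected mG un vn Su Sv) => u' v' un' vn' Su' Sv'.
have := no u'; rewrite mem_iota => /(_ un') /hasPn /(_ v'); rewrite mem_iota => /(_ vn').
by rewrite Su' Sv' /= -leqNgt leqn0 => /eqP.
Qed.

Lemma minimal_simple_edge G a b : minimal_obstruction G -> mu G a b = 1 -> listed G.
Proof.
move=> mG mab; have [L|nL] := classic (listed G); first by [].
have wG : wf G by case: mG.
have /and3P [an bn ab] : [&& a < gn G, b < gn G & a != b] by apply: mu_pos; rewrite ?mab.
pose m' p q := merge_mult a b (mu G) (bump b p) (bump b q).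
have c' : one_spectator_on (fun p => p < (gn G).-1) m'.
  apply: (@one_spectator_sub _ _ _ _ (bump b)) (minimal_contract mG mab) => // [p pn|p q _ _].
    by rewrite bump_lt ?bump_neq.
  exact: (can_inj (bumpK b)).
have n1 : 0 < (gn G).-1 by move: an bn ab; clear; lia.
have [w0 [s0 [i [wn ps [l1 l2] is0]]]] := one_spectator_linear_order n1 c'.
pose N := size s0.
have nG : gn G = N.+2.
  rewrite /N (perm_size ps) size_rem ?mem_iota // size_iota; move: n1; clear; lia.
have sP z : (z \in s0) = (z < (gn G).-1) && (z != w0).
  by rewrite (perm_mem ps) mem_rem_uniq ?iota_uniq // inE mem_iota andbC.
have us : uniq s0 by rewrite (perm_uniq ps) rem_uniq ?iota_uniq.
(* The default value [w0] makes [q N] the spectator. *)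
pose q k := nth w0 s0 k.
have qn k : q k < (gn G).-1.
  rewrite /q; case: (ltnP k N) => kN; last by rewrite nth_default.
  by have := mem_nth w0 kN; rewrite sP => /andP [].
have qs k : k < N -> q k = nth 0 s0 k by move=> kN; apply: set_nth_default.
have qN : q N = w0 by rewrite /q nth_default.
have q_inj k l : k <= N -> l <= N -> q k = q l -> k = l.
  have lw j : j < N -> q j != w0 by move=> jN; have := mem_nth w0 jN; rewrite sP => /andP [].
  move=> kN lN; case: (eqVneq k N) => [->|kN1]; case: (eqVneq l N) => [->|lN1] //.
  - have {}lN : l < N by rewrite ltn_neqAle lN1.
    by move=> e; move: (lw l lN); rewrite -e qN eqxx.
  - have {}kN : k < N by rewrite ltn_neqAle kN1.
    by move=> e; move: (lw k kN); rewrite e qN eqxx.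
  - have {}lN : l < N by rewrite ltn_neqAle lN1.
    have {}kN : k < N by rewrite ltn_neqAle kN1.
    by move/eqP; rewrite /q nth_uniq // => /eqP.
(* [bump b] returns from the contracted graph to the names in [G]; the end [b] that disappeared
   becomes [N.+1]. *)
pose h k := if k <= N then bump b (q k) else b.
have hb k : k <= N -> h k = bump b (q k) by rewrite /h => ->.
have hN1 : h N.+1 = b by rewrite /h ltnn.
have hn k : h k < N.+2.
  by rewrite -nG /h; case: ifP => // _; apply: bump_lt => //; apply: qn.
have h_inj k l : k < N.+2 -> l < N.+2 -> h k = h l -> k = l.
  move=> kN lN; rewrite /h; case: (leqP k N) => kN'; case: (leqP l N) => lN'.
  - by move/(can_inj (bumpK b)); apply: q_inj.
  - by move/eqP; rewrite (negbTE (bump_neq _ _)).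
  - by move/eqP; rewrite eq_sym (negbTE (bump_neq _ _)).
  - by move=> _; move: kN kN' lN lN'; clear; lia.
pose H := graph_of_mult N.+2 (fun u v => mu G (h u) (h v)).
have iH : iso G H by apply: (@iso_graph_of_mult _ _ _ h) => // u v un vn; apply: h_inj.
have mH := minimal_obstruction_iso iH mG; have wH : wf H by case: mH.
have muH u v : u < N.+2 -> v < N.+2 -> mu H u v = mu G (h u) (h v).
  move=> un vn; case: (ltngtP u v) => [uv|vu|->].
  - exact: mu_graph_of_mult.
  - by rewrite muC mu_graph_of_mult // muC.
  - by rewrite !muii.
have nLH : ~ listed H by move/(listed_iso wG iH).
have [x xN hx] : exists2 x, x <= N & h x = a.
  have [||x xn hx] := inj_surj (n := N.+2) (f := h) (fun k _ => hn k) _ (y := a).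
  - exact: h_inj.
  - by rewrite -nG.
  have xN : x != N.+1 by apply: contraNneq ab => e; rewrite -hx e hN1.
  by exists x => //; move: xn xN; clear; lia.
have xN2 : x < N.+2 by move: xN; clear; lia.
have mrgE k l : k <= N -> l <= N -> merge_mult x N.+1 (mu H) k l = m' (q k) (q l).
  move=> kN lN; have kN2 : k < N.+2 by move: kN; clear; lia.
  have lN2 : l < N.+2 by move: lN; clear; lia.
  have xE j : j <= N -> (bump b (q j) == a) = (j == x).
    move=> jN; rewrite -hb // -hx; apply/eqP/eqP => [|->//]; apply: h_inj => //.
    by move: jN; clear; lia.
  by rewrite /m' /merge_mult !xE // !muH // hx hN1 !hb.
(* For [N = 0] the contracted graph is one vertex, so [G] is a single edge and lies in the class. *)
case: (posnP N) => [N0|Npos].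
  have x0 : x = 0 by move: xN; rewrite N0; clear; lia.
  have : one_spectator H; last by case: mH => _ nH _ /nH.
  apply/(one_spectatorbP wH); suff -> : H = MGraph 2 [:: (0,1)] by [].
  have h0 : h 0 = a by rewrite -x0 hx.
  have h1 : h 1 = b by move: hN1; rewrite N0.
  by rewrite /H N0 /graph_of_mult /= h0 h1 mab.
apply: listed_iso iH _ => //; apply: (@split_host_listed H N x i) => //.
- exact: is0.
- by move=> S u v un vn Su Sv; apply: (@minimal_connected H) mH nLH un vn Su Sv.
- by rewrite muH // hx hN1.
- by move=> k l kN lN kl; rewrite mrgE ?(ltnW kN) ?(ltnW lN) // !qs //; apply: l1.
- by move=> k kN; rewrite mrgE ?(ltnW kN) // qN qs //; apply: l2.
Qed.

(** * Obstructions with every edge doubled *)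

Lemma all_bitsP k p bs : all_bits k p -> size bs = k -> p bs.
Proof.
elim: k p bs => [|k IH] p [|b bs] //= h [sb]; move: h; case: ifP => // h1 h2.
by case: b; [exact: (IH (fun bs => p (true :: bs))) | exact: (IH (fun bs => p (false :: bs)))].
Qed.

(** Delete one copy of an edge from 0 to [y]. Pairs other than 0, [y] keep at least two edges if
    they have any, too many for the line. So a vertex other than 0, [y] and the spectator is joined
    to the spectator and sits at [i] or [i.+1], which leaves 2 + 1 + 2 vertices. *)
Lemma minimal_doubled_small G : minimal_obstruction G -> (forall u v, mu G u v != 1) -> gn G <= 5.
Proof.
move=> mG no1; have wG : wf G by case: mG.
have n0 : 0 < gn G by case: wG.
have [y m0] := minimal_not_isolated mG n0; have /and3P [_ yn y0] := mu_pos wG m0.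
have [W [i [pos [h1 h2 h3 h4]]]] := minimal_del_edge mG m0.
have slot z : z < gn G -> z != 0 -> z != y -> ~~ W z -> (pos z == i) || (pos z == i.+1).
  move=> zn z0 zy Wz; have [t mz] := minimal_not_isolated mG zn; have /and3P [_ tn zt] := mu_pos wG mz.
  have m2 : 1 < mu G z t by rewrite ltn_neqAle eq_sym no1.
  have E : (enorm (0, y) == enorm (z, t)) = false.
    by rewrite enorm_eq eq_sym (negbTE z0) [y == z]eq_sym (negbTE zy) !andbF.
  case: (boolP (W t)) => Wt.
    by have := h4 t z tn zn Wt Wz; rewrite muC (enormC t) E subn0; apply.
  have := h3 z t zn tn Wz Wt zt; rewrite E subn0; case: (adj _ _); move: m2; clear; lia.
pose c z := if z == 0 then 0 else if z == y then 1 else if W z then 2 else if pos z == i then 3 else 4.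
have cn z : c z < 5 by rewrite /c; repeat case: ifP.
have ci : {in iota 0 (gn G) &, injective c}.
  move=> p q; rewrite !mem_iota !add0n /= => pn qn; rewrite /c.
  case: (eqVneq p 0) => p0; case: (eqVneq q 0) => q0; rewrite ?p0 ?q0 //;
    try by repeat case: ifP.
  case: (eqVneq p y) => py; case: (eqVneq q y) => qy; rewrite ?py ?qy //;
    try by repeat case: ifP.
  case: (boolP (W p)) => Wp; case: (boolP (W q)) => Wq; try by repeat case: ifP.
    by move=> _; apply: h1.
  have sp := slot p pn p0 py Wp; have sq := slot q qn q0 qy Wq => e.
  apply: h2 => //; move: sp sq e; case: (eqVneq (pos p) i) => ep; case: (eqVneq (pos q) i) => eq //=.
    by rewrite ep eq.
  by move=> /eqP -> /eqP ->.
rewrite -[gn G](size_iota 0) -(size_map c) -[5](size_iota 0).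
apply: uniq_leq_size; first by rewrite map_inj_in_uniq ?iota_uniq.
by move=> _ /mapP [z _ ->]; rewrite mem_iota cn.
Qed.

Lemma minimal_doubled G : minimal_obstruction G -> (forall u v, mu G u v != 1) -> listed G.
Proof.
move=> mG no1; have wG : wf G by case: mG.
have n0 : 0 < gn G by case: wG.
have n5 := minimal_doubled_small mG no1; set n := gn G in n0 n5.
(* The pairs on five vertices in the order of the rank [tri v + u]; the first [tri n] of them are
   the pairs below [n]. *)
pose pairs := [:: (0,1); (0,2); (1,2); (0,3); (1,3); (2,3); (0,4); (1,4); (2,4); (3,4)].
pose bs := [seq 0 < mu G p.1 p.2 | p <- take (tri n) pairs].
have bsE u v : u < v -> v < n -> (nth false bs (tri v + u)).*2 = mu G u v.
  move=> uv vn.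
  have vt : tri v + u < tri n.
    by move: uv vn n5; clear; move: n => [|[|[|[|[|[|k]]]]]] //; move: v => [|[|[|[|[|v]]]]] //;
      rewrite /tri /=; clear; lia.
  have tn : tri n <= 10 by move: n5; clear; move: n => [|[|[|[|[|[|k]]]]]] //.
  rewrite (nth_map (0,0)); last by rewrite size_take_min leq_min vt /= (leq_trans vt).
  rewrite nth_take //.
  have -> : nth (0,0) pairs (tri v + u) = (u, v).
    have v5 := leq_trans vn n5.
    by move: uv v5; clear; move: v => [|[|[|[|[|v]]]]] //; move: u => [|[|[|[|u]]]].
  have := minimal_mult_le2 u v mG; have := no1 u v => /=; case: (mu G u v) => [|[|[|k]]] //.
have hs : check_doubled n bs.
  apply: (@all_bitsP (tri n)); last first.
    rewrite size_map size_take_min; apply/minn_idPl.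
    by move: n5; clear; move: n => [|[|[|[|[|[|k]]]]]] //.
  have := check_all_doubled_true; rewrite /check_all_doubled lazy_allE => /allP; apply.
  by rewrite mem_iota n0 ltnS.
pose m u v := (nth false bs (tri v + u)).*2.
have {hs} : if lazy_all (fun u =>
      lazy_has (fun v => (if u < v then m u v else m v u) != 0) (rem u (iota 0 n))) (iota 0 n)
  then check_listed (graph_of_mult n m) else true by exact: hs.
case: ifP => [_|/negP []].
  apply: (@iso_check_listed _ _ mG); apply: (@iso_graph_of_mult _ _ _ id) => // u v uv vn; exact: bsE.
rewrite lazy_allE; apply/allP => u; rewrite mem_iota add0n => /andP [_ un]; rewrite lazy_hasE; apply/hasP.
have [v muv] := minimal_not_isolated mG un; have /and3P [_ vn uv] := mu_pos wG muv.
exists v; first by rewrite mem_rem_uniq ?iota_uniq // inE eq_sym uv mem_iota.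
by case: (ltngtP u v) uv => // lt _; rewrite /m bsE // -?lt0n // muC.
Qed.

Theorem minimal_obstruction_listed G : minimal_obstruction G -> listed G.
Proof.
move=> mG; case: (boolP (has (fun u => has (fun v => mu G u v == 1) (iota 0 (gn G))) (iota 0 (gn G)))).
  by move=> /hasP [u _ /hasP [v _ /eqP]]; apply: minimal_simple_edge.
move/hasPn => no; apply: minimal_doubled => // u v; apply/eqP => m1.
have /and3P [un vn _] : [&& u < gn G, v < gn G & u != v].
  by apply: mu_pos; [case: mG | rewrite m1].
have := no u; rewrite mem_iota => /(_ un) /hasPn /(_ v); rewrite mem_iota => /(_ vn).
by rewrite m1.
Qed.

(** * Unique shortest paths *)

(** The start [x] is kept apart, so that vertices and edges run in step and walks can be
    concatenated. *)
Fixpoint walk (G : mgraph) (x : nat) (vs es : seq nat) : bool :=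
  match vs, es with
  | [::], [::] => true
  | y :: vs', e :: es' => joins G e x y && walk G y vs' es'
  | _, _ => false
  end.

Lemma walkP G x vs es : walk G x vs es <-> size vs = size es /\
  forall i, i < size es -> joins G (nth 0 es i) (nth 0 (x :: vs) i) (nth 0 (x :: vs) i.+1).
Proof.
elim: vs es x => [|y vs IH] [|e es] x /=; try by split=> // -[].
split=> [/andP [j /IH [-> h]]|[[s] h]]; first by split=> // -[|i] //= hi; apply: h.
by rewrite (h 0) //=; apply/IH; split=> // i hi; apply: (h i.+1).
Qed.

Lemma walk_cat G x vs1 vs2 es1 es2 : size vs1 = size es1 ->
  walk G x (vs1 ++ vs2) (es1 ++ es2) = walk G x vs1 es1 && walk G (last x vs1) vs2 es2.
Proof. by elim: vs1 es1 x => [|y vs1 IH] [|e es1] x //= [s]; rewrite IH // andbA. Qed.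

Lemma is_pathP G u v vs es : is_path G u v vs es <->
  exists vs', [/\ vs = u :: vs', last u vs' = v, uniq vs, all (fun x => x < gn G) vs & walk G u vs' es].
Proof.
split.
  case=> -[s hu hv hq] [ha hj]; case: vs s hu hv hq ha hj => // x vs [s] /= xu hv hq ha hj; subst x.
  exists vs; split=> //; first by rewrite -hv -s -[in RHS](last_nth 0) .
  by apply/walkP; split.
case=> vs' [-> hv hq ha /walkP [s h]]; split=> //; split=> //=; first by rewrite s.
by rewrite -s -(last_nth 0).
Qed.

Lemma joinsP G e x y : joins G e x y <-> e < size (ge G) /\ enorm (nth (0,0) (ge G) e) = enorm (x, y).
Proof.
rewrite /joins; case: (nth _ _ _) => p q; rewrite !xpair_eqE; split.
  by case/andP => h1 h2; split=> //; apply/eqP; rewrite enorm_eq.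
by case=> -> /eqP; rewrite enorm_eq.
Qed.

(** Replacing the stretch [V2] by vertices off the path gives another path with the same ends;
    shortness and uniqueness are then applied to it. *)
Lemma usp_splice G u v V1 V2 V3 E1 E2 E3 y ms ds :
  is_usp G u v (u :: V1 ++ rcons V2 y ++ V3) (E1 ++ E2 ++ E3) ->
  size V1 = size E1 -> size E2 = (size V2).+1 ->
  walk G (last u V1) (rcons ms y) ds ->
  uniq ms -> all (fun z => (z < gn G) && (z \notin u :: V1 ++ rcons V2 y ++ V3)) ms ->
  size V2 <= size ms /\ (size V2 = size ms -> V2 = ms /\ E2 = ds).
Proof.
move=> [/is_pathP [vs' [[<-] lv uq ha hw]] short uniq_] s1 s2 hd um hm.
have sd : size ds = (size ms).+1 by have [<- _] := proj1 (walkP _ _ _ _) hd; rewrite size_rcons.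
have p : is_path G u v (u :: V1 ++ rcons ms y ++ V3) (E1 ++ ds ++ E3).
  apply/is_pathP; exists (V1 ++ rcons ms y ++ V3); split=> //.
  - by rewrite -lv !last_cat !last_rcons.
  - have sub : subseq (u :: V1 ++ y :: V3) (u :: V1 ++ rcons V2 y ++ V3).
      by rewrite /= eqxx cat_rcons; apply: cat_subseq => //; apply: suffix_subseq.
    have pe : perm_eq (u :: V1 ++ rcons ms y ++ V3) (ms ++ (u :: V1 ++ y :: V3)).
      by rewrite -!cat_cons cat_rcons perm_catCA.
    rewrite (perm_uniq pe) cat_uniq um (subseq_uniq sub uq) andbT.
    apply/hasPn => z /(mem_subseq sub) zo; apply/negP => /(allP hm) /andP [_]; by rewrite zo.
  - move: ha; rewrite /= !all_cat !all_rcons => /and3P [-> -> /andP [/andP [-> _] ->]].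
    rewrite !andbT; apply/allP => z /(allP hm) /andP [] //.
  - move: hw; rewrite !walk_cat //; last by rewrite size_rcons.
      by rewrite !last_rcons => /and3P [-> _ ->]; rewrite hd.
    by rewrite size_rcons sd.
have := short _ _ p; rewrite /= !size_cat !size_rcons => le; split.
  by move: le; clear; lia.
move=> e; have [|ev ee] := uniq_ _ _ p; first by rewrite /= !size_cat !size_rcons e.
move: ev => [/eqP]; rewrite eqseq_cat // eqxx /= eqseq_cat ?size_rcons ?e //.
case/andP => /eqP /rcons_inj [->] _; split=> //; move/eqP: ee.
by rewrite eqseq_cat // eqxx /= eqseq_cat ?s2 ?sd ?e // => /andP [/eqP -> _].
Qed.

Lemma split_at (s : seq nat) p q : p < q -> q < size s ->
  exists V1 V2 V3, [/\ behead s = V1 ++ rcons V2 (nth 0 s q) ++ V3, size V1 = p,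
     (size V2).+1 = q - p & last (head 0 s) V1 = nth 0 s p].
Proof.
case: s => // u s pq; rewrite ltnS /= => qs.
exists (take p s), (take (q.-1 - p) (drop p s)), (drop q s).
have q0 : 0 < q by apply: leq_ltn_trans pq.
have pq1 : p <= q.-1 by rewrite -ltnS prednK.
have q1s : q.-1 < size s by rewrite prednK.
split.
- have -> : nth 0 (u :: s) q = nth 0 s q.-1 by rewrite -{1}(prednK q0).
  rewrite -{1}(cat_take_drop p s); congr (_ ++ _).
  rewrite -{1}(cat_take_drop (q.-1 - p) (drop p s)) drop_drop subnK //.
  by rewrite (drop_nth 0 q1s) prednK // cat_rcons.
- by rewrite size_takel // (leq_trans pq1) // ltnW.
- rewrite size_takel; first by move: pq; clear; lia.
  by rewrite size_drop leq_sub2r // ltnW.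
- rewrite (last_nth 0) size_takel; last by rewrite (leq_trans pq1) // ltnW.
  by case: (p) => //= p'; rewrite nth_take.
Qed.

(** At equal length a detour must coincide with the stretch it replaces, so it cannot have an inner
    vertex off the path. *)
Lemma usp_detour G u v vs es p q ms ds : is_usp G u v vs es -> p < q -> q < size vs ->
  walk G (nth 0 vs p) (rcons ms (nth 0 vs q)) ds ->
  uniq ms -> all (fun z => (z < gn G) && (z \notin vs)) ms ->
  q - p <= size ds /\ (q - p = size ds -> ds = take (q - p) (drop p es) /\ (0 < size ms -> False)).
Proof.
move=> h pq qs hd um hm.
have [/is_pathP [vs' [evs lv uq ha hw]] _ _] := h.
have [ss _] := proj1 (walkP _ _ _ _) hw.
have [V1 [V2 [V3 [eV s1 s2 l1]]]] := split_at pq qs.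
subst vs; rewrite /= in eV l1; rewrite eV in h hm ss.
have se : q <= size es by rewrite -ss -eV; move: qs; rewrite /= ltnS.
have sd : size ds = (size ms).+1 by have [<- _] := proj1 (walkP _ _ _ _) hd; rewrite size_rcons.
have ee : es = take p es ++ take (q - p) (drop p es) ++ drop q es.
  by rewrite -{1}(cat_take_drop p es) -{1}(cat_take_drop (q - p) (drop p es)) drop_drop subnK // ltnW.
rewrite ee in h; have sE1 : size (take p es) = p by rewrite size_takel // (leq_trans (ltnW pq)).
have sE2 : size (take (q - p) (drop p es)) = q - p by rewrite size_takel // size_drop leq_sub2r.
have [|||] := usp_splice h _ _ _ um hm (ds := ds).
- by rewrite s1.
- by rewrite sE2.
- by rewrite l1.
move=> le eq; split; first by rewrite sd -s2 ltnS.
move=> e; have [|e1 e2] := eq; first by apply/eqP; rewrite -eqSS s2 e sd.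
split=> // m0; case: ms m0 e1 hm {hd um sd le eq} => // z ms _ e1 /= /andP [/andP [_ /negP zn] _]; case: zn.
by rewrite inE !mem_cat mem_rcons inE e1 mem_head !orbT.
Qed.

Lemma mu_two G x y : 1 < mu G x y -> exists i j, [/\ i != j, joins G i x y & joins G j x y].
Proof.
move=> m2; have [i hi ei] := mu_index (ltnW m2).
have : mu G (nth (0,0) (ge G) i).1 (nth (0,0) (ge G) i).2 = mu G x y.
  by rewrite /mu -ei -surjective_pairing.
rewrite mu_nth // => e; have : 0 < count (fun d => enorm d == enorm (nth (0, 0) (ge G) i)) (drop_edge (ge G) i).
  by move: e m2; clear; lia.
rewrite -has_count => /hasP [d /mem_drop_edgeP [j [hj ji ->]] /eqP ej].
by exists i, j; split; [rewrite eq_sym | apply/joinsP | apply/joinsP; rewrite ej].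
Qed.

Lemma mu_joins G x y : 0 < mu G x y -> exists i, joins G i x y.
Proof. by move/mu_index => [i hi ei]; exists i; apply/joinsP. Qed.

(** The path itself is the line, and the vertex it may miss is the spectator. Detours of one edge
    exclude chords and parallel edges; detours of two edges through the missed vertex force its
    neighbours to be consecutive. *)
Lemma usp_one_spectator G u v vs es : wf G -> is_usp G u v vs es -> gn G <= (size vs).+1 -> one_spectator G.
Proof.
move=> wG h sv; have [/is_pathP [vs' [_ _ uq /allP ha _]] _ _] := h.
have chord p q : p < q -> q < size vs -> mu G (nth 0 vs p) (nth 0 vs q) <= (q == p.+1).
  move=> pq qs; set m := mu G _ _.
  have jE e : joins G e (nth 0 vs p) (nth 0 vs q) -> q = p.+1 /\ [:: e] = take (q - p) (drop p es).
    move=> je; have [|//|//|] := usp_detour h pq qs (ms := [::]) (ds := [:: e]); first by rewrite /= je.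
    rewrite /= => le eq; have q1 : q - p = 1 by move: le pq; clear; lia.
    by have [-> _] := eq q1; split=> //; move: q1 pq; clear; lia.
  rewrite leqNgt; apply/negP => lt.
  have m0 : 0 < m by apply: leq_ltn_trans lt.
  have [e /jE [q1 _]] := mu_joins m0; move: lt; rewrite q1 eqxx => /mu_two [i [j [ij /jE [_ e1] /jE [_ e2]]]].
  by move: ij; rewrite -e2 in e1; case: e1 => ->; rewrite eqxx.
have detour z p q : z < gn G -> z \notin vs -> p < q -> q < size vs ->
    0 < mu G z (nth 0 vs p) -> 0 < mu G z (nth 0 vs q) -> q = p.+1.
  move=> zn zv pq qs /mu_joins [e je] /mu_joins [e' je'].
  have [|//||le eq] := usp_detour h pq qs (ms := [:: z]) (ds := [:: e; e']).
  - by rewrite /= je' andbT; move: je; rewrite /joins andbC orbC andbC => /andP [-> ->].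
  - by rewrite /= zn zv.
  have : q - p != 2 by apply/eqP => /eq [_ /(_ isT)].
  by move: le pq => /=; clear; lia.
have small z z' : z < gn G -> z' < gn G -> z \notin vs -> z' \notin vs -> z = z'.
  move=> zn zn' zv zv'; apply/eqP; apply: contraTT sv => ne; rewrite -ltnNge.
  have := @uniq_leq_size _ [:: z, z' & vs] (iota 0 (gn G)).
  rewrite /= size_iota inE negb_or ne zv zv' uq => /(_ isT); apply.
  by move=> t; rewrite mem_iota !inE => /or3P [/eqP ->|/eqP ->|/ha].
pose nb z := has (fun w => (w \notin vs) && (0 < mu G w z)) (iota 0 (gn G)).
(* The index [i] is that of the first neighbour of the spectator; [detour] puts any other neighbour
   right after it. *)
exists (fun z => z \notin vs), (find nb vs), (fun z => index z vs); split=> x y xn yn; rewrite ?negbK.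
- exact: small.
- by move=> xv yv e; rewrite -(nth_index 0 xv) e nth_index.
- move=> xv yv xy; rewrite -{1}(nth_index 0 xv) -{1}(nth_index 0 yv).
  have hx := xv; have hy := yv; rewrite -index_mem in hx; rewrite -index_mem in hy.
  case: (ltngtP (index x vs) (index y vs)) => [lt|lt|e].
  + by apply: leq_trans (chord _ _ lt hy) _; rewrite /adj orbC; case: eqP.
  + by rewrite muC; apply: leq_trans (chord _ _ lt hx) _; rewrite /adj; case: eqP.
  + by move: xy; rewrite -(nth_index 0 xv) e nth_index // eqxx.
- move=> xv yv m0; have hy := yv; rewrite -index_mem in hy.
  have nby : nb y by apply/hasP; exists x; rewrite ?mem_iota ?xv.
  have hs : has nb vs by apply/hasP; exists y.
  have hk : find nb vs <= index y vs.
    by rewrite leqNgt; apply/negP => /(before_find 0); rewrite nth_index // nby.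
  case: (eqVneq (index y vs) (find nb vs)) => //= ne.
  have lt : find nb vs < index y vs by rewrite ltn_neqAle eq_sym ne.
  have /hasP [w] := nth_find 0 hs; rewrite mem_iota add0n => /andP [_ wn] /andP [wv mw].
  have wx : w = x by apply: small.
  by rewrite (@detour x _ _ xn xv lt hy) ?nth_index // -wx.
Qed.

(* An edge changes h by at most 2, and by 2 only along the path. *)
Lemma usp_potential G N (h : nat -> nat) :
  N < gn G -> N <= size (ge G) ->
  (forall k, k < N -> nth (0,0) (ge G) k = (k, k.+1)) ->
  (forall k, k <= N -> h k = k.*2) ->
  (forall k, N <= k -> k < size (ge G) ->
     let e := nth (0,0) (ge G) k in h e.1 <= (h e.2).+1 /\ h e.2 <= (h e.1).+1) ->
  is_usp G 0 N (iota 0 N.+1) (iota 0 N).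
Proof.
move=> nN sN pe hp he.
have jh e x y : joins G e x y -> h y <= h x + 2 /\ (h y = h x + 2 -> e < N /\ x = e /\ y = e.+1).
  move=> /joinsP [es /eqP]; case: (ltnP e N) => eN.
    rewrite pe // enorm_eq => /orP [] /andP [/eqP <- /eqP <-]; rewrite !hp ?(ltnW eN) //; clear; lia.
  have := he e eN es; case: (nth _ _ _) => a b /= [h1 h2].
  by rewrite enorm_eq => /orP [] /andP [/eqP <- /eqP <-]; move: h1 h2; clear; lia.
have wh vs es x : walk G x vs es -> h (last x vs) <= h x + (size es).*2 /\
   (h (last x vs) = h x + (size es).*2 ->
     es = iota x (size es) /\ vs = iota x.+1 (size es) \/ es = [::] /\ vs = [::]).
  elim: vs es x => [|y vs IH] [|e es] x //=; first by split; [clear; lia | right].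
  case/andP => /jh [le eq] /IH [le' eq']; split; first by move: le le'; clear; lia.
  move=> E; left; have [_ [ex ey]] := eq ltac:(move: E le le'; clear; lia).
  subst x y; case: eq' => [|[-> ->]|[-> ->]] //; first by move: E le le'; clear; lia.
  by rewrite !size_iota.
have path : is_path G 0 N (iota 0 N.+1) (iota 0 N).
  split; first by rewrite !size_iota nth_iota // nth_iota // iota_uniq.
  split; first by apply/allP => x; rewrite mem_iota /= add0n ltnS => xN; apply: leq_ltn_trans nN.
  move=> i; rewrite size_iota => iN; rewrite !nth_iota // ?ltnS ?(ltnW iN) // !add0n.
  by rewrite /joins pe // eqxx (leq_trans iN).
split=> //.
  move=> vs es /is_pathP [vs' [-> lv _ _ hw]]; have [le _] := wh _ _ _ hw.
  have [ss _] := proj1 (walkP _ _ _ _) hw.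
  by rewrite size_iota /= ltnS ss; move: le; rewrite lv !hp //; clear; lia.
move=> vs es /is_pathP [vs' [-> lv _ _ hw]]; rewrite size_iota /= => -[sv].
have [ss _] := proj1 (walkP _ _ _ _) hw; have [_] := wh _ _ _ hw.
rewrite lv !hp // -ss sv add0n => /(_ erefl) [[-> ->]|[e1 e2]] //.
by rewrite e1 e2 -sv e2.
Qed.

(** * Spectator floors and hosts *)

Lemma usp_size G u v vs es : is_usp G u v vs es -> size vs <= gn G.
Proof.
case=> /is_pathP [vs' [_ _ uq /allP ha _]] _ _.
rewrite -(size_iota 0 (gn G)); apply: uniq_leq_size => // x /ha xn.
by rewrite mem_iota.
Qed.

(** Only two sizes are left for the maximum, [gn G] and [size vs], and excluded middle decides
    between them. *)
Lemma parade_ge1 G u v vs es : is_usp G u v vs es -> gn G <= (size vs).+1 ->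
  exists2 m, parade_number G m & gn G <= m.+1.
Proof.
move=> h sv.
have [[u' [v' [vs' [es' [h' e]]]]]|no] :=
  classic (exists u v vs es, is_usp G u v vs es /\ size vs = gn G).
  exists (gn G) => //; split; first by exists u', v', vs', es'.
  exact: usp_size.
exists (size vs) => //; split; first by exists u, v, vs, es.
move=> u' v' vs' es' h'; have := usp_size h'; rewrite leq_eqVlt => /orP [/eqP e|lt].
  by case: no; exists u', v', vs', es'.
by rewrite -ltnS; apply: leq_trans lt sv.
Qed.

(** The host fills in the line to a path 0, ..., N and joins one more vertex to [i] and [i.+1] by
    [K] edges each. As [K] bounds every multiplicity in [G], the graph embeds at its own
    positions. *)
Lemma one_spectator_spectator_le1 G : wf G -> one_spectator G ->
  exists H s, [/\ wf H, minor G H, spectator_number H s & s <= 1].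
Proof.
move=> wG [W [i [pos [h1 h2 h3 h4]]]]; have [B hB] := pos_bound (gn G) pos.
have [N NE] : exists N, N = (B + i).+2 by eexists.
pose K := size (ge G).
pose H := MGraph N.+2 ([seq (j, j.+1) | j <- iota 0 N] ++ (nseq K (i, N.+1) ++ nseq K (i.+1, N.+1))).
have sz : size (ge H) = N + (K + K) by rewrite /= !size_cat size_map size_iota !size_nseq.
have eP k : k < N -> nth (0,0) (ge H) k = (k, k.+1).
  by move=> kN; rewrite /= nth_cat size_map size_iota kN (nth_map 0) ?size_iota // nth_iota.
have eW k : N <= k -> k < size (ge H) ->
    nth (0,0) (ge H) k = (i, N.+1) \/ nth (0,0) (ge H) k = (i.+1, N.+1).
  rewrite sz => Nk ks; rewrite /= nth_cat size_map size_iota ltnNge Nk /= nth_cat size_nseq.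
  case: ifP => kK; first by left; rewrite nth_nseq kK.
  by right; rewrite nth_nseq; case: ifP => //; move: kK Nk ks; clear; lia.
have iN : i.+1 < N by rewrite NE; clear; lia.
have wH : wf H.
  split=> //; apply/(all_nthP (0,0)) => k ks; case: (ltnP k N) => kN.
    by rewrite eP //=; move: kN; clear; lia.
  by case: (eW k kN ks) => -> /=; move: iN; clear; lia.
have usp : is_usp H 0 N (iota 0 N.+1) (iota 0 N).
  (* The spectator gets the value midway between those of [i] and [i.+1], so its edges change the
     potential by 1 only. *)
  apply: (usp_potential (h := fun z => if z <= N then z.*2 else i.*2.+1)) => //.
  - by rewrite sz leq_addr.
  - by move=> k ->.
  - move=> k Nk ks; case: (eW k Nk ks) => -> /=;
    by rewrite ltnn; case: ifP; move: iN; clear; lia.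
have [|m pm sm] := parade_ge1 usp; first by rewrite size_iota.
exists H, (gn H - m); split=> //; last 1 first.
- by move: sm; clear; lia.
- pose g z := if W z then N.+1 else pos z.
  have posN z : z < gn G -> pos z < N by move=> /hB; rewrite NE; clear; lia.
  have mpath p : p.+1 < N -> 0 < mu H p p.+1.
    move=> pN; rewrite /mu -has_count; apply/hasP; exists (p, p.+1) => //.
    by rewrite /= mem_cat map_f // mem_iota /= add0n ltnW.
  have mW p : (p == i) || (p == i.+1) -> K <= mu H p N.+1.
    by case/orP => /eqP ->; rewrite /mu /= !count_cat !count_nseq !eqxx; clear; lia.
  have gmu u v : u < gn G -> v < gn G -> u != v -> mu G u v <= mu H (g u) (g v).
    have K_ge a b : mu G a b <= K by apply: count_size.
    move=> un vn uv; rewrite /g; case: (boolP (W u)) => Wu; case: (boolP (W v)) => Wv.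
    + by move: uv; rewrite (h1 u v) // eqxx.
    + case: (posnP (mu G u v)) => [->//|m0]; rewrite [leqRHS]muC.
      by apply: leq_trans (K_ge _ _) (mW _ _); apply: h4 m0.
    + case: (posnP (mu G u v)) => [->//|m0].
      by apply: leq_trans (K_ge _ _) (mW _ _); apply: h4 Wv Wu _ => //; rewrite muC.
    + apply: leq_trans (h3 u v un vn Wu Wv uv) _; rewrite /adj.
      have pu := posN u un; have pv := posN v vn.
      by case: eqP => [e|_]; [rewrite muC e mpath // -e | case: eqP => [e|//]; rewrite e mpath // -e].
  have gn_lt z : z < gn G -> g z < N.+2.
    by rewrite /g => /posN; case: ifP; clear; lia.
  have g_inj : {in iota 0 (gn G) &, injective g}.
    move=> a b; rewrite !mem_iota /= => an bn; have pa := posN a an; have pb := posN b bn.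
    rewrite /g; case: (boolP (W a)) => Wa; case: (boolP (W b)) => Wb.
    + by move=> _; apply: h1.
    + by move=> e; move: pb; rewrite -e; clear; lia.
    + by move=> e; move: pa; rewrite e; clear; lia.
    + exact: h2.
  apply: (@embedding_minor _ _ (map g (iota 0 (gn G)))) => //.
  + by rewrite size_map size_iota.
  + by rewrite map_inj_in_uniq ?iota_uniq.
  + by apply/allP => y /mapP [z]; rewrite mem_iota /= => zn ->; apply: gn_lt.
  + move=> p q pq qn; have pn := ltn_trans pq qn.
    by rewrite !(nth_map 0) ?size_iota // !nth_iota //; apply: gmu; rewrite // neq_ltn pq.
- by exists m.
Qed.

Lemma not_one_spectator_ge2 G : wf G -> ~ one_spectator G -> forall H s, wf H -> minor G H ->
  spectator_number H s -> 2 <= s.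
Proof.
move=> wG nG H s wH mGH [m [[[u [v [vs [es [h e]]]]] _] ->]].
rewrite ltnNge leq_subLR addn1 -e; apply/negP => le.
by apply: nG; apply: minor_one_spectator mGH _ => //; apply: usp_one_spectator h le.
Qed.

Lemma one_spectator_not_floor2 G : wf G -> one_spectator G -> ~ spectator_floor G 2.
Proof.
move=> wG /(one_spectator_spectator_le1 wG) [H [s [wH mH sH s1]]] [_ /(_ H s wH mH sH)].
by rewrite leqNgt ltnS s1.
Qed.

(* ges are the edges of a graph on N.+3 vertices with unique shortest path 0, ..., N, certified by
   the potential h; us embeds X in it. *)
Definition hostb X N (ges : seq (nat * nat)) us h :=
  let H := MGraph N.+3 ges in
  [&& wfb X, wfb H, size us == gn X, uniq us, all (fun u => u < gn H) us,
      all (fun j => all (fun i => mu X i j <= mu H (nth 0 us i) (nth 0 us j)) (iota 0 j)) (iota 0 (gn X)),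
      take N ges == [seq (k, k.+1) | k <- iota 0 N],
      take N.+1 h == [seq k.*2 | k <- iota 0 N.+1] &
      all (fun e => (nth 0 h e.1 <= (nth 0 h e.2).+1) && (nth 0 h e.2 <= (nth 0 h e.1).+1)) (drop N ges)].

(** The certified path misses two of the [N.+3] vertices. A unique shortest path missing fewer would
    put the host, and with it the minor [X], into the class. *)
Lemma hostb_floor X N ges us h : ~ one_spectator X -> hostb X N ges us h ->
  exists H, [/\ wf H, minor X H & spectator_number H 2].
Proof.
move=> nX /and5P [/wfbP wX /wfbP wH /eqP su uu /and5P [au /allP mX /eqP tg /eqP th /allP dr]].
set H := MGraph N.+3 ges in wH au mX.
have mXH : minor X H.
  apply: (@embedding_minor _ _ us) => // i j ij jX; have := mX j; rewrite mem_iota => /(_ jX) /allP /(_ i).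
  by rewrite mem_iota; apply.
have sN : N <= size ges.
  by have := congr1 size tg; rewrite size_map size_iota size_take_min => <-; apply: geq_minr.
have usp : is_usp H 0 N (iota 0 N.+1) (iota 0 N).
  apply: (usp_potential (h := nth 0 h)) => //=.
  - by rewrite ltnW.
  - by move=> k kN; rewrite -(nth_take (n0 := N)) // tg (nth_map 0) ?size_iota // nth_iota.
  - by move=> k kN; rewrite -(nth_take (n0 := N.+1)) // th (nth_map 0) ?size_iota // nth_iota.
  - move=> k Nk ks; apply/andP; apply: (dr (nth (0,0) ges k)).
    by rewrite -(subnKC Nk) -nth_drop mem_nth // size_drop ltn_sub2r // (leq_ltn_trans Nk).
exists H; split=> //; exists N.+1; split; last by rewrite /= subSS subSn // subSn // subnn.
split; first by exists 0, N, (iota 0 N.+1), (iota 0 N); rewrite size_iota.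
move=> u v vs es hv; rewrite leqNgt; apply/negP => lt.
by apply: nX; apply: minor_one_spectator mXH _ => //; apply: usp_one_spectator hv _.
Qed.

Lemma obstruction_host G : listed G -> exists X H, [/\ iso G X, wf H, minor X H & spectator_number H 2].
Proof.
have wit X N ges us h : obstructionb X -> hostb X N ges us h -> iso G X ->
    exists X H, [/\ iso G X, wf H, minor X H & spectator_number H 2].
  move=> oX hX i; have [_ nX _] := obstruction_minimal oX.
  by have [H [wH mH sH]] := hostb_floor nX hX; exists X, H.
(* The connected graphs are their own hosts, renumbered along the path. Each disjoint union gets one
   extra edge between its components, since a path confined to one component misses too many
   vertices. *)
rewrite /listed; case=> [|[|[|[|[|[|[|[|[|[|]]]]]]]]]].
- exact: (@wit _ 1 [:: (0,1); (0,2); (0,2); (1,3); (1,3)] [:: 0; 2; 1; 3] [:: 0; 2; 0; 2]).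
- exact: (@wit _ 3 [:: (0,1); (1,2); (2,3); (1,4); (3,5); (3,5)]
    [:: 3; 5; 1; 0; 2; 4] [:: 0; 2; 4; 6; 2; 6]).
- exact: (@wit _ 5 [:: (0,1); (1,2); (2,3); (3,4); (4,5); (1,6); (4,7)]
    [:: 1; 0; 2; 6; 4; 3; 5; 7] [:: 0; 2; 4; 6; 8; 10; 2; 8]).
- exact: (@wit _ 1 [:: (0,1); (1,2); (2,3); (3,0)] [:: 0; 1; 2; 3] [:: 0; 2; 2; 1]).
- exact: (@wit _ 0 [:: (0,1); (0,1); (1,2); (1,2); (0,2); (0,2)] [:: 0; 1; 2] [:: 0; 0; 0]).
- exact: (@wit _ 1 [:: (0,1); (0,2); (0,2); (0,3); (0,3)] [:: 0; 2; 3; 1] [:: 0; 2; 0; 0]).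
- exact: (@wit _ 1 [:: (0,1); (1,2); (0,2); (0,3); (0,3)] [:: 0; 1; 2; 3] [:: 0; 2; 1; 0]).
- exact: (@wit _ 2 [:: (0,1); (1,2); (1,3); (1,3); (3,4)] [:: 1; 3; 0; 2; 4] [:: 0; 2; 4; 2; 2]).
- exact: (@wit _ 2 [:: (0,1); (1,2); (1,3); (3,4); (3,4)] [:: 0; 2; 1; 3; 4] [:: 0; 2; 4; 2; 2]).
- exact: (@wit _ 2 [:: (0,1); (1,2); (1,3); (1,4)] [:: 1; 0; 2; 3; 4] [:: 0; 2; 4; 2; 2]).
- exact: (@wit _ 4 [:: (0,1); (1,2); (2,3); (3,4); (2,5); (5,6)]
    [:: 2; 1; 0; 3; 4; 5; 6] [:: 0; 2; 4; 6; 8; 4; 4]).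
Qed.

Lemma minor_iso G X H : wf G -> iso G X -> minor X H -> minor G H.
Proof. by move=> wG i [H' [r i']]; exists H'; split=> //; apply: iso_trans i i'. Qed.

Lemma reach_trans G H K : reach G H -> reach H K -> reach G K.
Proof. by elim=> {G H} // G1 G2 G3 s _ IH /IH; apply: reach_step. Qed.

(** Outside the class every host has at least two spectators, so floor 2 only asks for a host that
    attains this bound. *)
Lemma floor2P G : wf G -> spectator_floor G 2 <->
  ~ one_spectator G /\ exists H, [/\ wf H, minor G H & spectator_number H 2].
Proof.
move=> wG; split=> [f|[nG [H [wH mH sH]]]].
  split; first by move=> cG; apply: one_spectator_not_floor2 f.
  by case: f => -[H [wH [mH sH]]] _; exists H.
split; first by exists H.
exact: not_one_spectator_ge2.
Qed.

Theorem theorem6p10 (G : mgraph) :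
  wf G ->
  (minor_minimal_floor G 2 <->
   (iso G C2_C2 \/ iso G C2_K13 \/ iso G K13_K13 \/ iso G C4 \/ iso G H1 \/
    iso G H2 \/ iso G H3 \/ iso G H4 \/ iso G H5 \/ iso G K14 \/ iso G longY)).
Proof.
move=> wG; rewrite -/(listed G); split=> [[/(floor2P wG) [nG [H [wH mH sH]]] mini]|L].
  (* A graph [G1] one step below [G] and outside the class would also have floor 2, since it is a
     minor of the same host [H]. *)
  apply: minimal_obstruction_listed; split=> // G1 s; apply: NNPP => nG1; have wG1 := step_wf s wG.
  apply: (mini G1 wG1).
    by exists G1, G1; split=> //; split; [exact: reach_refl | exact: iso_refl].
  apply/floor2P => //; split=> //; exists H; split=> //.
  have [G' [r i]] := mH; have [G1' s' i'] := step_iso wG i s.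
  by exists G1'; split=> //; apply: reach_trans r (reach_step s' (reach_refl _)).
have [X [H [i wH mH sH]]] := obstruction_host L.
have [X' /obstruction_minimal mX' i'] := listed_obstruction L.
have [_ nG sG] := minimal_obstruction_iso (iso_sym wG i') mX'.
split; first by apply/floor2P => //; split=> //; exists H; split=> //; apply: minor_iso mH.
move=> G' wG' [G1 [G'' [s [r i'']]]]; apply: one_spectator_not_floor2 => //.
by apply: iso_one_spectator i'' _ => //; apply: reach_one_spectator r (step_wf s wG) (sG _ s).
Qed.
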